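(* Let $m\in\mathbb Z_{\ge3}$ and $k\in\mathbb Z_{\ge0}$. Define $F_{k,m}\in C^\infty(\mathrm{SL}_2(\mathbb R))\cap L^1(\mathrm{SL}_2(\mathbb R))$ by $$F_{k,m}(r_{\theta_1}d_tr_{\theta_2})=e^{-i(m+2k)\theta_1}\,\frac{\tanh^k(t)}{\cosh^m(t)}\,e^{-im\theta_2},\qquad\theta_1,\theta_2\in\mathbb R,\ t\in\mathbb R_{\ge0},$$ where $r_\theta=\begin{pmatrix}\cos\theta&-\sin\theta\\\sin\theta&\cos\theta\end{pmatrix}$ and $d_t=\begin{pmatrix}e^t&0\\0&e^{-t}\end{pmatrix}$. Let $N\in\mathbb Z_{>0}$, and let $\Gamma$ be a subgroup of $\Gamma(N)$ such that $\#(\Gamma\cap\mathrm{SO}_2(\mathbb R))\mid m+2k$. If $$N>\frac{4\,\mathrm M\left(\frac k2+1,\frac m2-1\right)^{\frac12}}{1-\mathrm M\left(\frac k2+1,\frac m2-1\right)},$$ then $P_\Gamma F_{k,m}\in C^\infty(\Gamma\backslash\mathrm{SL}_2(\mathbb R))$ is not identically $0$.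
   Context: $\Gamma(N)=\left\{\begin{pmatrix}a&b\\c&d\end{pmatrix}\in\mathrm{SL}_2(\mathbb Z):a,d\equiv1,\ b,c\equiv0\ (\mathrm{mod}\ N)\right\}$. The function $F_{k,m}$ is well defined since every element of $\mathrm{SL}_2(\mathbb R)$ is of the form $r_{\theta_1}d_tr_{\theta_2}$ (Cartan decomposition); for $k=0$, $\tanh^0(t)=1$. The Poincaré series is $(P_\Gamma F_{k,m})(g)=\sum_{\gamma\in\Gamma}F_{k,m}(\gamma g)$, $g\in\mathrm{SL}_2(\mathbb R)$. For $a,b\in\mathbb R_{>0}$, $\mathrm M(a,b)$ denotes the median of the beta distribution $B(a,b)$, i.e. the unique $\mathrm M(a,b)\in\,]0,1[$ such that $\int_0^{\mathrm M(a,b)}x^{a-1}(1-x)^{b-1}\,dx=\int_{\mathrm M(a,b)}^1x^{a-1}(1-x)^{b-1}\,dx$. *)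

(* Defs.v *)
From HB Require Import structures.
From mathcomp Require Import all_boot all_order all_algebra finmap complex.
From mathcomp Require Import all_classical all_reals all_analysis.

Set Implicit Arguments.
Unset Strict Implicit.
Unset Printing Implicit Defensive.

Import Order.TTheory GRing.Theory Num.Theory.
Import numFieldNormedType.Exports.

Local Open Scope classical_set_scope.
Local Open Scope ring_scope.
Local Open Scope complex_scope.

Definition mx2 (T : Type) (a b c d : T) : 'M[T]_2 :=
  \matrix_(i < 2, j < 2)
    if i == ord0 then (if j == ord0 then a else b)
    else (if j == ord0 then c else d).

Section SL2.
Variable R : realType.

(* Functions on SL_2(R) are functions on 'M[R]_2; only their values on [SL2]
   are ever referred to. *)
Definition SL2 : set 'M[R]_2 := [set g | \det g = 1].

Definition SO2 : set 'M[R]_2 := [set g | g *m g^T = 1%:M /\ \det g = 1].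

Definition r_ (theta : R) : 'M[R]_2 :=
  mx2 (cos theta) (- sin theta) (sin theta) (cos theta).

Definition d_ (t : R) : 'M[R]_2 := mx2 (expR t) 0 0 (expR (- t)).

Definition n_ (x : R) : 'M[R]_2 := mx2 1 x 0 1.

Definition a_ (y : R) : 'M[R]_2 := mx2 (Num.sqrt y) 0 0 (Num.sqrt y)^-1.

Definition cosh (t : R) : R := (expR t + expR (- t)) / 2.
Definition sinh (t : R) : R := (expR t - expR (- t)) / 2.
Definition tanh (t : R) : R := sinh t / cosh t.

(* e^(i x) *)
Definition expi (x : R) : R[i] := cos x +i* sin x.

(* The value prescribed at r_theta1 d_t r_theta2. By the Cartan decomposition
   such a triple exists for every g in SL_2(R), and the value does not depend
   on its choice. *)
Definition F (k m : nat) (g : 'M[R]_2) : R[i] :=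
  xget 0 [set z | exists theta1 theta2 t : R,
    [/\ 0 <= t,
        g = r_ theta1 *m d_ t *m r_ theta2
      & z = expi (- ((m + 2 * k)%:R * theta1))
            * (tanh t ^+ k / cosh t ^+ m)%:C
            * expi (- (m%:R * theta2))]].

Section Smooth.
Variable V : normedModType R.

(* f is of class C^n on the open set U *)
Fixpoint Cn (n : nat) (U : set V) (f : V -> R) : Prop :=
  (forall x, U x -> {for x, continuous f}) /\
  if n is n'.+1 then
    forall v : V, (forall x, U x -> derivable f x v) /\ Cn n' U ('D_v f)
  else True.

Definition Cinfty (U : set V) (f : V -> R) : Prop := forall n, Cn n U f.

End Smooth.

(* Smoothness on the embedded submanifold SL_2(R) of 'M[R]_2: f extends, near
   each point of SL_2(R), to a smooth function on an open set of matrices. *)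
Definition smooth_SL2_real (f : 'M[R]_2 -> R) : Prop :=
  forall g, SL2 g -> exists (U : set 'M[R]_2) (h : 'M[R]_2 -> R),
    [/\ open U, U g, Cinfty U h & forall x, U x -> SL2 x -> h x = f x].

Definition smooth_SL2 (f : 'M[R]_2 -> R[i]) : Prop :=
  smooth_SL2_real (fun g => complex.Re (f g)) /\ smooth_SL2_real (fun g => complex.Im (f g)).

(* L^1 for the Haar measure dx dy dtheta / y^2 in the Iwasawa coordinates
   g = n_x a_y r_theta, with x real, y > 0 and 0 <= theta < 2 pi. *)
Definition L1_SL2_real (f : 'M[R]_2 -> R) : Prop :=
  let mu := @lebesgue_measure R in
  ((mu \x mu) \x mu)%E.-integrable
    (([set: R] `*` `]0, +oo[%classic) `*` `[0, 2 * pi[%classic)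
    (fun p : R * R * R =>
       (f (n_ p.1.1 *m a_ p.1.2 *m r_ p.2) / p.1.2 ^+ 2)%:E).

Definition L1_SL2 (f : 'M[R]_2 -> R[i]) : Prop :=
  L1_SL2_real (fun g => complex.Re (f g)) /\ L1_SL2_real (fun g => complex.Im (f g)).

Section UnorderedSum.
Variable I : choiceType.

(* absolute convergence *)
Definition csummable (D : set I) (f : I -> R[i]) : Prop :=
  summable D (fun i => (complex.Re (f i))%:E) /\ summable D (fun i => (complex.Im (f i))%:E).

Definition rsum (D : set I) (f : I -> R) : R :=
  fine (\esum_(i in D) (Num.max (f i) 0)%:E)
  - fine (\esum_(i in D) (Num.max (- f i) 0)%:E).

Definition csum (D : set I) (f : I -> R[i]) : R[i] :=
  rsum D (fun i => complex.Re (f i)) +i* rsum D (fun i => complex.Im (f i)).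

End UnorderedSum.

Definition toR (gamma : 'M[int]_2) : 'M[R]_2 := map_mx intr gamma.

Definition PoincareTerm (f : 'M[R]_2 -> R[i]) (g : 'M[R]_2)
  (gamma : 'M[int]_2) : R[i] := f (toR gamma *m g).

Definition Poincare (Gamma : set 'M[int]_2) (f : 'M[R]_2 -> R[i])
  (g : 'M[R]_2) : R[i] := csum Gamma (PoincareTerm f g).

(* C^infty(Gamma \ SL_2(R)) *)
Definition smooth_quotient (Gamma : set 'M[int]_2) (f : 'M[R]_2 -> R[i]) :
    Prop :=
  smooth_SL2 f /\
  forall gamma g, Gamma gamma -> SL2 g -> f (toR gamma *m g) = f g.

(* Gamma cap SO_2(R), always finite: its elements are orthogonal integer
   matrices. *)
Definition cap_SO2 (Gamma : set 'M[int]_2) : set 'M[int]_2 :=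
  Gamma `&` toR @^-1` SO2.

Definition beta_weight (a b x : R) : R := x `^ (a - 1) * (1 - x) `^ (b - 1).

(* median of the beta distribution B(a, b), for a, b > 0 *)
Definition beta_median (a b : R) : R :=
  xget 0 [set x | 0 < x < 1 /\
    (\int[lebesgue_measure]_(u in `]0%R, x[) (beta_weight a b u)%:E =
     \int[lebesgue_measure]_(u in `]x, 1%R[) (beta_weight a b u)%:E)%E].

End SL2.

Definition is_subgroup (Gamma : set 'M[int]_2) : Prop :=
  [/\ Gamma 1%:M,
      forall x y, Gamma x -> Gamma y -> Gamma (x *m y)
    & forall x, Gamma x -> Gamma (invmx x)].

Definition principal_congruence (N : nat) : set 'M[int]_2 :=
  [set gamma | \det gamma = 1 /\
    forall i j, (gamma i j = (1%:M : 'M[int]_2) i j %[mod N])%Z].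

(* Main.v *)
Require Import Defs.
From HB Require Import structures.
From mathcomp Require Import all_boot all_order all_algebra finmap complex.
From mathcomp Require Import all_classical all_reals all_analysis.
From mathcomp Require Import measurable_realfun ring lra zify.

(* In the coordinates z = zc g, w = wc g the group SL_2(R) is the hyperboloid
   |z|^2 - |w|^2 = 1 in C^2 and F_{k,m} is w^k / z^(m + k), of size at most
   |z|^(-m).  The sum of |zc (gamma g)|^(-m) over SL_2(Z) converges because, in
   Iwasawa coordinates, it is dominated by a product of three sums of
   (1 + |n|)^(-3/2); the same bound holds for all derivatives in a
   neighbourhood of g, which gives smoothness.

   The function w^k / z^(m + k) is homogeneous on the cone |w| < |z|, on which
   SL_2(R) acts by products of shears, hence preserves volume.  In the shell
   1 <= |z|^2 - |w|^2 <= 2, the mass of its modulus on |w|^2 < M |z|^2 is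
   proportional to the beta mass of ]0, M[.  If gamma maps a point of the set
   |w|^2 < M |z|^2 back into this set, then 2 |wc gamma| is less than
   4 M^(1/2) / (1 - M) < N; as 2 |wc gamma| is the modulus of an element of
   N Z[i], gamma lies in SO_2(R).  Take M slightly above the median.  If the
   Poincare series vanished, the contribution of the stabilizer Gamma cap SO_2
   would be bounded by that of the other elements of Gamma; integrating over
   the set and unfolding, the mass of the set would be at most the mass of its
   complement, against the choice of M. *)

Import Order.TTheory GRing.Theory Num.Theory.
Import numFieldNormedType.Exports.
Import Normc.

Set Implicit Arguments.
Unset Strict Implicit.
Unset Printing Implicit Defensive.

Local Open Scope classical_set_scope.
Local Open Scope ring_scope.
Local Open Scope complex_scope.

(** * Complex coordinates and the Cartan decomposition *)

(** For the nonvanishing, Lebesgue measure on C^2 replaces Haar measure on SL_2(R): F extends to the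
    cone as a function homogeneous of degree -m. A homogeneous function has no finite nonzero mass
    along whole rays, which is why an invariant shell is cut out. In the variables x = |w|^2 / |z|^2
    and y = |z|^2 the mass has density proportional to x^(k/2) y^(1 - m/2). Under the shell
    condition 1 <= (1 - x) y <= 2, integrating out y leaves a multiple of x^(k/2) (1 - x)^(m/2 - 2):
    this is where the parameters k/2 + 1 and m/2 - 1 come from. An element of the stabilizer
    multiplies F by the power -(m + 2k) of a root of unity whose order divides the order of the
    stabilizer. The divisibility hypothesis thus makes the stabilizer terms add up instead of
    cancelling. The factor they produce, the order of the stabilizer, is also the largest number of
    translates of the inner region that can overlap off the stabilizer, so it cancels. The resulting
    comparison of masses is not strict and would be no contradiction at the median itself; the
    strict bound on N leaves room to move M upwards. *)

Section CartanCoordinates.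
Variable R : realType.
Implicit Types (g h : 'M[R]_2) (z w : R[i]).

(* A real matrix acts on the plane of complex numbers as
   v |-> zc g * v + (wc g)^* * v^*. *)
Definition zc g : R[i] :=
  ((g ord0 ord0 + g ord_max ord_max) / 2) +i* ((g ord_max ord0 - g ord0 ord_max) / 2).
Definition wc g : R[i] :=
  ((g ord0 ord0 - g ord_max ord_max) / 2) +i* (- ((g ord_max ord0 + g ord0 ord_max) / 2)).

Definition nsq z : R := complex.Re z ^+ 2 + complex.Im z ^+ 2.

Lemma nsq_ge0 z : 0 <= nsq z.
Proof. by rewrite addr_ge0 ?sqr_ge0. Qed.

Lemma nsqM z w : nsq (z * w) = nsq z * nsq w.
Proof. by case: z w => [a b] [c d]; rewrite /nsq /=; ring. Qed.

Lemma nsqJ z : nsq (conjc z) = nsq z.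
Proof. by case: z => [a b]; rewrite /nsq /= sqrrN. Qed.

Lemma normcE2 z : normc z ^+ 2 = nsq z.
Proof. by case: z => [a b]; rewrite /normc sqr_sqrtr // addr_ge0 ?sqr_ge0. Qed.

Lemma normcS z : normc z = Num.sqrt (nsq z).
Proof. by case: z. Qed.

Lemma normc_ge0 z : 0 <= normc z.
Proof. by rewrite normcS sqrtr_ge0. Qed.

Lemma normc_gt0 z : (0 < normc z) = (z != 0).
Proof.
rewrite lt_neqAle normc_ge0 andbT eq_sym; congr negb.
by apply/eqP/eqP => [/eq0_normc //|->]; rewrite normc0.
Qed.

Lemma normcX z n : normc (z ^+ n) = normc z ^+ n.
Proof. by elim: n => [|n IH]; rewrite ?expr0 ?normc1 // !exprS normcM IH. Qed.

Lemma normc_conj z : normc (conjc z) = normc z.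
Proof. by rewrite !normcS nsqJ. Qed.

Lemma mulcJ z : z * conjc z = (nsq z)%:C.
Proof. by case: z => [a b]; apply/eqP; rewrite eq_complex /nsq /=; apply/andP; split; apply/eqP; ring. Qed.

Lemma normcR (x : R) : 0 <= x -> normc x%:C = x.
Proof. by move=> x0; rewrite /= expr0n addr0 sqrtr_sqr ger0_norm. Qed.

Lemma Re_le_normc z : `|complex.Re z| <= normc z.
Proof. by case: z => [a b] /=; rewrite -sqrtr_sqr ler_wsqrtr // lerDl sqr_ge0. Qed.

Lemma Im_le_normc z : `|complex.Im z| <= normc z.
Proof. by case: z => [a b] /=; rewrite -sqrtr_sqr ler_wsqrtr // lerDr sqr_ge0. Qed.

Lemma ord2 (i : 'I_2) : i = ord0 \/ i = ord_max.
Proof. by case: i => [[|[|i]] hi]; [left; exact: val_inj|right; exact: val_inj|]. Qed.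

Lemma lift01 : lift ord0 ord0 = ord_max :> 'I_2. Proof. exact: val_inj. Qed.

Lemma det2 (K : comRingType) (g : 'M[K]_2) :
  \det g = g ord0 ord0 * g ord_max ord_max - g ord0 ord_max * g ord_max ord0.
Proof.
by rewrite (expand_det_row _ ord0) !big_ord_recl big_ord0 /cofactor !det_mx11 !mxE /= !lift01
  (_ : lift ord_max ord0 = ord0 :> 'I_2) ?expr0 ?expr1; [ring|exact: val_inj].
Qed.

Lemma mulmx2 (K : pzRingType) (g h : 'M[K]_2) i j :
  (g *m h) i j = g i ord0 * h ord0 j + g i ord_max * h ord_max j.
Proof. by rewrite mxE !big_ord_recl big_ord0 addr0 lift01. Qed.

Lemma nsq_det g : \det g = nsq (zc g) - nsq (wc g).
Proof. by rewrite det2 /nsq /=; field. Qed.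

Lemma zcM g h : zc (g *m h) = zc g * zc h + conjc (wc g) * wc h.
Proof.
by rewrite /zc /wc !mulmx2; apply/eqP; rewrite eq_complex /=; apply/andP; split;
  apply/eqP; field.
Qed.

Lemma wcM g h : wc (g *m h) = wc g * zc h + conjc (zc g) * wc h.
Proof.
by rewrite /zc /wc !mulmx2; apply/eqP; rewrite eq_complex /=; apply/andP; split;
  apply/eqP; field.
Qed.

Lemma mx2E (K : Type) (a b c d : K) : ((mx2 a b c d ord0 ord0 = a) * (mx2 a b c d ord0 ord_max = b)
  * (mx2 a b c d ord_max ord0 = c) * (mx2 a b c d ord_max ord_max = d))%type.
Proof. by rewrite /mx2 !mxE. Qed.

Definition of_zw z w : 'M[R]_2 :=
  mx2 (complex.Re z + complex.Re w) (- complex.Im z - complex.Im w)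
      (complex.Im z - complex.Im w) (complex.Re z - complex.Re w).

Lemma zc_of_zw z w : zc (of_zw z w) = z.
Proof.
by case: z w => [a b] [c d]; apply/eqP; rewrite eq_complex /zc /of_zw !mx2E /=; apply/andP; split;
  apply/eqP; field.
Qed.

Lemma wc_of_zw z w : wc (of_zw z w) = w.
Proof.
by case: z w => [a b] [c d]; apply/eqP; rewrite eq_complex /wc /of_zw !mx2E /=; apply/andP; split;
  apply/eqP; field.
Qed.

Lemma mx2P (K : Type) (g h : 'M[K]_2) : g ord0 ord0 = h ord0 ord0 -> g ord0 ord_max = h ord0 ord_max ->
  g ord_max ord0 = h ord_max ord0 -> g ord_max ord_max = h ord_max ord_max -> g = h.
Proof. by move=> *; apply/matrixP => i j; case: (ord2 i) => ->; case: (ord2 j) => ->. Qed.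

Lemma zcwc_inj g h : zc g = zc h -> wc g = wc h -> g = h.
Proof.
move=> /eqP; rewrite eq_complex /= => /andP[/eqP z1 /eqP z2] /eqP.
rewrite eq_complex /= => /andP[/eqP w1 /eqP w2].
by apply: mx2P; lra.
Qed.

Lemma expiD (x y : R) : expi (x + y) = expi x * expi y.
Proof.
by rewrite /expi cosD sinD; apply/eqP; rewrite eq_complex /=; apply/andP; split;
  apply/eqP; ring.
Qed.

Lemma expi0 : expi (0 : R) = 1.
Proof. by rewrite /expi cos0 sin0. Qed.

Lemma expi_neq0 (x : R) : expi x != 0.
Proof.
apply/eqP => /(congr1 nsq); rewrite /nsq /= cos2Dsin2 expr0n addr0 => /eqP.
by rewrite oner_eq0.
Qed.

Lemma expiN (x : R) : expi (- x) = (expi x)^-1.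
Proof.
by apply: (mulIf (expi_neq0 x)); rewrite -expiD addNr expi0 mulVf // expi_neq0.
Qed.

Lemma expiJ (x : R) : conjc (expi x) = (expi x)^-1.
Proof. by rewrite -expiN /expi cosN sinN. Qed.

Lemma expiMn (x : R) n : expi (n%:R * x) = expi x ^+ n.
Proof.
elim: n => [|n IH]; first by rewrite mul0r expi0.
by rewrite -natr1 mulrDl mul1r expiD IH exprSr.
Qed.

Lemma conj0 : conjc (0 : R[i]) = 0.
Proof. by apply/eqP; rewrite eq_complex /= oppr0 eqxx. Qed.

Lemma zc_r (t : R) : zc (r_ t) = expi t.
Proof.
by apply/eqP; rewrite eq_complex /zc /r_ !mx2E /=; apply/andP; split; apply/eqP; field.
Qed.

Lemma wc_r (t : R) : wc (r_ t) = 0.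
Proof.
by apply/eqP; rewrite eq_complex /wc /r_ !mx2E /=; apply/andP; split; apply/eqP; field.
Qed.

Lemma zc_d (t : R) : zc (d_ t) = (cosh t)%:C.
Proof.
by apply/eqP; rewrite eq_complex /zc /d_ !mx2E /cosh /=; apply/andP; split; apply/eqP; field.
Qed.

Lemma wc_d (t : R) : wc (d_ t) = (sinh t)%:C.
Proof.
by apply/eqP; rewrite eq_complex /wc /d_ !mx2E /sinh /=; apply/andP; split; apply/eqP; field.
Qed.

Lemma cosh_gt0 (t : R) : 0 < cosh t.
Proof. by rewrite divr_gt0 ?addr_gt0 ?expR_gt0. Qed.

Lemma expi_surj z : nsq z = 1 -> exists t : R, z = expi t.
Proof.
case: z => [x y]; rewrite /nsq /= => xy1.
have x1 : -1 <= x <= 1.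
  by rewrite -ler_norml -(@ler_pXn2r _ 2) ?nnegrE // real_normK ?num_real // expr1n -xy1 lerDl sqr_ge0.
have ca : cos (acos x) = x by rewrite acosK // in_itv.
have : `|sin (acos x)| = `|y|.
  by apply/eqP; rewrite -eqr_sqr_norm2 ||
    (rewrite -[_ == _](@eqrXn2 _ 2) // !real_normK ?num_real // sin2cos2 ca -xy1 addrAC subrr add0r).
move=> /eqP; rewrite eqr_norm2 => /orP[/eqP sy|/eqP sy].
  by exists (acos x); rewrite /expi ca sy.
by exists (- acos x); rewrite /expi cosN sinN ca sy opprK.
Qed.

Lemma polar z : exists t : R, z = (normc z)%:C * expi t.
Proof.
have [->|z0] := eqVneq z 0; first by exists 0; rewrite normc0 mul0r.
have nz : (normc z)%:C != 0.
  by apply/eqP => /(congr1 (@complex.Re R)) /= /eqP; rewrite gt_eqF // normc_gt0.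
have [|t ht] := @expi_surj (z / (normc z)%:C).
  by rewrite -normcE2 normcM normcV normcR ?normc_ge0 // divff ?expr1n // gt_eqF // normc_gt0.
by exists t; rewrite -ht mulrC divfK.
Qed.

Lemma cosh_sinh_surj (a b : R) : 0 <= a -> 0 <= b -> a ^+ 2 - b ^+ 2 = 1 ->
  exists t : R, [/\ 0 <= t, cosh t = a & sinh t = b].
Proof.
move=> a0 b0 ab.
have ba : b < a by rewrite -(@ltr_pXn2r _ 2) // -subr_gt0 ab.
have a1 : 1 <= a by rewrite -(@ler_pXn2r _ 2) ?nnegrE // expr1n -ab gerBl sqr_ge0.
have s0 : 0 < a + b by rewrite ltr_wpDr // (lt_le_trans _ a1).
have e : expR (ln (a + b)) = a + b by rewrite lnK.
have e' : expR (- ln (a + b)) = a - b.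
  by rewrite expRN e; apply: (mulIf (lt0r_neq0 s0)); rewrite mulVf ?gt_eqF // -ab; ring.
exists (ln (a + b)); split; rewrite /cosh /sinh ?e ?e'; [|by field|by field].
by rewrite ln_ge0 // (le_trans a1) // lerDl.
Qed.

Lemma nsq_gt0 z : (0 < nsq z) = (z != 0).
Proof. by rewrite lt_def nsq_ge0 andbT -normcE2 sqrf_eq0 -normc_gt0 lt_def normc_ge0 andbT. Qed.

Lemma zc_neq0 g : 0 < \det g -> zc g != 0.
Proof.
by rewrite nsq_det subr_gt0 => h; rewrite -nsq_gt0 (le_lt_trans _ h) // nsq_ge0.
Qed.

(** The product has coordinates cosh t e^(i(t1 + t2)) and sinh t e^(i(t2 - t1)). Polar forms of
    [zc g] and [wc g] with angles p and q therefore determine everything, and |z|^2 - |w|^2 = 1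
    provides t. *)
Lemma cartan g : SL2 g -> exists t1 t2 t : R, 0 <= t /\ g = r_ t1 *m d_ t *m r_ t2.
Proof.
rewrite /SL2 /= nsq_det -!normcE2 => dg.
have [t [t0 ct st]] := @cosh_sinh_surj _ _ (normc_ge0 _) (normc_ge0 _) dg.
have [p hp] := polar (zc g); have [q hq] := polar (wc g).
exists ((p - q) / 2), ((p + q) / 2), t; split => //.
apply: zcwc_inj; rewrite ?zcM ?wcM ?zc_r ?wc_r ?zc_d ?wc_d ?zcM ?wcM ?zc_r ?wc_r ?zc_d ?wc_d conj0.
  rewrite !mul0r !mulr0 !addr0 ct mulrAC -expiD.
  by rewrite [X in expi X](_ : _ = p) 1?mulrC //; field.
rewrite !mul0r !mulr0 !addr0 !add0r st expiJ -expiN mulrAC -expiD.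
by rewrite [X in expi X](_ : _ = q) 1?mulrC //; field.
Qed.

Definition Fzw (k m : nat) z w : R[i] := w ^+ k / z ^+ (m + k).

Lemma F_cartan (k m : nat) (t1 t2 t : R) :
  Fzw k m (zc (r_ t1 *m d_ t *m r_ t2)) (wc (r_ t1 *m d_ t *m r_ t2)) =
  expi (- ((m + 2 * k)%:R * t1)) * (tanh t ^+ k / cosh t ^+ m)%:C * expi (- (m%:R * t2)).
Proof.
rewrite /Fzw !zcM !wcM !zc_r !wc_r !zc_d !wc_d.
rewrite conj0 !(mul0r,mulr0,addr0,add0r) expiJ.
rewrite !expiN !expiMn /tanh expr_div_n.
have c0 : (cosh t)%:C != 0 :> R[i].
  by apply/eqP => /(congr1 (@complex.Re R)) /= /eqP; rewrite gt_eqF // cosh_gt0.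
move: (expi_neq0 t1) (expi_neq0 t2) c0.
move: (expi t1) (expi t2) (cosh t) (sinh t) => e1 e2 c s e10 e20 c0.
rewrite rmorphM fmorphV rmorphM fmorphV !rmorphXn /= !exprMn !exprVn mul2n -addnn !exprD.
move: (expf_neq0 k e10) (expf_neq0 m e10) (expf_neq0 k e20) (expf_neq0 m e20).
move: (expf_neq0 m c0) (expf_neq0 k c0).
move: (e1 ^+ k) (e1 ^+ m) (e2 ^+ k) (e2 ^+ m) (c%:C ^+ m) (c%:C ^+ k) (s%:C ^+ k).
move=> a1 a2 a3 a4 a5 a6 a7 *.
by field; do ?[apply/andP; split].
Qed.

(** This is the independence of the Cartan triple: by [F_cartan] every admissible value is the same
    expression in [zc g] and [wc g], and [cartan] excludes the default value of [xget]. *)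
Lemma FE (k m : nat) g : SL2 g -> F k m g = Fzw k m (zc g) (wc g).
Proof.
move=> hg; rewrite /F; case: xgetP => [z _ [t1 [t2 [t [t0 -> ->]]]]|].
  by rewrite F_cartan.
have [t1 [t2 [t [t0 e]]]] := cartan hg.
by move=> /(_ (expi (- ((m + 2 * k)%:R * t1)) * (tanh t ^+ k / cosh t ^+ m)%:C
  * expi (- (m%:R * t2))))[]; exists t1, t2, t.
Qed.

Lemma normc_Fzw k m z w : nsq w <= nsq z ->
  normc (Fzw k m z w) <= (normc z ^+ m)^-1.
Proof.
move=> wz; rewrite /Fzw normcM normcV !normcX exprD.
have [->|z0] := eqVneq z 0.
  rewrite normc0; case: m => [|m]; last by rewrite exprS mul0r mul0r invr0 mulr0.
  rewrite !expr0 mul1r invr1; case: k => [|k]; rewrite ?expr0 ?invr1 ?mulr1 // [0 ^+ _]exprS mul0r invr0 mulr0 //.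
have zp : 0 < normc z by rewrite normc_gt0.
rewrite invfM mulrCA ler_piMr ?invr_ge0 ?exprn_ge0 ?normc_ge0 //.
rewrite ler_pdivrMr ?exprn_gt0 // mul1r lerXn2r ?nnegrE ?normc_ge0 //.
by rewrite !normcS ler_wsqrtr.
Qed.

End CartanCoordinates.

(** * Termwise differentiation of unordered sums *)

Section UnorderedSums.
Variables (R : realType) (I : choiceType) (D : set I).
Implicit Types (f g M : I -> R).

Definition rsummable f := summable D (fun i => (f i)%:E).

Lemma rsummable_le f M : (forall i, D i -> `|f i| <= M i) -> rsummable M -> rsummable f.
Proof.
move=> fM; apply: le_lt_trans; apply: le_esum => i Di.
by rewrite !abse_EFin lee_fin (le_trans (fM i Di)) // ler_norm.
Qed.

Lemma rsummableD f g : rsummable f -> rsummable g -> rsummable (fun i => f i + g i).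
Proof. by move=> sf sg; have := summableD sf sg. Qed.

Lemma rsummable_norm f : rsummable f -> rsummable (fun i => `|f i|).
Proof. by apply: le_lt_trans; apply: le_esum => i Di; rewrite !abse_EFin normr_id. Qed.

(** The finite set depends on the majorant [M] alone and serves all dominated families at once. This
    uniformity yields dominated convergence, and also the linearity of [rsum], which is not apparent
    from its definition by positive and negative parts. *)
Lemma rsum_approx M (e : R) : rsummable M -> 0 < e ->
  exists s : seq I, (forall i, i \in s -> D i) /\
    forall f, (forall i, D i -> `|f i| <= M i) ->
      `|rsum D f - \sum_(i <- s) f i| <= e.
Proof.
move=> sM e0; pose N i := (`|M i|)%:E.
have Nfin : \esum_(i in D) N i \is a fin_num.
  by move: sM; rewrite /rsummable summableE; under eq_esum do rewrite abse_EFin.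
have [_ [A [finA AD] <-] hA] := ub_ereal_sup_adherent e0 Nfin.
have DA : D `&` A = A by apply: setIidr.
have tail : (\esum_(i in D `&` ~` A) N i <= e%:E)%E.
  have N0 i : D i -> (0 <= N i)%E by rewrite lee_fin.
  move: hA Nfin; rewrite -/(esum D N) (esumID A D) // DA esum_fset; last 2 first.
  - by [].
  - by move=> i; rewrite lee_fin.
  rewrite fsbig_finite //= /N sumEFin => hA; rewrite fin_numD => /andP[_ tfin].
  move: hA; rewrite -(fineK tfin) -!EFinD lte_fin lee_fin; lra.
exists (fset_set A); split=> [i|f fM]; first by rewrite in_fset_set // inE => /AD.
(* Used for the positive and for the negative part: both remainders lie in [0, e], so their
   difference is at most e in absolute value. *)
have part (h : I -> R) : (forall i, D i -> 0 <= h i <= `|M i|) ->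
    exists2 x, 0 <= x <= e &
      fine (\esum_(i in D) (h i)%:E) = \sum_(i <- fset_set A) h i + x.
  move=> hM.
  have h0 i : D i -> (0 <= (h i)%:E)%E by rewrite lee_fin => /hM /andP[].
  have t0 : (0 <= \esum_(i in D `&` ~` A) (h i)%:E)%E.
    by apply: esum_ge0 => i [/h0].
  have te : (\esum_(i in D `&` ~` A) (h i)%:E <= e%:E)%E.
    apply: le_trans tail; apply: le_esum => i [Di _].
    by rewrite lee_fin; case/andP: (hM i Di).
  have tf : \esum_(i in D `&` ~` A) (h i)%:E \is a fin_num.
    by rewrite fin_numElt (lt_le_trans _ t0) ?ltNyr // (le_lt_trans te) ?ltry.
  exists (fine (\esum_(i in D `&` ~` A) (h i)%:E)).
    by rewrite fine_ge0 //= -lee_fin fineK.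
  rewrite (esumID A D) // DA esum_fset //; last by move=> i /set_mem/AD/h0.
  by rewrite fsbig_finite //= sumEFin -(fineK tf).
have [|x x01 ex] := part (fun i => Num.max (f i) 0).
  move=> i Di; have := fM i Di; have := ler_norm (f i); have := ler_norm (M i).
  by rewrite le_max lexx orbT ge_max /= normr_ge0 andbT; lra.
have [|y y01 ey] := part (fun i => Num.max (- f i) 0).
  move=> i Di; have := fM i Di; have := ler_norm (- f i); rewrite normrN; have := ler_norm (M i).
  by rewrite le_max lexx orbT ge_max /= normr_ge0 andbT; lra.
have -> : \sum_(i <- fset_set A) f i =
    \sum_(i <- fset_set A) Num.max (f i) 0 - \sum_(i <- fset_set A) Num.max (- f i) 0.
  rewrite -sumrB; apply: eq_bigr => i _.
  by have [a|a] := leP (f i) 0; have [b|b] := leP (- f i) 0; lra.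
by rewrite /rsum ex ey ler_norml; lra.
Qed.

Lemma eq_rsum f g : (forall i, D i -> f i = g i) -> rsum D f = rsum D g.
Proof.
by move=> e; rewrite /rsum; congr (fine _ - fine _); apply: eq_esum => i /e ->.
Qed.

(** Dominated convergence along an arbitrary filter: one finite set approximates both the sums of
    [g t] and the sum of [l] up to e/3, and a finite sum passes to the limit. *)
Lemma rsum_cvg (T : Type) (F : set_system T) {FF : Filter F} (g : T -> I -> R) (l : I -> R) M :
  rsummable M -> (\forall t \near F, forall i, D i -> `|g t i| <= M i) ->
  (forall i, D i -> `|l i| <= M i) ->
  (forall i, D i -> (g t i) @[t --> F] --> l i) ->
  rsum D (g t) @[t --> F] --> rsum D l.
Proof.
move=> sM gM lM gl; apply/cvgrPdist_le => e e0.
have e3 : 0 < e / 3 by rewrite divr_gt0.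
have [s [sD hs]] := rsum_approx sM e3.
have cs : \sum_(i <- s) g t i @[t --> F] --> \sum_(i <- s) l i.
  elim: s sD {hs} => [_|i s IH sD].
    by under eq_fun do rewrite big_nil; rewrite big_nil; exact: cvg_cst.
  under eq_fun do rewrite big_cons; rewrite big_cons.
  apply: cvgD; first by apply/gl/sD; rewrite mem_head.
  by apply: IH => j js; apply: sD; rewrite in_cons js orbT.
have h1 := hs _ lM; near=> t.
have := hs (g t); have : `|\sum_(i <- s) l i - \sum_(i <- s) g t i| <= e / 3.
  by near: t; move/cvgrPdist_le : cs; apply.
have H : forall i, D i -> `|g t i| <= M i by near: t.
move=> + /(_ H); move: h1; rewrite !ler_norml => *.
lra.
Unshelve. all: by end_near. Qed.

Lemma rsummableZ c f : rsummable f -> rsummable (fun i => c * f i).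
Proof.
move=> sf; apply: (@le_lt_trans _ _ (`|c|%:E * \esum_(i in D) `|(f i)%:E|)%E).
  apply: ge_ereal_sup => _ [A [finA AD] <-].
  under eq_fsbigr do rewrite EFinM abseM abse_EFin.
  rewrite -ge0_mule_fsumr; last by move=> i; exact: abse_ge0.
  by rewrite lee_wpmul2l ?lee_fin // esum_ge //; exists A.
by rewrite lte_mul_pinfty ?lee_fin.
Qed.

(** All three sums are compared with finite sums over the same index set, chosen for the majorant
    |f| + |g|; on that set subtraction is exact. *)
Lemma rsumB f g : rsummable f -> rsummable g ->
  rsum D (fun i => f i - g i) = rsum D f - rsum D g.
Proof.
move=> sf sg; apply/eqP; rewrite -subr_eq0 -normr_le0; apply/ler_addgt0Pr => e e0.
have sM := rsummableD (rsummable_norm sf) (rsummable_norm sg).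
have e3 : 0 < e / 3 by rewrite divr_gt0.
have [s [_ hs]] := rsum_approx sM e3.
have h1 := hs f (fun i _ => ler_wpDr (normr_ge0 _) (lexx _)).
have h2 := hs g (fun i _ => ler_wpDl (normr_ge0 _) (lexx _)).
have := hs (fun i => f i - g i) (fun i _ => ler_normB _ _).
rewrite add0r sumrB; move: h1 h2; rewrite !ler_norml => *; lra.
Qed.

Lemma rsumZ c f : rsummable f -> rsum D (fun i => c * f i) = c * rsum D f.
Proof.
move=> sf; apply/eqP; rewrite -subr_eq0 -normr_le0; apply/ler_addgt0Pr => e e0.
have sM := rsummableD (rsummable_norm sf) (rsummable_norm (rsummableZ c sf)).
have e3 : 0 < e / (1 + `|c|) by rewrite divr_gt0 // ltr_pwDl.
have [s [_ hs]] := rsum_approx sM e3.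
have h1 := hs f (fun i _ => ler_wpDr (normr_ge0 _) (lexx _)).
have := hs (fun i => c * f i) (fun i _ => ler_wpDl (normr_ge0 _) (lexx _)).
rewrite add0r -mulr_sumr => h2.
rewrite (_ : _ - _ = (rsum D (fun i => c * f i) - c * \sum_(i <- s) f i)
  - c * (rsum D f - \sum_(i <- s) f i)); last by ring.
rewrite (le_trans (ler_normB _ _)) // normrM.
rewrite (le_trans (lerD h2 (ler_wpM2l (normr_ge0 c) h1))) //.
by rewrite -[X in X + _]mul1r -mulrDl mulrC divfK // gt_eqF // ltr_pwDl.
Qed.

End UnorderedSums.

(** * Families with uniformly bounded derivatives *)

Section UniformFamilies.
Variables (R : realType) (I : choiceType) (D : set I) (V : normedModType R).
Implicit Types (U : set V) (phi psi : I -> V -> R).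

(* A family of C^n functions all of whose derivatives of order at most n are
   bounded on U, uniformly over the indices in D. *)
Fixpoint UCn n U phi : Prop :=
  [/\ exists C, forall i x, D i -> U x -> `|phi i x| <= C,
      forall i x, D i -> U x -> {for x, continuous (phi i)}
    & if n is n'.+1 then
        forall v, (forall i x, D i -> U x -> derivable (phi i) x v) /\
          UCn n' U (fun i => 'D_v (phi i))
      else True].

Lemma UCnW n U phi : UCn n.+1 U phi -> UCn n U phi.
Proof.
elim: n phi => [|n IH] phi; first by case.
by case=> b c d; split => // v; have [dv /IH] := d v.
Qed.

Lemma near_open U (P : V -> Prop) x : open U -> U x -> (forall y, U y -> P y) ->
  \forall y \near x, P y.
Proof. by move=> oU Ux UP; apply: filterS UP _; exact: open_nbhs_nbhs. Qed.

Lemma UCn_ext n U phi psi : open U ->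
  (forall i x, D i -> U x -> phi i x = psi i x) -> UCn n U phi -> UCn n U psi.
Proof.
move=> oU; elim: n phi psi => [|n IH] phi psi e.
  case=> [[C hC] c _]; split=> //.
    by exists C => i x Di Ux; rewrite -e // hC.
  move=> i x Di Ux; have := c i x Di Ux; rewrite /prop_for /continuous_at /= e //.
  by apply: cvg_trans; apply: near_eq_cvg; apply: near_open oU Ux _ => y Uy; rewrite e.
move=> [[C hC] c d]; split.
- by exists C => i x Di Ux; rewrite -e // hC.
- move=> i x Di Ux; have := c i x Di Ux; rewrite /prop_for /continuous_at /= e //.
  by apply: cvg_trans; apply: near_eq_cvg; apply: near_open oU Ux _ => y Uy; rewrite e.
- move=> v; have [dv hn] := d v; split=> [i x Di Ux|].
    by apply: near_eq_derivable (dv i x Di Ux); apply: near_open oU Ux _ => y Uy; exact: e.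
  apply: IH hn => i x Di Ux.
  by apply: near_eq_derive; apply: near_open oU Ux _ => y Uy; exact: e.
Qed.

Lemma UCn_cst n U (c : I -> R) C : open U -> (forall i, D i -> `|c i| <= C) ->
  UCn n U (fun i _ => c i).
Proof.
move=> oU; elim: n c C => [|n IH] c C hC; split => //.
- by exists C => i x Di _; exact: hC.
- by move=> i x _ _; exact: cvg_cst.
- by exists C => i x Di _; exact: hC.
- by move=> i x _ _; exact: cvg_cst.
- move=> v; split=> [i x _ _|]; first exact: derivable_cst.
  apply: (UCn_ext oU _ (IH (fun=> 0) 0 _)) => [i x _ _|i _]; last by rewrite normr0.
  by rewrite derive_cst.
Qed.

Lemma UCnD n U phi psi : open U -> UCn n U phi -> UCn n U psi ->
  UCn n U (fun i x => phi i x + psi i x).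
Proof.
move=> oU; elim: n phi psi => [|n IH] phi psi [[C hC] c d] [[C' hC'] c' d']; split => //.
- by exists (C + C') => i x Di Ux; rewrite (le_trans (ler_normD _ _)) // lerD ?hC ?hC'.
- by move=> i x Di Ux; apply: cvgD; [exact: c|exact: c'].
- by exists (C + C') => i x Di Ux; rewrite (le_trans (ler_normD _ _)) // lerD ?hC ?hC'.
- by move=> i x Di Ux; apply: cvgD; [exact: c|exact: c'].
- move=> v; have [dv hv] := d v; have [dv' hv'] := d' v; split=> [i x Di Ux|].
    by apply: derivableD; [exact: dv|exact: dv'].
  apply: (UCn_ext oU _ (IH _ _ hv hv')) => i x Di Ux.
  by rewrite -deriveD; [|exact: dv|exact: dv'].
Qed.

Lemma UCnM n U phi psi : open U -> UCn n U phi -> UCn n U psi ->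
  UCn n U (fun i x => phi i x * psi i x).
Proof.
move=> oU; elim: n phi psi => [|n IH] phi psi h h'.
  move: h h' => [[C hC] c _] [[C' hC'] c' _]; split => //.
  - by exists (C * C') => i x Di Ux; rewrite normrM ler_pM ?hC ?hC'.
  - by move=> i x Di Ux; apply: cvgM; [exact: c|exact: c'].
have w := UCnW h; have w' := UCnW h'.
move: h h' => [[C hC] c d] [[C' hC'] c' d']; split => //.
- by exists (C * C') => i x Di Ux; rewrite normrM ler_pM ?hC ?hC'.
- by move=> i x Di Ux; apply: cvgM; [exact: c|exact: c'].
- move=> v; have [dv hv] := d v; have [dv' hv'] := d' v; split=> [i x Di Ux|].
    by apply: derivableM; [exact: dv|exact: dv'].
  apply: (UCn_ext oU _ (UCnD oU (IH _ _ w hv') (IH _ _ w' hv))) => i x Di Ux.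
  by rewrite [RHS]deriveM; [|exact: dv|exact: dv'].
Qed.

Lemma UCnN n U phi : open U -> UCn n U phi -> UCn n U (fun i x => - phi i x).
Proof.
move=> oU h; have := UCnM oU (@UCn_cst n U (fun=> -1) 1 oU _) h.
have H : forall i, D i -> `|-1 : R| <= 1 by move=> *; rewrite normrN1.
by move=> /(_ H); apply: UCn_ext => // i x _ _; rewrite mulN1r.
Qed.

(** The derivative of 1/phi is -(1/phi)^2 phi', so the class is gained one order at a time from
    products; the uniform lower bound [e] starts the induction. *)
Lemma UCnV n U phi e : open U -> 0 < e ->
  (forall i x, D i -> U x -> e <= `|phi i x|) -> UCn n U phi ->
  UCn n U (fun i x => (phi i x)^-1).
Proof.
move=> oU e0 he.
have n0 i x : D i -> U x -> phi i x != 0.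
  by move=> Di Ux; rewrite -normr_gt0 (lt_le_trans e0) // he.
have B : exists C, forall i x, D i -> U x -> `|(phi i x)^-1| <= C.
  by exists e^-1 => i x Di Ux; rewrite normfV lef_pV2 ?posrE ?he // normr_gt0 n0.
elim: n => [|n IH] h.
  by move: h => [b c _]; split => // i x Di Ux; apply: cvgV; [exact: n0|exact: c].
have {}IH := IH (UCnW h).
move: h => [_ c d]; split => //.
  by move=> i x Di Ux; apply: cvgV; [exact: n0|exact: c].
move=> v; have [dv hv] := d v; split=> [i x Di Ux|].
  by apply: derivableV; [exact: n0|exact: dv].
apply: (UCn_ext oU _ (UCnN oU (UCnM oU (UCnM oU IH IH) hv))) => i x Di Ux.
by rewrite [RHS]deriveV; [rewrite expr2 invfM scaleNr|exact: n0|exact: dv].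
Qed.

Lemma derivable_along (f : V -> R) (x v : V) (t : R) :
  derivable f (t *: v + x) v -> is_derive t 1 (fun s : R => f (s *: v + x)) ('D_v f (t *: v + x)).
Proof.
move=> df.
have E : (fun h : R => h^-1 *: (((fun s : R => f (s *: v + x)) \o shift t) (h *: 1) - f (t *: v + x)))
   = (fun h : R => h^-1 *: ((f \o shift (t *: v + x)) (h *: v) - f (t *: v + x))).
  by apply/funext => h /=; rewrite scalerDl -addrA [h *: 1]mulr1.
by apply: DeriveDef; rewrite /derivable /derive E.
Qed.

(** Mean value inequality on a segment of either orientation. It dominates the difference quotients
    in [rsum_derive] uniformly in the index. *)
Lemma increment_le (f : V -> R) (x v : V) (h C : R) :
  (forall t : R, `|t| <= `|h| -> derivable f (t *: v + x) v /\ `|'D_v f (t *: v + x)| <= C) ->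
  `|f (h *: v + x) - f x| <= C * `|h|.
Proof.
move=> H.
pose g (s : R) := f (s *: v + x).
have dg (t : R) : `|t| <= `|h| -> is_derive t 1 g ('D_v f (t *: v + x)).
  by move=> /H[dt _]; exact: derivable_along.
have cg (t : R) : `|t| <= `|h| -> {for t, continuous g}.
  by move=> /dg dt; apply/differentiable_continuous/derivable1_diffP; exact: ex_derive.
have -> : f x = g 0 by rewrite /g scale0r add0r.
rewrite -/(g h).
have key a b : a <= b -> `|a| <= `|h| -> `|b| <= `|h| -> `|g b - g a| <= C * (b - a).
  move=> ab ah bh.
  have inab c : c \in `[a, b] -> `|c| <= `|h|.
    by rewrite in_itv /= => /andP[ac cb]; move: ah bh; rewrite !ler_norml; lra.
  have [c|c|c cab ->] := @MVT_segment R g (fun t => 'D_v f (t *: v + x)) a b ab.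
  - by move=> cab; apply/dg/inab; exact: subset_itv_oo_cc.
  - by apply: continuous_in_subspaceT => y /set_mem yab; apply/cg/inab.
  - rewrite normrM [ `|b - a|]ger0_norm ?subr_ge0 // ler_wpM2r ?subr_ge0 //.
    by case: (H c (inab c cab)).
have [h0|h0] := leP 0 h.
  by have := key 0 h h0; rewrite normr0 subr0 (ger0_norm h0); apply.
have := key h 0 (ltW h0); rewrite distrC normr0 sub0r (ltr0_norm h0); apply => //.
by rewrite oppr_ge0 ltW.
Qed.

Lemma Cn_ext n U (f g : V -> R) : open U ->
  (forall x, U x -> f x = g x) -> Cn n U f -> Cn n U g.
Proof.
move=> oU; elim: n f g => [|n IH] f g e [c d]; split=> //.
- move=> x Ux; have := c x Ux; rewrite /prop_for /continuous_at /= e //.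
  by apply: cvg_trans; apply: near_eq_cvg; apply: near_open oU Ux _ => y Uy; rewrite e.
- move=> x Ux; have := c x Ux; rewrite /prop_for /continuous_at /= e //.
  by apply: cvg_trans; apply: near_eq_cvg; apply: near_open oU Ux _ => y Uy; rewrite e.
- move=> v; have [dv hn] := d v; split=> [x Ux|].
    by apply: near_eq_derivable (dv x Ux); apply: near_open oU Ux _ => y Uy; exact: e.
  apply: IH hn => x Ux.
  by apply: near_eq_derive; apply: near_open oU Ux _ => y Uy; exact: e.
Qed.

Section TermwiseDifferentiation.
Variables (U : set V) (a : I -> R).
Hypotheses (oU : open U) (sa : rsummable D a).

Let S phi x := rsum D (fun i => a i * phi i x).

Lemma rsummable_family phi C x : (forall i x, D i -> U x -> `|phi i x| <= C) ->
  U x -> rsummable D (fun i => a i * phi i x).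
Proof.
move=> hC Ux; apply: rsummable_le (rsummableZ C (rsummable_norm sa)) => i Di.
by rewrite normrM mulrC ler_wpM2r // hC.
Qed.

Lemma rsum_continuous phi x : UCn 0 U phi -> U x -> {for x, continuous (S phi)}.
Proof.
move=> [[C hC] c _] Ux.
apply: (rsum_cvg (rsummableZ C (rsummable_norm sa))).
- by apply: near_open oU Ux _ => y Uy i Di; rewrite normrM mulrC ler_wpM2r // hC.
- by move=> i Di; rewrite normrM mulrC ler_wpM2r // hC.
- by move=> i Di; apply: cvgMr; exact: c.
Qed.

(** The mean value inequality needs the whole segment inside [U], not only its far end. *)
Lemma segment_open x v : U x -> \forall h \near (0 : R)^', forall t : R, `|t| <= `|h| -> U (t *: v + x).
Proof.
move=> Ux; have cv : (t *: v + x) @[t --> (0 : R)] --> x.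
  rewrite -[X in _ --> X](add0r x) -(scale0r v).
  by apply: cvgD; [apply: cvgZr_tmp; exact: cvg_id|exact: cvg_cst].
have : \forall t \near (0 : R), U (t *: v + x) by apply: cv; exact: open_nbhs_nbhs.
move=> /nbhs_ballP[e /= e0 he].
apply: cvg_within; apply/nbhs_ballP; exists e => //= h.
rewrite /ball /= sub0r normrN => hh t th; apply: he.
by rewrite /ball /= sub0r normrN (le_lt_trans th).
Qed.

(** By linearity the difference quotient of the sum is the sum of the difference quotients. The mean
    value inequality bounds each of these by the bound [C'] on the derivatives, so the limit may be
    taken under the sum. *)
Lemma rsum_derive phi x v : UCn 1 U phi -> U x ->
  is_derive x v (S phi) (S (fun i => 'D_v (phi i)) x).
Proof.
move=> [[C hC] c d] Ux; have [dv [[C' hC'] _ _]] := d v.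
have key : h^-1 *: ((S phi \o shift x) (h *: v) - S phi x) @[h --> 0^'] -->
    S (fun i => 'D_v (phi i)) x.
  have e : {near (0 : R)^', (fun h => rsum D (fun i => a i * (h^-1 * (phi i (h *: v + x) - phi i x)))) =1
     (fun h => h^-1 *: ((S phi \o shift x) (h *: v) - S phi x))}.
    have := segment_open v Ux; apply: filterS => h hU /=.
    have Uh := hU h (lexx _).
    rewrite /S -rsumB; [|exact: rsummable_family hC Uh|exact: rsummable_family hC Ux].
    rewrite [RHS]/( _ *: _) /= -rsumZ; first by apply: eq_rsum => i _; ring.
    by apply: rsummableD; [exact: rsummable_family hC Uh|
      rewrite -/(rsummable _ _); under eq_fun do rewrite -mulrN;
      apply: (@rsummable_family (fun i y => - phi i y) C) => // i y *; rewrite normrN hC].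
  apply: cvg_trans (near_eq_cvg e) _.
  apply: (rsum_cvg (rsummableZ C' (rsummable_norm sa))).
  - have := segment_open v Ux; apply: filterS2 (nbhs_dnbhs_neq (0 : R)) => h h0 hU i Di.
    rewrite normrM mulrC ler_wpM2r // normrM normfV ler_pdivrMl ?normr_gt0 // mulrC.
    by apply: increment_le => t th; split; [apply: dv|apply: hC'] => //; exact: hU.
  - by move=> i Di; rewrite normrM mulrC ler_wpM2r // hC'.
  - by move=> i Di; apply: cvgMr; exact: (dv i x Di Ux).
by apply: DeriveDef; [apply/cvg_ex; eexists; exact: key|exact: cvg_lim key].
Qed.

Lemma Cn_rsum n phi : UCn n U phi -> Cn n U (S phi).
Proof.
elim: n phi => [|n IH] phi h; split => //.
- by move=> x Ux; exact: rsum_continuous.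
- move=> x Ux; apply: rsum_continuous => //.
  by elim: n phi h {IH} => [|n IH] phi /UCnW // /IH.
move=> v; have h1 : UCn 1 U phi.
  by elim: n phi h {IH} => [//|n IH] phi /UCnW /IH.
split=> [x Ux|]; first by case: (rsum_derive v h1 Ux).
have [_ _ /(_ v)[_ /IH]] := h; apply: Cn_ext => // x Ux.
by have := rsum_derive v h1 Ux => e; rewrite derive_val.
Qed.

End TermwiseDifferentiation.
End UniformFamilies.

(** * Absolute convergence over the modular group *)

Section LatticeSum.
Variable R : realType.

Definition SL2Z : set 'M[int]_2 := [set g | \det g = 1].

Lemma esum_scale_le (T : choiceType) (A : set T) (c : R) (f : T -> \bar R) :
  0 <= c -> (forall i, 0 <= f i)%E ->
  (\esum_(i in A) (c%:E * f i) <= c%:E * \esum_(i in A) f i)%E.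
Proof.
move=> c0 f0; apply: ge_ereal_sup => _ [B [finB BA] <-].
rewrite -ge0_mule_fsumr; last exact: f0.
by rewrite lee_wpmul2l ?lee_fin // esum_ge //; exists B.
Qed.

Lemma le_esum_subset (T : choiceType) (A B : set T) (f : T -> \bar R) :
  (forall i, 0 <= f i)%E -> A `<=` B -> (\esum_(i in A) f i <= \esum_(i in B) f i)%E.
Proof.
move=> f0 AB; rewrite [leRHS](esumID A) // (setIidr AB) leeDl //.
by apply: esum_ge0.
Qed.

(** The power (1 + |x|)^(-3/2). As m >= 3, the terms are at most |z|^(-3), and |z|^2 will dominate a
    product of three factors 1 + |n|; the exponent 3/2 exceeds 1, so each factor is summable. *)
Definition decay (x : int) : R := (Num.sqrt (1 + `|x|%:~R) ^+ 3)^-1.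

Lemma decay_gt0 x : 0 < decay x.
Proof. by rewrite invr_gt0 exprn_gt0 // sqrtr_gt0 ltr_pwDl // ler0z. Qed.

(** Telescoping: (u + 1)^(-3/2) <= 2 / sqrt u - 2 / sqrt (u + 1), with equality of both sides of the
    claim at n = 1. *)
Lemma sum_decay n : \sum_(0 <= i < n) decay (Posz i) <= 3 - 2 / Num.sqrt n%:R *+ (0 < n)%N.
Proof.
case: n => [|n]; first by rewrite big_geq // mulr0n subr0.
rewrite mulr1n; elim: n => [|n IH].
  by rewrite big_nat1 /decay normr0 addr0 sqrtr1 expr1n invr1; lra.
rewrite big_nat_recr //=; apply: (le_trans (lerD IH (lexx _))).
rewrite /decay.
have -> : (1 + (`|Posz n.+1|)%:~R : R) = n.+1%:R + 1 by rewrite addrC.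
rewrite -[n.+2%:R]natr1.
set u : R := n.+1%:R; have u0 : 0 < u by rewrite ltr0n.
have s0 : 0 < Num.sqrt u by rewrite sqrtr_gt0.
have t0 : 0 < Num.sqrt (u + 1) by rewrite sqrtr_gt0 ltr_wpDr.
have : Num.sqrt (u + 1) ^+ 2 = Num.sqrt u ^+ 2 + 1.
  by rewrite !sqr_sqrtr ?ltW // ltr_wpDr // ltW.
move: (Num.sqrt u) (Num.sqrt (u + 1)) s0 t0 => s t s0 t0 st.
have st0 : s <= t by rewrite -(@ler_pXn2r _ 2) ?nnegrE ?(ltW s0) ?(ltW t0) // st lerDl.
have h1 : 1 <= 2 * t * (t - s) by nra.
have h2 : s <= 2 * t ^+ 2 * (t - s) by nra.
have -> : (t ^+ 3)^-1 = s / (s * t ^+ 3) by field; rewrite !gt_eqF.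
have : s / (s * t ^+ 3) <= 2 * t ^+ 2 * (t - s) / (s * t ^+ 3).
  by rewrite ler_pM2r // invr_gt0 mulr_gt0 ?exprn_gt0.
have -> : 2 * t ^+ 2 * (t - s) / (s * t ^+ 3) = 2 / s - 2 / t by field; rewrite !gt_eqF.
lra.
Qed.

Lemma esum_decay : (\esum_(x in [set: int]) (decay x)%:E < +oo)%E.
Proof.
have f0 (x : int) : (0 <= (decay x)%:E)%E by rewrite lee_fin ltW // decay_gt0.
have nat_sum (a : nat -> R) : (forall n, 0 <= a n) -> (forall n, \sum_(0 <= i < n) a i <= 3) ->
    (\esum_(n in [set: nat]) (a n)%:E <= 3%:E)%E.
  move=> a0 ha; rewrite -nneseries_esumT; last by move=> n; rewrite lee_fin.
  apply: lime_le; first by apply: is_cvg_nneseries => n _ _; rewrite lee_fin.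
  by apply: nearW => n; rewrite sumEFin lee_fin ha.
have D3 n : \sum_(0 <= i < n) decay (Posz i) <= 3.
  apply: (le_trans (sum_decay n)); rewrite gerBl.
  by rewrite mulrn_wge0 // divr_ge0 ?sqrtr_ge0.
have P : (\esum_(n in [set: nat]) (decay (Posz n))%:E <= 3%:E)%E.
  by apply: nat_sum => // n; rewrite -lee_fin.
have N : (\esum_(n in [set: nat]) (decay (Negz n))%:E <= 3%:E)%E.
  apply: le_trans P; apply: le_esum => n _; rewrite lee_fin /decay.
  rewrite lef_pV2 ?posrE ?exprn_gt0 ?sqrtr_gt0 ?ltr_pwDl ?ler0z //.
  rewrite lerXn2r ?nnegrE ?sqrtr_ge0 // ler_wsqrtr // lerD2l ler_int.
  by rewrite NegzE normrN; lia.
rewrite (esumID [set x : int | 0 <= x]) // !setTI.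
have -> : [set x : int | 0 <= x] = range Posz.
  by apply/seteqP; split=> [[n|n]//= _|_ [n _ <-]//]; exists n.
have -> : ~` (range Posz) = range Negz.
  apply/seteqP; split=> [[n|n] //= h|_ [n _ <-] [m _]//]; first by case: h; exists n.
  by exists n.
rewrite (esum_image [set: nat] Posz (fun x => (decay x)%:E)); last by move=> x y _ _ [].
rewrite (esum_image [set: nat] Negz (fun x => (decay x)%:E)); last by move=> x y _ _ [].
by rewrite (le_lt_trans (leeD P N)) // -EFinD ltry.
Qed.

Lemma esum_decay3 :
  (\esum_(x in [set: int * (int * int)]) (decay x.1 * (decay x.2.1 * decay x.2.2))%:E < +oo)%E.
Proof.
have d0 x : 0 <= decay x by rewrite ltW // decay_gt0.
have prod (T : choiceType) (f : T -> R) : (forall x, 0 <= f x) ->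
   (\esum_(x in [set: T]) (f x)%:E < +oo)%E ->
   (\esum_(x in [set: int * T]) (decay x.1 * f x.2)%:E < +oo)%E.
  move=> f0 sf.
  have -> : [set: int * T] = [set: int] `*`` (fun=> [set: T]) by apply/seteqP; split.
  rewrite -(@esum_esum _ _ _ _ _ (fun i j => (decay i * f j)%:E)); last first.
    by move=> i j _ _; rewrite lee_fin mulr_ge0.
  have F : \esum_(x in [set: T]) (f x)%:E \is a fin_num.
    by rewrite fin_numElt sf (lt_le_trans (ltNyr 0)) // esum_ge0 // => i _; rewrite lee_fin.
  apply: (@le_lt_trans _ _ ((fine (\esum_(x in [set: T]) (f x)%:E))%:E *
     \esum_(x in [set: int]) (decay x)%:E)%E).
    apply: le_trans (esum_scale_le _ _ _); last 2 first.
    - by rewrite fine_ge0 // esum_ge0 // => i _; rewrite lee_fin.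
    - by move=> i; rewrite lee_fin.
    apply: le_esum => i _; rewrite fineK // muleC.
    apply: le_trans (esum_scale_le _ _ _) => //.
  apply: lte_mul_pinfty => //; last exact: esum_decay.
  by rewrite fineK // esum_ge0 // => i _; rewrite lee_fin.
apply: (@prod _ (fun y => decay y.1 * decay y.2)) => [x|]; first exact: mulr_ge0.
by apply: prod => //; exact: esum_decay.
Qed.

(** The bottom row together with the integer part of (a c + b d) / (c^2 + d^2), the real part of g
    applied to i. Elements of SL_2(Z) with the same bottom row differ by an integral unipotent
    matrix on the left, which shifts this real part by an integer. *)
Definition iwasawa_code (g : 'M[int]_2) : int * (int * int) :=
  let: (a, b, c, d) := (g ord0 ord0, g ord0 ord_max, g ord_max ord0, g ord_max ord_max) in
  (c, (d, ((a * c + b * d) %/ (c ^+ 2 + d ^+ 2))%Z)).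

Lemma row2_gt0 (g : 'M[int]_2) : SL2Z g -> 0 < g ord_max ord0 ^+ 2 + g ord_max ord_max ^+ 2.
Proof.
rewrite /SL2Z /= det2 => h; rewrite lt_def addr_ge0 ?sqr_ge0 // andbT.
rewrite paddr_eq0 ?sqr_ge0 // !sqrf_eq0.
by apply/negP => /andP[/eqP c0 /eqP d0]; move: h; rewrite c0 d0 !mulr0.
Qed.

Lemma iwasawa_code_inj : {in SL2Z &, injective iwasawa_code}.
Proof.
move=> g h /set_mem gS /set_mem hS; have r0 := row2_gt0 gS.
move: gS hS; rewrite /SL2Z /= !det2 /iwasawa_code => dg dh [ec ed en].
move: (g ord0 ord0) (g ord0 ord_max) (g ord_max ord0) (g ord_max ord_max)
  (h ord0 ord0) (h ord0 ord_max) (h ord_max ord0) (h ord_max ord_max)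
  (@mx2P _ g h) r0 dg dh ec ed en => a b c d a' b' c' d' H r0 dg dh ec ed en.
subst c' d'.
(* The integer by which the upper row is sheared, (a', b') = (a, b) + j (c, d), solved for j with
   the determinant equal to 1. *)
pose j := (b' - b) * a - (a' - a) * b.
have e0 : (a' - a) * d = (b' - b) * c by lra.
have jc : a' = a + j * c.
  have -> : j * c = (a' - a) * (a * d - b * c).
    by rewrite /j mulrBl mulrAC -e0; ring.
  by rewrite dg; ring.
have jd : b' = b + j * d.
  have -> : j * d = (b' - b) * (a * d - b * c).
    by rewrite /j mulrBl (mulrAC (a' - a)) e0; ring.
  by rewrite dg; ring.
have j0 : j = 0.
  move: en; rewrite [in RHS]jc [in RHS]jd.
  rewrite (_ : (a + j * c) * c + _ = j * (c ^+ 2 + d ^+ 2) + (a * c + b * d)); last by ring.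
  by rewrite divzMDl ?gt_eqF // => /eqP; rewrite -subr_eq0 opprD addrCA subrr addr0 oppr_eq0 => /eqP.
by apply: H => //; rewrite ?jc ?jd j0 mul0r addr0.
Qed.

(** Here 4 |z|^2 = a^2 + b^2 + c^2 + d^2 + 2. With r = c^2 + d^2, division gives (a^2 + b^2) r = (n
    r + e)^2 + 1 and 0 <= e < r, whence r (1 + n^2) <= 3 (a^2 + b^2 + r). Since (1 + |c|)(1 + |d|)
    <= 4 r and 1 + |n| <= 2 (1 + n^2), the product of the three factors is at most 24 (a^2 + b^2 +
    r), hence at most 96 |z|^2. *)
Lemma normc_code (g : 'M[int]_2) : SL2Z g ->
  (normc (zc (toR R g)) ^+ 3)^-1 <=
  Num.sqrt 96 ^+ 3 * (decay (iwasawa_code g).1 *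
    (decay (iwasawa_code g).2.1 * decay (iwasawa_code g).2.2)).
Proof.
move=> gS; have r0 := row2_gt0 gS; rewrite /iwasawa_code normcS.
have dg : g ord0 ord0 * g ord_max ord_max - g ord0 ord_max * g ord_max ord0 = 1.
  by move: gS; rewrite /SL2Z /= det2.
clear gS.
have : 4 * nsq (zc (toR R g)) = (g ord0 ord0 ^+ 2 + g ord0 ord_max ^+ 2 + g ord_max ord0 ^+ 2 +
   g ord_max ord_max ^+ 2 + 2 * \det g)%:~R.
  rewrite det2 !(rmorphD, rmorphM, rmorphXn, rmorphB, rmorphN) /nsq /toR /= !mxE; by field.
rewrite det2; move: (nsq_ge0 (zc (toR R g))); move: (nsq (zc (toR R g))) => q q0.
move: (g ord0 ord0) (g ord0 ord_max) (g ord_max ord0) (g ord_max ord_max) r0 dg => a b c d r0 dg /=.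
set r := c ^+ 2 + d ^+ 2 in r0 *; set n := divz _ _.
rewrite dg.
have ndef := divz_eq (a * c + b * d) r; rewrite -/n in ndef.
have m0 : 0 <= ((a * c + b * d) %% r)%Z by rewrite modz_ge0 // gt_eqF.
have m1 : ((a * c + b * d) %% r)%Z < r by rewrite ltz_pmod.
set e := (_ %% _)%Z in ndef m0 m1.
have ab : (a ^+ 2 + b ^+ 2) * r = (n * r + e) ^+ 2 + 1.
  have -> : (1 : int) = (a * d - b * c) ^+ 2 by rewrite dg.
  by rewrite -ndef /r; ring.
have r1 : 1 <= r by [].
have main : r * (1 + n ^+ 2) <= 3 * (a ^+ 2 + b ^+ 2 + r).
  rewrite -(ler_pM2r r0).
  have -> : 3 * (a ^+ 2 + b ^+ 2 + r) * r = 3 * ((a ^+ 2 + b ^+ 2) * r) + 3 * r ^+ 2 by ring.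
  rewrite ab.
  (* Half of this square absorbs the mixed term 6 n r e; the excess 3 e^2 / 2 is covered by 2 r^2,
     as e < r. *)
  have := sqr_ge0 (2 * (n * r) + 3 * e); nra.
have main2 : (1 + `|c|) * (1 + `|d|) * (1 + `|n|) <= 24 * (a ^+ 2 + b ^+ 2 + r).
  have h1 : (1 + `|c|) * (1 + `|d|) <= 4 * r.
    have -> : r = `|c| ^+ 2 + `|d| ^+ 2 by rewrite !real_normK ?num_real.
    have : 1 <= `|c| ^+ 2 + `|d| ^+ 2 by rewrite !real_normK ?num_real.
    by have := sqr_ge0 (`|c| - `|d|); have := sqr_ge0 (`|c| - 1); have := sqr_ge0 (`|d| - 1); nra.
  have h2 : 1 + `|n| <= 2 * (1 + n ^+ 2).
    rewrite -[n ^+ 2]real_normK ?num_real //; have := normr_ge0 n; nra.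
  have h3 : (1 + `|c|) * (1 + `|d|) * (1 + `|n|) <= 4 * r * (2 * (1 + n ^+ 2)).
    by apply: ler_pM; rewrite ?mulr_ge0 ?addr_ge0.
  nra.
rewrite -/r => h4q.
set x := 1 + `|c|%:~R : R; set y := 1 + `|d|%:~R : R; set w := 1 + `|n|%:~R : R.
have xyw : x * y * w <= 96 * q.
  have -> : x * y * w = ((1 + `|c|) * (1 + `|d|) * (1 + `|n|))%:~R.
    by rewrite !rmorphM !rmorphD.
  have : 96 * q = (24 * (a ^+ 2 + b ^+ 2 + c ^+ 2 + d ^+ 2 + 2 * 1))%:~R.
    by rewrite rmorphM /= -h4q; lra.
  by move=> ->; rewrite ler_int (le_trans main2) // /r; lra.
have x0 : 0 < x by rewrite ltr_pwDl // ler0z.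
have y0 : 0 < y by rewrite ltr_pwDl // ler0z.
have w0 : 0 < w by rewrite ltr_pwDl // ler0z.
have q1 : 0 < q.
  by rewrite -(@pmulr_rgt0 _ 96) // (lt_le_trans _ xyw) // !mulr_gt0.
rewrite /decay -/x -/y -/w -!invfM -!exprMn mulrA.
have <- : Num.sqrt (x * y * w) = Num.sqrt x * Num.sqrt y * Num.sqrt w.
  by rewrite !sqrtrM ?mulr_ge0 ?(ltW x0) ?(ltW y0).
rewrite ler_pdivlMr ?exprn_gt0 ?sqrtr_gt0 ?mulr_gt0 // mulrC.
rewrite ler_pdivrMr ?exprn_gt0 ?sqrtr_gt0 // -exprMn -sqrtrM //.
by rewrite lerXn2r ?nnegrE ?sqrtr_ge0 // ler_wsqrtr.
Qed.

Lemma normc_zcM_le (g h : 'M[R]_2) : nsq (wc g) <= nsq (zc g) ->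
  normc (zc (g *m h)) <= normc (zc g) * (normc (zc h) + normc (wc h)).
Proof.
move=> wz; rewrite zcM (le_trans (le_normcD _ _)) // mulrDr !normcM lerD2l.
by rewrite ler_wpM2r ?normc_ge0 // normc_conj !normcS ler_wsqrtr.
Qed.

Lemma toRM (g h : 'M[int]_2) : toR R (g *m h) = toR R g *m toR R h.
Proof. exact: map_mxM. Qed.

Lemma det_toR (g : 'M[int]_2) : \det (toR R g) = (\det g)%:~R.
Proof. exact: det_map_mx. Qed.

Lemma SL2_toR (g : 'M[int]_2) : SL2Z g -> SL2 (toR R g).
Proof. by rewrite /SL2Z /SL2 /= det_toR => ->. Qed.

Lemma SL2M (g h : 'M[R]_2) : SL2 g -> SL2 h -> SL2 (g *m h).
Proof. by rewrite /SL2 /= det_mulmx => -> ->; rewrite mulr1. Qed.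

Lemma SL2_nsq (g : 'M[R]_2) : SL2 g -> nsq (zc g) = 1 + nsq (wc g).
Proof. by rewrite /SL2 /= nsq_det => /eqP; rewrite subr_eq => /eqP. Qed.

Lemma SL2_wz (g : 'M[R]_2) : SL2 g -> nsq (wc g) <= nsq (zc g).
Proof. by move=> /SL2_nsq ->; rewrite lerDr. Qed.

Lemma SL2_normc_ge1 (g : 'M[R]_2) : SL2 g -> 1 <= normc (zc g).
Proof.
by move=> /SL2_nsq e; rewrite -[1]sqrtr1 normcS ler_wsqrtr // e lerDl nsq_ge0.
Qed.

(** Writing gamma = (gamma g) g^-1 bounds |zc gamma| by a constant [K] times |zc (gamma g)|, which
    reduces the convergence to g = 1. *)
Lemma rsummable_SL2Z (m : nat) (g : 'M[R]_2) : (3 <= m)%N -> SL2 g ->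
  rsummable SL2Z (fun gamma => (normc (zc (toR R gamma *m g)) ^+ m)^-1).
Proof.
move=> m3 gS.
have gU : g \in unitmx by rewrite unitmxE gS unitr1.
set K := normc (zc (invmx g)) + normc (wc (invmx g)).
have K0 : 0 <= K by rewrite addr_ge0 ?normc_ge0.
pose code_decay x := decay x.1 * (decay x.2.1 * decay x.2.2).
have sC : rsummable SL2Z (fun gamma => code_decay (iwasawa_code gamma)).
  rewrite /rsummable /summable; under eq_esum do rewrite gee0_abs ?lee_fin ?mulr_ge0 ?ltW ?decay_gt0 //.
  rewrite -(esum_image SL2Z iwasawa_code (fun x => (code_decay x)%:E)); last exact: iwasawa_code_inj.
  apply: le_lt_trans esum_decay3; apply: le_esum_subset => //.
  by move=> x; rewrite lee_fin !mulr_ge0 ?ltW ?decay_gt0.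
apply: (rsummable_le _ (rsummableZ (K ^+ 3 * Num.sqrt 96 ^+ 3) sC)) => gamma gS'.
have gg := SL2M (SL2_toR gS') gS.
have n1 := SL2_normc_ge1 gg; have n0 := lt_le_trans ltr01 n1.
have nz : 0 < normc (zc (toR R gamma)) by apply: lt_le_trans (SL2_normc_ge1 (SL2_toR gS')).
rewrite ger0_norm ?invr_ge0 ?exprn_ge0 ?normc_ge0 //.
apply: (@le_trans _ _ (normc (zc (toR R gamma *m g)) ^+ 3)^-1).
  by rewrite lef_pV2 ?posrE ?exprn_gt0 // ler_weXn2l.
rewrite -mulrA; apply: le_trans (ler_wpM2l (exprn_ge0 3 K0) (normc_code gS')).
rewrite ler_pdivlMr ?exprn_gt0 // mulrC ler_pdivrMr ?exprn_gt0 // -exprMn.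
rewrite lerXn2r ?nnegrE ?mulr_ge0 ?normc_ge0 // mulrC.
by have := normc_zcM_le (invmx g) (SL2_wz gg); rewrite mulmxK.
Qed.

End LatticeSum.

(** * Smoothness of the Poincare series *)

Section ComplexFamilies.
Variables (R : realType) (I : choiceType) (D : set I) (V : normedModType R).
Variable U : set V.
Hypothesis oU : open U.
Implicit Types (Phi Psi : I -> V -> R[i]).

Definition UCc n Phi := UCn D n U (fun i x => complex.Re (Phi i x)) /\
  UCn D n U (fun i x => complex.Im (Phi i x)).

Lemma UCc_ext n Phi Psi : (forall i x, D i -> U x -> Phi i x = Psi i x) ->
  UCc n Phi -> UCc n Psi.
Proof.
by move=> e [h1 h2]; split; [apply: UCn_ext h1|apply: UCn_ext h2] => // i x Di Ux; rewrite e.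
Qed.

Lemma UCc_cst n (c : I -> R[i]) C : (forall i, D i -> normc (c i) <= C) ->
  UCc n (fun i _ => c i).
Proof.
move=> hC; split; apply: (@UCn_cst _ _ _ _ _ _ _ C) => // i Di.
  exact: le_trans (Re_le_normc _) (hC i Di).
exact: le_trans (Im_le_normc _) (hC i Di).
Qed.

Lemma UCcD n Phi Psi : UCc n Phi -> UCc n Psi -> UCc n (fun i x => Phi i x + Psi i x).
Proof.
move=> [a b] [c d]; split.
  by apply: UCn_ext (UCnD oU a c) => // i x _ _; rewrite raddfD.
by apply: UCn_ext (UCnD oU b d) => // i x _ _; rewrite raddfD.
Qed.

Lemma ReM (z w : R[i]) : complex.Re (z * w) = complex.Re z * complex.Re w - complex.Im z * complex.Im w.
Proof. by case: z w => [a b] [c d]. Qed.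

Lemma ImM (z w : R[i]) : complex.Im (z * w) = complex.Re z * complex.Im w + complex.Im z * complex.Re w.
Proof. by case: z w => [a b] [c d]. Qed.

Lemma ReZ (r : R) (z : R[i]) : complex.Re (r%:C * z) = r * complex.Re z.
Proof. by rewrite ReM /= mul0r subr0. Qed.

Lemma ImZ (r : R) (z : R[i]) : complex.Im (r%:C * z) = r * complex.Im z.
Proof. by rewrite ImM /= mul0r addr0. Qed.

Lemma ReV (z : R[i]) : complex.Re z^-1 = complex.Re z / nsq z.
Proof. by case: z. Qed.

Lemma ImV (z : R[i]) : complex.Im z^-1 = - complex.Im z / nsq z.
Proof. by case: z => a b; rewrite /= mulNr. Qed.

Lemma UCcM n Phi Psi : UCc n Phi -> UCc n Psi -> UCc n (fun i x => Phi i x * Psi i x).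
Proof.
move=> [a b] [c d]; split.
  apply: UCn_ext (UCnD oU (UCnM oU a c) (UCnN oU (UCnM oU b d))) => // i x _ _.
  by rewrite ReM.
apply: UCn_ext (UCnD oU (UCnM oU a d) (UCnM oU b c)) => // i x _ _.
by rewrite ImM.
Qed.

Lemma UCcX n Phi k : UCc n Phi -> UCc n (fun i x => Phi i x ^+ k).
Proof.
move=> h; elim: k => [|k IH].
  by apply: (@UCc_cst n (fun=> 1) 1) => i _; rewrite normc1.
by apply: UCc_ext (UCcM h IH) => i x _ _; rewrite exprS.
Qed.

Lemma UCcV n Phi e : 0 < e -> (forall i x, D i -> U x -> e <= normc (Phi i x)) ->
  UCc n Phi -> UCc n (fun i x => (Phi i x)^-1).
Proof.
move=> e0 he [a b].
have N : UCn D n U (fun i x => (nsq (Phi i x))^-1).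
  apply: (@UCnV _ _ _ _ _ _ _ (e ^+ 2)) => //; first by rewrite exprn_gt0.
    move=> i x Di Ux; rewrite ger0_norm ?nsq_ge0 // -normcE2.
    by rewrite lerXn2r ?nnegrE ?normc_ge0 ?(ltW e0) // he.
  exact: UCnD (UCnM oU a a) (UCnM oU b b).
split.
  by apply: UCn_ext (UCnM oU a N) => // i x _ _; rewrite ReV.
by apply: UCn_ext (UCnM oU (UCnN oU b) N) => // i x _ _; rewrite ImV.
Qed.

(** The derivative of a linear form along v is the constant f v, so only f itself has to be bounded
    on [U]. *)
Lemma UCn_linear n (f : V -> R) C : continuous f ->
  (forall (h : R) v x, f (h *: v + x) = h * f v + f x) ->
  (forall x, U x -> `|f x| <= C) -> UCn D n U (fun _ => f).
Proof.
move=> cf lf bf.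
have df x v : is_derive x v f (f v).
  have E : {near (0 : R)^', (fun=> f v) =1 (fun h : R => h^-1 *: ((f \o shift x) (h *: v) - f x))}.
    apply: filterS (nbhs_dnbhs_neq (0 : R)) => h h0 /=.
    by rewrite lf addrK [RHS]/(_ *: _) /= mulKf.
  have key : h^-1 *: ((f \o shift x) (h *: v) - f x) @[h --> (0 : R)^'] --> f v.
    exact: cvg_trans (near_eq_cvg E) (cvg_cst _).
  by apply: DeriveDef; [apply/cvg_ex; eexists; exact: key|exact: cvg_lim key].
case: n => [|n]; split.
- by exists C => i x _; exact: bf.
- by move=> i x _ _; exact: cf.
- by [].
- by exists C => i x _; exact: bf.
- by move=> i x _ _; exact: cf.
- move=> v; split=> [i x _ _|]; first by case: (df x v).
  apply: UCn_ext (@UCn_cst _ _ D _ n U (fun=> f v) `|f v| oU _) => // i x _ _.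
  by case: (df x v).
Qed.

End ComplexFamilies.

Section Continuity.
Variables (R : realType) (V : normedModType R).
Implicit Types f g : V -> R.

Lemma continuous_ext f g : f =1 g -> continuous f -> continuous g.
Proof. by move=> /funext ->. Qed.

Lemma continuous_lin2 f g (a b : R) : continuous f -> continuous g ->
  continuous (fun x => a * f x + b * g x).
Proof. by move=> cf cg x; apply: cvgD; apply: cvgMr; [exact: cf|exact: cg]. Qed.

Lemma continuous_sqr_dist f1 f2 f3 f4 :
  continuous f1 -> continuous f2 -> continuous f3 -> continuous f4 ->
  continuous (fun x => (f1 x - 1) ^+ 2 + f2 x ^+ 2 + (f3 x ^+ 2 + f4 x ^+ 2)).
Proof.
move=> c1 c2 c3 c4 x.
have c1' : {for x, continuous (fun x => f1 x - 1)}.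
  by apply: cvgB; [exact: c1|exact: cvg_cst].
by apply: cvgD; apply: cvgD; apply: cvgM;
  [exact: c1'|exact: c1'|exact: c2|exact: c2|exact: c3|exact: c3|exact: c4|exact: c4].
Qed.

End Continuity.

(** * Uniform estimates near a point of SL_2(R) *)

Section LocalFamily.
Variables (R : realType) (k m : nat) (D : set 'M[int]_2).
Hypothesis DSL2 : D `<=` SL2Z.
Variable g0 : 'M[R]_2.
Hypothesis g0S : SL2 g0.

(** Since gamma x = (gamma g0) (y x) and y x is close to the identity, gamma acts only through the
    coordinates of gamma g0, while x enters through a small neighbourhood of 1. *)
Let y (x : 'M[R]_2) := invmx g0 *m x.
Let U : set 'M[R]_2 := [set x | nsq (zc (y x) - 1) + nsq (wc (y x)) < 1 / 16].

Lemma continuous_entry (i j : 'I_2) : continuous (fun x : 'M[R]_2 => y x i j).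
Proof.
have -> : (fun x : 'M[R]_2 => y x i j) =
    (fun x => invmx g0 i ord0 * x ord0 j + invmx g0 i ord_max * x ord_max j).
  by apply/funext => x; rewrite /y mulmx2.
by apply: continuous_lin2; exact: coord_continuous.
Qed.

Lemma continuous_coordinates :
  [/\ continuous (fun x => complex.Re (zc (y x))), continuous (fun x => complex.Im (zc (y x))),
      continuous (fun x => complex.Re (wc (y x))) & continuous (fun x => complex.Im (wc (y x)))].
Proof.
have c a b i j i' j' : continuous (fun x => a * y x i j + b * y x i' j').
  by apply: continuous_lin2; exact: continuous_entry.
split.
- by apply: continuous_ext (c (1 / 2) (1 / 2) ord0 ord0 ord_max ord_max) => x /=; field.
- by apply: continuous_ext (c (1 / 2) (- (1 / 2)) ord_max ord0 ord0 ord_max) => x /=; field.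
- by apply: continuous_ext (c (1 / 2) (- (1 / 2)) ord0 ord0 ord_max ord_max) => x /=; field.
- by apply: continuous_ext (c (- (1 / 2)) (- (1 / 2)) ord_max ord0 ord0 ord_max) => x /=; field.
Qed.

Let oU : open U.
Proof.
have [c1 c2 c3 c4] := continuous_coordinates.
rewrite (_ : U = (fun x => nsq (zc (y x) - 1) + nsq (wc (y x))) @^-1` [set r | r < 1 / 16]) //.
apply: open_comp; last exact: open_lt.
have -> : (fun x => nsq (zc (y x) - 1) + nsq (wc (y x))) =
    (fun x => (complex.Re (zc (y x)) - 1) ^+ 2 + complex.Im (zc (y x)) ^+ 2 +
      (complex.Re (wc (y x)) ^+ 2 + complex.Im (wc (y x)) ^+ 2)).
  by apply/funext => x; rewrite /nsq !raddfB /= subr0.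
by move=> x _; exact: (continuous_sqr_dist c1 c2 c3 c4).
Qed.

Let Ug0 : U g0.
Proof.
rewrite /U /y /= mulVmx ?unitmxE ?g0S ?unitr1 //.
by rewrite /nsq /zc /wc !mxE /=; lra.
Qed.

Let U_bounds x : U x -> normc (zc (y x) - 1) <= 1 / 4 /\ normc (wc (y x)) <= 1 / 4.
Proof.
move=> h; have {}h : nsq (zc (y x) - 1) + nsq (wc (y x)) < 1 / 16 := h.
have := nsq_ge0 (zc (y x) - 1); have := nsq_ge0 (wc (y x)).
have q : 1 / 4 = Num.sqrt (1 / 16) :> R.
  by rewrite (_ : 1 / 16 = (1 / 4) ^+ 2); [rewrite sqrtr_sqr ger0_norm|field].
by move=> a b; rewrite q !normcS !ler_wsqrtr //; lra.
Qed.

Let UCc_zw n : UCc D U n (fun _ x => zc (y x)) /\ UCc D U n (fun _ x => wc (y x)).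
Proof.
have [c1 c2 c3 c4] := continuous_coordinates.
have Z x : U x -> normc (zc (y x)) <= 2.
  move=> /U_bounds [h _]; rewrite -[zc _](subrK 1) (le_trans (le_normcD _ _)) // normc1; lra.
have W x : U x -> normc (wc (y x)) <= 2.
  by move=> /U_bounds [_ h]; lra.
have L (h : R) v x i j : y (h *: v + x) i j = h * y v i j + y x i j.
  by rewrite /y mulmxDr -scalemxAr !mxE.
split; split; apply: (@UCn_linear _ _ _ _ _ oU _ _ 2) => //.
- by move=> h v x /=; rewrite !L; field.
- by move=> x /Z; apply: le_trans; exact: Re_le_normc.
- by move=> h v x /=; rewrite !L; field.
- by move=> x /Z; apply: le_trans; exact: Im_le_normc.
- by move=> h v x /=; rewrite !L; field.
- by move=> x /W; apply: le_trans; exact: Re_le_normc.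
- by move=> h v x /=; rewrite !L; field.
- by move=> x /W; apply: le_trans; exact: Im_le_normc.
Qed.

Let P gamma := zc (toR R gamma *m g0).
Let Q gamma := wc (toR R gamma *m g0).

Let P_bounds gamma : D gamma -> 1 <= normc (P gamma) /\ normc (Q gamma) <= normc (P gamma).
Proof.
move=> /DSL2 h; have s := SL2M (SL2_toR R h) g0S.
by split; [exact: SL2_normc_ge1|rewrite !normcS ler_wsqrtr // SL2_wz].
Qed.

(** Dividing by P gives zc (gamma x) = P L1 and wc (gamma x) = P L2, where the coefficients of L1
    and L2 have modulus at most 1. The term of the series is then |P|^(-m) times [Phi]: a summable
    coefficient, and a family bounded uniformly in gamma together with its derivatives. *)
Let phase gamma : R[i] := (normc (P gamma) ^+ m)%:C / P gamma ^+ m.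
Let L1 gamma x : R[i] := zc (y x) + conjc (Q gamma) / P gamma * wc (y x).
Let L2 gamma x : R[i] := Q gamma / P gamma * zc (y x) + conjc (P gamma) / P gamma * wc (y x).
Let Phi gamma x : R[i] := phase gamma * (L2 gamma x ^+ k * (L1 gamma x)^-1 ^+ (m + k)).

Let Phi_smooth n : UCc D U n Phi.
Proof.
have [Z W] := UCc_zw n.
have le1 (z w : R[i]) : 1 <= normc w -> normc z <= normc w -> normc (z / w) <= 1.
  move=> w1 zw; rewrite normcM normcV ler_pdivrMr ?mul1r //.
  exact: lt_le_trans w1.
have hph : UCc D U n (fun i _ => phase i).
  apply: (@UCc_cst _ _ _ _ _ oU _ _ 1) => i Di; have [p1 q1] := P_bounds Di.
  have p0 := lt_le_trans ltr01 p1.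
  rewrite normcM normcV normcX normcR ?exprn_ge0 ?normc_ge0 //.
  by rewrite divff // gt_eqF // exprn_gt0.
have hL1 : UCc D U n L1.
  apply: UCcD => //; apply: UCcM => //.
  apply: (@UCc_cst _ _ _ _ _ oU _ _ 1) => i Di; have [p1 q1] := P_bounds Di.
  by apply: le1; rewrite ?normc_conj.
have hL2 : UCc D U n L2.
  apply: UCcD => //; apply: UCcM => //.
    by apply: (@UCc_cst _ _ _ _ _ oU _ _ 1) => i Di; have [p1 q1] := P_bounds Di; exact: le1.
  apply: (@UCc_cst _ _ _ _ _ oU _ _ 1) => i Di; have [p1 q1] := P_bounds Di.
  by apply: le1; rewrite ?normc_conj.
apply: UCcM => //; apply: UCcM => //; apply: UCcX => //.
(* On [U] both |zc y - 1| and |wc y| are at most 1/4, so |L1| >= 1 - 1/4 - 1/4. *)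
apply: (@UCcV _ _ _ _ _ _ _ _ (1 / 2)) => //.
move=> i x Di /U_bounds [h1 h2]; have [p1 q1] := P_bounds Di.
have : normc (conjc (Q i) / P i * wc (y x)) <= 1 / 4.
  rewrite normcM -[1 / 4]mul1r ler_pM ?normc_ge0 //.
  by apply: le1; rewrite ?normc_conj.
have : 1 <= normc (L1 i x) + normc (zc (y x) - 1) + normc (conjc (Q i) / P i * wc (y x)).
  rewrite -normc1 -(normcN (zc _ - 1)) -(normcN (conjc _ / _ * _)).
  have e : (1 : R[i]) = L1 i x + (- (zc (y x) - 1)) + - (conjc (Q i) / P i * wc (y x)).
    by rewrite /L1; ring.
  rewrite {1}e (le_trans (le_normcD _ _)) // lerD2r.
  exact: le_normcD.
lra.
Qed.

Let Phi_term gamma x : D gamma ->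
  Fzw k m (zc (toR R gamma *m x)) (wc (toR R gamma *m x)) = (normc (P gamma) ^+ m)^-1%:C * Phi gamma x.
Proof.
move=> Dg; have [p1 _] := P_bounds Dg; have p0 := lt_le_trans ltr01 p1.
have P0 : P gamma != 0 by rewrite -normc_gt0.
have -> : toR R gamma *m x = toR R gamma *m g0 *m y x.
  by rewrite /y mulmxA mulmxK // unitmxE g0S unitr1.
rewrite /Fzw zcM wcM -/(P gamma) -/(Q gamma).
have -> : P gamma * zc (y x) + conjc (Q gamma) * wc (y x) = P gamma * L1 gamma x.
  by rewrite /L1; field.
have -> : Q gamma * zc (y x) + conjc (P gamma) * wc (y x) = P gamma * L2 gamma x.
  by rewrite /L2; field.
have q0 : (normc (P gamma) ^+ m)%:C != 0.
  by apply/eqP => /(congr1 (@complex.Re R)) /eqP /=; rewrite gt_eqF // exprn_gt0.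
have key (p u v q : R[i]) : p != 0 -> q != 0 ->
    (p * v) ^+ k / (p * u) ^+ (m + k) = q^-1 * (q / p ^+ m * (v ^+ k * u^-1 ^+ (m + k))).
  move=> p0' q0'; rewrite !exprMn exprVn !invfM exprD !invfM.
  have := expf_neq0 k p0'; have := expf_neq0 m p0'.
  move: (u ^- _) (v ^+ k) (p ^+ k) (p ^+ m) => u' v' a b *.
  by field; apply/and3P.
by rewrite (key _ _ _ _ P0 q0) /Phi /phase fmorphV.
Qed.

Lemma rsummable_normP : (3 <= m)%N -> rsummable D (fun gamma => (normc (P gamma) ^+ m)^-1).
Proof.
move=> m3; apply: le_lt_trans (rsummable_SL2Z m3 g0S).
by apply: le_esum_subset.
Qed.

Lemma local_family : (3 <= m)%N -> exists V : set 'M[R]_2, [/\ open V, V g0,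
  Cinfty V (fun x => rsum D (fun gamma =>
    complex.Re (Fzw k m (zc (toR R gamma *m x)) (wc (toR R gamma *m x)))))
  & Cinfty V (fun x => rsum D (fun gamma =>
    complex.Im (Fzw k m (zc (toR R gamma *m x)) (wc (toR R gamma *m x)))))].
Proof.
move=> m3; exists U; have sP := rsummable_normP m3; split => // n;
  have [h1 h2] := Phi_smooth n.
  apply: Cn_ext (Cn_rsum oU sP h1) => // x _; apply: eq_rsum => gamma Dg.
  by rewrite Phi_term // ReZ.
apply: Cn_ext (Cn_rsum oU sP h2) => // x _; apply: eq_rsum => gamma Dg.
by rewrite Phi_term // ImZ.
Qed.

Lemma csummable_F : (3 <= m)%N -> csummable D (PoincareTerm (@F R k m) g0).
Proof.
move=> m3; have sP := rsummable_normP m3.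
have B gamma : D gamma -> normc (PoincareTerm (@F R k m) g0 gamma) <= (normc (P gamma) ^+ m)^-1.
  move=> /DSL2 h; have s := SL2M (SL2_toR R h) g0S.
  by rewrite /PoincareTerm FE // normc_Fzw // SL2_wz.
split; apply: rsummable_le sP => gamma Dg; apply: le_trans (B gamma Dg).
  exact: Re_le_normc.
exact: Im_le_normc.
Qed.

End LocalFamily.

Section PoincareSeries.
Variables (R : realType) (k m : nat) (D : set 'M[int]_2).
Hypotheses (m3 : (3 <= m)%N) (DSL2 : D `<=` SL2Z).

Lemma Poincare_smooth : smooth_SL2 (Poincare D (@F R k m)).
Proof.
have E x gamma : D gamma -> SL2 x ->
    PoincareTerm (@F R k m) x gamma = Fzw k m (zc (toR R gamma *m x)) (wc (toR R gamma *m x)).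
  by move=> /DSL2 Dg xS; rewrite /PoincareTerm FE //; exact: (SL2M (SL2_toR R Dg) xS).
split=> g gS; have [U [oU Ug h1 h2]] := local_family k DSL2 gS m3.
  exists U; eexists; split; [exact: oU|exact: Ug|exact: h1|] => x _ xS.
  by apply: eq_rsum => gamma Dg; rewrite E.
exists U; eexists; split; [exact: oU|exact: Ug|exact: h2|] => x _ xS.
by apply: eq_rsum => gamma Dg; rewrite E.
Qed.

Lemma rsum_reindex (f : 'M[int]_2 -> R) (e : 'M[int]_2 -> 'M[int]_2) :
  set_bij D D e -> rsum D (f \o e) = rsum D f.
Proof. move=> be; rewrite /rsum; congr (fine _ - fine _); symmetry.
  exact: (reindex_esum D D e (fun i => (Num.max (f i) 0)%:E)).
exact: (reindex_esum D D e (fun i => (Num.max (- f i) 0)%:E)). Qed.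

Lemma Poincare_invariant gamma (g : 'M[R]_2) : is_subgroup D -> D gamma ->
  Poincare D (@F R k m) (toR R gamma *m g) = Poincare D (@F R k m) g.
Proof.
move=> [_ DM DV] Dg.
have gU : gamma \in unitmx by rewrite unitmxE (DSL2 Dg) unitr1.
have be : set_bij D D (fun h => h *m gamma).
  split=> [h /= Dh|h h' _ _ /(congr1 (mulmx^~ (invmx gamma)))|h Dh]; first exact: DM.
    by rewrite !mulmxK.
  by exists (h *m invmx gamma); [apply: DM => //; exact: DV|rewrite mulmxKV].
rewrite /Poincare /csum; congr (_ +i* _).
  rewrite -[RHS](rsum_reindex _ be); apply: eq_rsum => h Dh /=.
  by rewrite /PoincareTerm toRM mulmxA.
rewrite -[RHS](rsum_reindex _ be); apply: eq_rsum => h Dh /=.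
by rewrite /PoincareTerm toRM mulmxA.
Qed.

End PoincareSeries.

Section SmoothF.
Variables (R : realType) (k m : nat).

Lemma rsum_set1 (I : choiceType) (i : I) (f : I -> R) : rsum [set i] f = f i.
Proof.
rewrite /rsum !esum_set1 ?lee_fin ?le_max ?lexx ?orbT //=.
by have [a|a] := leP (f i) 0; have [b|b] := leP (- f i) 0; lra.
Qed.

(** F is its own Poincare series over the trivial group, so the smoothness already proved for series
    applies. *)
Lemma F_smooth : (3 <= m)%N -> smooth_SL2 (@F R k m).
Proof.
move=> m3.
have -> : @F R k m = Poincare [set 1%:M] (@F R k m).
  apply/funext => g; rewrite /Poincare /csum !rsum_set1 /PoincareTerm /toR map_mx1 mul1mx.
  by case: (F k m g).
by apply: Poincare_smooth => // g ->; rewrite /SL2Z /= det1.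
Qed.

End SmoothF.

(** * Invariant volume on the plane of pairs of complex numbers *)

Section Transport.
Variable R : realType.
Notation mu := (@lebesgue_measure R).
Notation RR := (measurableTypeR R).

Lemma lebesgue_itv (a b : R) : a <= b -> mu `]a, b]%classic = (b - a)%:E.
Proof.
move=> ab; rewrite lebesgue_measure_itv /= lte_fin; case: ltP => // ba.
by rewrite (le_anti (introT andP (conj ab ba))) subrr.
Qed.

(** After division by c the measure gives half-open intervals their length, and these determine
    Lebesgue measure. *)
Lemma measure_transport (nu : {measure set (measurableTypeR R) -> \bar R}) (c : R) : 0 < c ->
  (forall a b : R, a < b -> nu `]a, b]%classic = (c * (b - a))%:E) ->
  forall A, measurable A -> nu A = (c%:E * mu A)%E.
Proof.
move=> c0 h A mA.
have ci0 : 0 <= c^-1 by rewrite invr_ge0 ltW.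
have -> : mu A = (c^-1%:E * nu A)%E.
  rewrite -[RHS]/(mscale (NngNum ci0) nu A).
  apply: lebesgue_measure_unique => // X /ocitvP[->|[[a b] /= ab ->]].
    by rewrite !measure0.
  by rewrite /mscale /= h // lebesgue_itv ?ltW // -EFinM mulKf // gt_eqF.
by rewrite muleA -EFinM divff ?mul1e // gt_eqF.
Qed.

(** A change of variables that only asks for the preimages of intervals; translations, dilations and
    reflections of the line follow from it. *)
Lemma integral_transport d (T : measurableType d) (m : {measure set T -> \bar R})
    (phi : T -> RR) (c : R) : 0 < c -> measurable_fun setT phi ->
  (forall a b : R, a < b -> m (phi @^-1` `]a, b]%classic) = (c * (b - a))%:E) ->
  forall f : RR -> \bar R, measurable_fun setT f -> (forall x, 0 <= f x)%E ->
  (\int[m]_x f (phi x) = c%:E * \int[mu]_y f y)%E.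
Proof.
move=> c0 mphi h f mf f0.
transitivity (\int[pushforward m phi]_y f y)%E.
  by rewrite (ge0_integral_pushforward mphi _ measurableT mf) // => x _; exact: f0.
have cn : 0 <= c by rewrite ltW.
transitivity (\int[mscale (NngNum cn) mu]_y f y)%E; last by rewrite ge0_integral_mscale.
apply: eq_measure_integral => A mA _; rewrite /mscale /=.
exact: (measure_transport c0 _ mA).
Qed.

Lemma integral_shift (f : RR -> \bar R) (a : R) : measurable_fun setT f -> (forall x, 0 <= f x)%E ->
  (\int[mu]_x f (x + a)%R = \int[mu]_x f x)%E.
Proof.
move=> mf f0; rewrite (@integral_transport _ _ mu (fun x : RR => x + a : RR) 1) ?mul1e //.
  have H : measurable_fun setT (fun x : RR => x + a : R).
    by apply: measurable_funD => //; exact: measurable_cst.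
  exact: H.
move=> x y xy; have -> : (fun z : RR => z + a) @^-1` `]x, y]%classic = `](x - a), (y - a)]%classic.
  by apply/seteqP; split=> z /=; rewrite !in_itv /= => /andP[]; rewrite ltrBlDr lerBrDr => -> ->.
apply: etrans (lebesgue_itv _) _; first by rewrite lerD2r ltW.
by congr (_%:E); ring.
Qed.

Lemma integral_scale (f : RR -> \bar R) (c : R) : 0 < c ->
  measurable_fun setT f -> (forall x, 0 <= f x)%E ->
  (c%:E * \int[mu]_x f (c * x)%R = \int[mu]_x f x)%E.
Proof.
move=> c0 mf f0.
rewrite (@integral_transport _ _ mu (fun x : RR => c * x : RR) c^-1) ?invr_gt0 //.
- by rewrite muleA -EFinM divff ?mul1e // gt_eqF.
- have H : measurable_fun setT (fun x : RR => c * x : R).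
    by apply: measurable_funM => //; exact: measurable_cst.
  exact: H.
move=> x y xy; have -> : (fun z : RR => c * z) @^-1` `]x, y]%classic = `](c^-1 * x), (c^-1 * y)]%classic.
  apply/seteqP; split=> z /=; rewrite !in_itv /= => /andP[];
  by rewrite ltr_pdivrMl // ler_pdivlMl // => -> ->.
apply: etrans (lebesgue_itv _) _; first by rewrite ler_pM2l ?invr_gt0 // ltW.
by rewrite mulrBr.
Qed.

End Transport.

(** The product is packed as a sigma-finite measure so that it can itself be a factor of a product
    to which Tonelli applies. *)
Lemma sigma_finite_product d1 d2 (T1 : measurableType d1) (T2 : measurableType d2) (R : realType)
    (m1 : {sigma_finite_measure set T1 -> \bar R}) (m2 : {sigma_finite_measure set T2 -> \bar R}) :
  exists A : {sigma_finite_measure set (T1 * T2)%type -> \bar R}, forall S, A S = (m1 \x m2)%E S.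
Proof.
have sf : sigma_finite setT (m1 \x m2)%E.
  have /sigma_finiteP[F [FT Fn Ff]] := sigma_finiteT m1.
  have /sigma_finiteP[G [GT Gn Gf]] := sigma_finiteT m2.
  exists (fun n => F n `*` G n) => [|n].
    apply/seteqP; split=> // -[x y] _.
    have [k _ Fx] : (\bigcup_n F n) x by rewrite -FT.
    have [l _ Gy] : (\bigcup_n G n) y by rewrite -GT.
    exists (maxn k l) => //; split=> /=.
      by move: Fx; exact/subsetPset/Fn/leq_maxl.
    by move: Gy; exact/subsetPset/Gn/leq_maxr.
  have [mF fF] := Ff n; have [mG fG] := Gf n; split; first exact: measurableX.
  by rewrite product_measure1E // lte_mul_pinfty // ge0_fin_numE.
pose H := Measure_isSigmaFinite.Build _ _ _ (m1 \x m2)%E sf.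
pose A : {sigma_finite_measure set (T1 * T2)%type -> \bar R} := HB.pack (m1 \x m2)%E H.
by exists A.
Qed.

(** * Area in the plane and the law of the squared norm *)

Section Plane.
Variable R : realType.
Notation mu := (@lebesgue_measure R).
Notation RR := (measurableTypeR R).
Notation plane := (RR * RR)%type.

Notation area := (mu \x mu)%E.

Lemma measurable_plane d (T : measurableType d) (f g : T -> R) :
  measurable_fun setT f -> measurable_fun setT g ->
  measurable_fun setT (fun x => (f x, g x) : plane).
Proof. by move=> mf mg; apply/measurable_fun_pairP; split. Qed.

Lemma measurable_fst2 : measurable_fun setT (fun p : plane => p.1 : R).
Proof. exact: measurable_fst. Qed.

Lemma measurable_snd2 : measurable_fun setT (fun p : plane => p.2 : R).
Proof. exact: measurable_snd. Qed.

Lemma measurable_translate (a : plane) : measurable_fun setT (fun p : plane => (p.1 + a.1, p.2 + a.2) : plane).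
Proof.
by apply: measurable_plane; apply: measurable_funD; do ?[exact: measurable_fst2|
  exact: measurable_snd2|exact: measurable_cst].
Qed.

Lemma area_shift (f : plane -> \bar R) (a : plane) : measurable_fun setT f -> (forall x, 0 <= f x)%E ->
  (\int[area]_p f (p.1 + a.1, p.2 + a.2)%R = \int[area]_p f p)%E.
Proof.
move=> mf f0; pose g (p : plane) := f (p.1 + a.1, p.2 + a.2)%R.
have mg : measurable_fun setT g.
  by apply: measurableT_comp => //; exact: measurable_translate.
have g0 p : (0 <= g p)%E by exact: f0.
rewrite [LHS](fubini_tonelli1 _ mg g0) [RHS](fubini_tonelli1 _ mf f0).
rewrite /fubini_F /=.
under eq_integral => x _.
  rewrite (@integral_shift _ (fun y => f (x + a.1, y))) //; last exact: measurableT_comp.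
  over.
rewrite (@integral_shift _ (fun x => \int[mu]_y f (x, y))%E) //.
  exact: measurable_fun_fubini_tonelli_F.
by move=> x; apply: integral_ge0.
Qed.

Lemma area_scale (f : plane -> \bar R) (c : R) : 0 < c -> measurable_fun setT f -> (forall x, 0 <= f x)%E ->
  ((c ^+ 2)%:E * \int[area]_p f (c * p.1, c * p.2)%R = \int[area]_p f p)%E.
Proof.
move=> c0 mf f0; pose g (p : plane) := f (c * p.1, c * p.2)%R.
have mg : measurable_fun setT g.
  apply: measurableT_comp => //.
  by apply: measurable_plane; apply: measurable_funM; do ?[exact: measurable_fst2|
    exact: measurable_snd2|exact: measurable_cst].
have g0 p : (0 <= g p)%E by exact: f0.
rewrite [X in (_ * X)%E](fubini_tonelli1 _ mg g0) [RHS](fubini_tonelli1 _ mf f0).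
rewrite /fubini_F /= expr2 EFinM -muleA -ge0_integralZl_EFin ?ltW //; last 2 first.
- by move=> x _; exact: integral_ge0.
- exact: (measurable_fun_fubini_tonelli_F _ mg g0).
under eq_integral => x _.
  rewrite (@integral_scale _ (fun y => f (c * x, y))) //; last exact: measurableT_comp.
  over.
rewrite (@integral_scale _ (fun x => \int[mu]_y f (x, y))%E) //.
  exact: measurable_fun_fubini_tonelli_F.
by move=> x; apply: integral_ge0.
Qed.

Definition nsq2 (p : plane) : R := p.1 ^+ 2 + p.2 ^+ 2.

Lemma measurable_nsq2 : measurable_fun setT nsq2.
Proof.
by apply: measurable_funD; apply: measurable_funX; [exact: measurable_fst2|exact: measurable_snd2].
Qed.

Definition disc r : set plane := [set p | nsq2 p <= r].

Lemma measurable_disc r : measurable (disc r).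
Proof.
have := measurable_nsq2; move=> /(_ measurableT `]-oo, r]%classic).
by rewrite setTI /disc => /(_ (measurable_itv _)); congr measurable; apply/seteqP; split => p /=; rewrite in_itv.
Qed.

Lemma area_disc_scale r : 0 < r -> area (disc r) = (r%:E * area (disc 1%R))%E.
Proof.
move=> r0.
have I s : area (disc s) = (\int[area]_p (\1_(disc s) p)%:E)%E.
  by rewrite integral_indic ?setIT //; exact: measurable_disc.
rewrite !I -(@area_scale (fun p => (\1_(disc r) p)%:E) (Num.sqrt r)) ?sqrtr_gt0 //; last first.
  apply/measurable_EFinP; apply: measurable_indic; exact: measurable_disc.
rewrite sqr_sqrtr ?ltW //; congr (_ * _)%E; apply: eq_integral => p _; congr (_%:E).
by rewrite !indicE; congr (_%:R); congr nat_of_bool; apply/idP/idP;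
  rewrite !inE /disc /nsq2 /= !exprMn -mulrDr sqr_sqrtr ?(ltW r0) // ger_pMr.
Qed.

Lemma area_rect (a b c d : R) : a <= b -> c <= d ->
  area (`]a, b]%classic `*` `]c, d]%classic) = ((b - a) * (d - c))%:E.
Proof.
move=> ab cd; rewrite product_measure1E; do ?exact: measurable_itv.
by rewrite EFinM; congr (_ * _)%E; exact: lebesgue_itv.
Qed.

Lemma area_disc1_fin : (area (disc 1%R) < +oo)%E.
Proof.
pose Q := `]-2, 2]%classic : set RR.
apply: (@le_lt_trans _ _ (area (Q `*` Q))).
  have mQ : measurable Q by exact: measurable_itv.
  apply: le_measure; rewrite ?inE; [exact: measurable_disc|exact: measurableX|].
  move=> [x y]; rewrite /disc /nsq2 /= => h; rewrite /Q /= !in_itv /=.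
  by split; apply/andP; split; nra.
by rewrite area_rect ?ltry //; lra.
Qed.

Lemma area_disc1_gt0 : (0 < area (disc 1%R))%E.
Proof.
pose Q := `]0, 1/2]%classic : set RR.
apply: (@lt_le_trans _ _ (area (Q `*` Q))).
  by rewrite area_rect ?lte_fin; lra.
have mQ : measurable Q by exact: measurable_itv.
apply: le_measure; rewrite ?inE; [exact: measurableX|exact: measurable_disc|].
by move=> [x y]; rewrite /disc /nsq2 /Q /= !in_itv /= => -[/andP[? ?] /andP[? ?]]; nra.
Qed.

Definition disc_area : R := fine (area (disc 1%R)).

Lemma disc_area_gt0 : 0 < disc_area.
Proof. by rewrite fine_gt0 // area_disc1_gt0 area_disc1_fin. Qed.

Lemma area_disc r : 0 <= r -> area (disc r) = (r * disc_area)%:E.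
Proof.
have fin : area (disc 1%R) \is a fin_num.
  by rewrite fin_numElt area_disc1_fin (lt_trans _ area_disc1_gt0) // ltNyr.
have pos s : 0 < s -> area (disc s) = (s * disc_area)%:E.
  by move=> s0; rewrite area_disc_scale // EFinM fineK.
rewrite le_eqVlt => /orP[/eqP<-|]; last exact: pos.
(* The scaling argument needs a positive radius; the disc of radius 0 is enclosed in discs of
   arbitrarily small area. *)
rewrite mul0r; apply/eqP; rewrite eq_le measure_ge0 andbT; apply/lee_addgt0Pr => e e0.
rewrite add0e; apply: (@le_trans _ _ (area (disc (e / disc_area)))).
  apply: le_measure; rewrite ?inE; [exact: measurable_disc|exact: measurable_disc|].
  by move=> p; rewrite /disc /= => /le_trans; apply; rewrite divr_ge0 ?ltW ?disc_area_gt0.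
by rewrite pos ?divr_gt0 ?disc_area_gt0 // divfK // gt_eqF ?disc_area_gt0.
Qed.

(* Adding a multiple of Lebesgue measure on the negative half-line turns the
   law of the squared norm into a multiple of Lebesgue measure on the line. *)
Lemma area_annulus (A : set RR) : measurable A -> A `<=` `[0, +oo[%classic ->
  area (nsq2 @^-1` A) = (disc_area%:E * mu A)%E.
Proof.
move=> mA A0.
have mN : measurable (`]-oo, 0[%classic : set RR) by exact: measurable_itv.
have d0 : 0 <= disc_area by rewrite ltW // disc_area_gt0.
have mn : measurable_fun setT (nsq2 : plane -> RR) by exact: measurable_nsq2.
pose nu1 := pushforward area (nsq2 : plane -> RR).
have nu1E (a b : R) : nu1 `]a, b]%classic = area (disc b `\` disc a).
  rewrite /nu1 /pushforward; congr (_ _); apply/seteqP; split=> q /=; rewrite in_itv /disc /= ltNge.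
    by move=> /andP[/negP h1 h2]; split.
  by move=> [h1 /negP h2]; apply/andP.
have disc_neg (b : R) : b < 0 -> disc b = set0.
  move=> b0; apply/seteqP; split=> // q; rewrite /disc /= => h.
  by have := addr_ge0 (sqr_ge0 q.1) (sqr_ge0 q.2); rewrite -/(nsq2 q) leNgt (le_lt_trans h b0).
have fin (b : R) : (area (disc b) < +oo)%E.
  have [b0|b0] := leP 0 b; first by rewrite area_disc // ltry.
  by rewrite disc_neg // measure0 ltry.
have nu1D (a b : R) : a < b -> nu1 `]a, b]%classic = (area (disc b) - area (disc a))%E.
  move=> ab; rewrite nu1E measureD ?fin //; do ?exact: measurable_disc.
  congr (_ - area _)%E; apply/setIidr => q; rewrite /disc /= => h.
  exact: le_trans (ltW ab).
pose nu2 := mscale (NngNum d0) (mrestr mu mN).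
have nu2E (a b : R) : a < b -> nu2 `]a, b]%classic = (disc_area * (Num.min b 0 - Num.min a 0))%:E.
  move=> ab; rewrite /nu2 /mscale /= EFinM; congr (_ * _)%E.
  have -> : mrestr mu mN `]a, b]%classic = mu (`]a, b]%classic `&` `]-oo, 0[%classic) by [].
  have [a0|a0] := leP 0 a.
    rewrite [X in mu X](_ : _ = set0) ?measure0; last first.
      by apply/seteqP; split=> // x /=; rewrite !in_itv /=; lra.
    by rewrite min_r ?(le_trans a0) ?ltW // subrr.
  have [b0|b0] := leP 0 b.
    rewrite [X in mu X](_ : _ = `]a, 0[%classic); last first.
      by apply/seteqP; split=> x /=; rewrite !in_itv /=; lra.
    by rewrite lebesgue_measure_itv /= lte_fin a0 EFinB.
  rewrite [X in mu X](_ : _ = `]a, b]%classic); first by rewrite lebesgue_itv ?ltW.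
  by apply/seteqP; split=> x /=; rewrite !in_itv /=; lra.
have H (a b : R) : a < b -> measure_add nu1 nu2 `]a, b]%classic = (disc_area * (b - a))%:E.
  move=> ab; transitivity (nu1 `]a, b]%classic + nu2 `]a, b]%classic)%E; first exact: measure_addE.
  rewrite nu1D // nu2E //.
  have [a0|a0] := leP 0 a.
    have b0 := le_trans a0 (ltW ab).
    by rewrite !area_disc // !min_r // subrr mulr0 adde0 -EFinB; congr (_%:E); ring.
  rewrite (disc_neg a) // measure0 sube0.
  have [b0|b0] := leP 0 b; first by rewrite area_disc // -EFinD; congr (_%:E); ring.
  by rewrite disc_neg // measure0 add0e.
rewrite -(measure_transport disc_area_gt0 (H mn) mA).
transitivity (nu1 A + nu2 A)%E; last by apply/esym; exact: measure_addE.
have -> : nu2 A = 0%E; last by rewrite adde0.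
pose N : set RR := `]-oo, 0[%classic.
transitivity (disc_area%:E * mu (A `&` N))%E; first by [].
rewrite (_ : A `&` _ = set0) ?measure0 ?mule0 //.
apply/seteqP; split=> // x [/A0]; rewrite /N /= !in_itv /= andbT => x0.
by rewrite ltNge x0.
Qed.

Lemma area_radial (f : RR -> \bar R) : measurable_fun setT f -> (forall x, 0 <= f x)%E ->
  (forall x, x < 0 -> f x = 0%E) ->
  (\int[area]_p f (nsq2 p) = disc_area%:E * \int[mu]_x f x)%E.
Proof.
move=> mf f0 fN; have mn : measurable_fun setT (nsq2 : plane -> RR) by exact: measurable_nsq2.
have d0 : 0 <= disc_area by rewrite ltW // disc_area_gt0.
have mP : measurable (`[0, +oo[%classic : set RR) by exact: measurable_itv.
have restr : (\int[mu]_x f x = \int[mu]_(x in `[0%R, +oo[) f x)%E.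
  rewrite [RHS]integral_mkcond; apply: eq_integral => x _; rewrite patchE.
  by case: ifPn => //; rewrite notin_setE /= in_itv /= andbT => /negP; rewrite -ltNge => /fN.
rewrite restr.
transitivity (\int[pushforward area (nsq2 : plane -> RR)]_(y in `[0%R, +oo[) f y)%E.
  rewrite (ge0_integral_pushforward mn _ mP) //; last exact: measurable_funTS.
  rewrite (_ : _ @^-1` _ = setT) //; apply/seteqP; split=> // q _ /=.
  by rewrite in_itv /= andbT addr_ge0 ?sqr_ge0.
transitivity (\int[mscale (NngNum d0) mu]_(y in `[0%R, +oo[) f y)%E.
  apply: eq_measure_integral => A mA A0; rewrite /mscale /=.
  exact: area_annulus.
by rewrite ge0_integral_mscale //; exact: measurable_funTS.
Qed.

Definition invariant_area (A : {measure set plane -> \bar R}) (c : R) : Prop :=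
  [/\ 0 < c,
    forall (f : plane -> \bar R) (a : plane), measurable_fun setT f -> (forall p, 0 <= f p)%E ->
      (\int[A]_p f (p.1 + a.1, p.2 + a.2)%R = \int[A]_p f p)%E &
    forall f : RR -> \bar R, measurable_fun setT f -> (forall x, 0 <= f x)%E ->
      (forall x, x < 0 -> f x = 0%E) ->
      (\int[A]_p f (nsq2 p) = c%:E * \int[mu]_x f x)%E].

Lemma invariant_area_exists :
  exists (A : {sigma_finite_measure set plane -> \bar R}) (c : R), invariant_area A c.
Proof.
have [A hA] := sigma_finite_product mu mu.
have I (f : plane -> \bar R) : (\int[A]_p f p = \int[area]_p f p)%E.
  by apply: eq_measure_integral => S _ _; exact: hA.
exists A, disc_area; split; first exact: disc_area_gt0.
  by move=> f a mf f0; rewrite !I; exact: area_shift.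
by move=> f mf f0 fN; rewrite I; exact: area_radial.
Qed.

End Plane.

(* The product measure is only used through its invariance, so that conversion
   never has to unfold it. *)
Section Volume.
Variable R : realType.
Notation mu := (@lebesgue_measure R).
Notation RR := (measurableTypeR R).
Notation plane := (RR * RR)%type.
Variables (area : {sigma_finite_measure set plane -> \bar R}) (ca : R).
Hypothesis areaP : invariant_area area ca.
Notation vol := (area \x area)%E.
Notation space := (plane * plane)%type.

Definition toC (p : plane) : R[i] := p.1 +i* p.2.
Definition ofC (z : R[i]) : plane := (complex.Re z, complex.Im z).

Lemma toCK : cancel toC ofC. Proof. by case. Qed.
Lemma ofCK : cancel ofC toC. Proof. by case. Qed.

Lemma ofCD (p : plane) z : ofC (toC p + z) = (p.1 + (ofC z).1, p.2 + (ofC z).2).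
Proof. by case: p z => [a b] [c d]. Qed.

Lemma nsq_toC p : nsq (toC p) = nsq2 p. Proof. by case: p. Qed.

Lemma measurable_11 : measurable_fun setT (fun v : space => v.1.1 : R).
Proof. by apply: (measurableT_comp (@measurable_fst2 R)); exact: measurable_fst. Qed.
Lemma measurable_12 : measurable_fun setT (fun v : space => v.1.2 : R).
Proof. by apply: (measurableT_comp (@measurable_snd2 R)); exact: measurable_fst. Qed.
Lemma measurable_21 : measurable_fun setT (fun v : space => v.2.1 : R).
Proof. by apply: (measurableT_comp (@measurable_fst2 R)); exact: measurable_snd. Qed.
Lemma measurable_22 : measurable_fun setT (fun v : space => v.2.2 : R).
Proof. by apply: (measurableT_comp (@measurable_snd2 R)); exact: measurable_snd. Qed.

Lemma measurable_lincomb (a b c d : R) : measurable_fun setT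
  (fun v : space => a * v.1.1 + b * v.1.2 + (c * v.2.1 + d * v.2.2) : R).
Proof.
by apply: measurable_funD; apply: measurable_funD; apply: measurable_funM;
  do ?[exact: measurable_cst|exact: measurable_11|exact: measurable_12
    |exact: measurable_21|exact: measurable_22].
Qed.

Lemma measurable_space d (T : measurableType d) (f1 f2 f3 f4 : T -> R) :
  measurable_fun setT f1 -> measurable_fun setT f2 -> measurable_fun setT f3 -> measurable_fun setT f4 ->
  measurable_fun setT (fun x => ((f1 x, f2 x), (f3 x, f4 x)) : space).
Proof.
move=> m1 m2 m3 m4; have h1 := measurable_plane m1 m2; have h2 := measurable_plane m3 m4.
by apply/measurable_fun_pairP; split; [exact: h1|exact: h2].
Qed.

Definition clin (a b c d : R[i]) (v : space) : space :=
  (ofC (a * toC v.1 + b * toC v.2), ofC (c * toC v.1 + d * toC v.2)).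

Lemma measurable_clin a b c d : measurable_fun setT (clin a b c d).
Proof.
have E : clin a b c d = (fun v : space =>
  ((complex.Re a * v.1.1 + - complex.Im a * v.1.2 + (complex.Re b * v.2.1 + - complex.Im b * v.2.2),
    complex.Im a * v.1.1 + complex.Re a * v.1.2 + (complex.Im b * v.2.1 + complex.Re b * v.2.2)),
   (complex.Re c * v.1.1 + - complex.Im c * v.1.2 + (complex.Re d * v.2.1 + - complex.Im d * v.2.2),
    complex.Im c * v.1.1 + complex.Re c * v.1.2 + (complex.Im d * v.2.1 + complex.Re d * v.2.2)))).
  apply/funext => -[[x y] [s t]]; rewrite /clin /ofC /toC /=.
  by case: a b c d => [a1 a2] [b1 b2] [c1 c2] [d1 d2] /=; congr ((_, _), (_, _)); ring.
by rewrite E; apply: measurable_space; exact: measurable_lincomb.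
Qed.

(** On each fibre where the second coordinate is fixed, the shear is a translation of the first
    coordinate. *)
Lemma vol_shear1 (c : R[i]) (f : space -> \bar R) : measurable_fun setT f -> (forall v, 0 <= f v)%E ->
  (\int[vol]_v f (clin 1%R c 0%R 1%R v) = \int[vol]_v f v)%E.
Proof.
move=> mf f0; pose g v := f (clin 1 c 0 1 v).
have mg : measurable_fun setT g by apply: measurableT_comp => //; exact: measurable_clin.
have g0 v : (0 <= g v)%E by exact: f0.
rewrite [LHS](fubini_tonelli2 _ mg g0) [RHS](fubini_tonelli2 _ mf f0).
apply: eq_integral => w _; rewrite /fubini_G /g.
have mfw : measurable_fun setT (fun z => f (z, w)) by exact: measurableT_comp.
have [_ area_shift _] := areaP; rewrite -(area_shift (fun z => f (z, w)) (ofC (c * toC w)) mfw) //.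
apply: eq_integral => z _; congr f; rewrite /clin !mul1r mul0r add0r toCK.
by rewrite ofCD.
Qed.

Lemma vol_shear2 (c : R[i]) (f : space -> \bar R) : measurable_fun setT f -> (forall v, 0 <= f v)%E ->
  (\int[vol]_v f (clin 1%R 0%R c 1%R v) = \int[vol]_v f v)%E.
Proof.
move=> mf f0; pose g v := f (clin 1 0 c 1 v).
have mg : measurable_fun setT g by apply: measurableT_comp => //; exact: measurable_clin.
have g0 v : (0 <= g v)%E by exact: f0.
rewrite [LHS](fubini_tonelli1 _ mg g0) [RHS](fubini_tonelli1 _ mf f0).
apply: eq_integral => w _; rewrite /fubini_F /g.
have mfw : measurable_fun setT (fun z => f (w, z)) by exact: measurableT_comp.
have [_ area_shift _] := areaP; rewrite -(area_shift (fun z => f (w, z)) (ofC (c * toC w)) mfw) //.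
apply: eq_integral => z _; congr f; rewrite /clin !mul1r mul0r addr0 toCK.
by rewrite /= addrC ofCD.
Qed.

(** By [zcM] and [wcM], this is left multiplication by the matrix with coordinates p and q, extended
    from SL_2(R) to all pairs (z, w). *)
Definition act (p q : R[i]) := clin p (conjc q) q (conjc p).

(* An element of SU(1,1) that is not diagonal is a product of three shears. *)
Lemma act_shears p q v : q != 0 -> nsq p - nsq q = 1 ->
  act p q v = clin 1 ((p - 1) / q) 0 1 (clin 1 0 q 1 (clin 1 ((conjc p - 1) / q) 0 1 v)).
Proof.
move=> q0 pq; rewrite /act /clin /= !ofCK !mul1r !mul0r !add0r !addr0.
have e : p * conjc p - q * conjc q = 1.
  by rewrite !mulcJ -rmorphB pq.
have e' : conjc q = (p * conjc p - 1) / q by rewrite -e; field.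
congr (ofC _, ofC _); last by field.
by rewrite [conjc q]e'; field.
Qed.

(** The elements to be unfolded lie outside the stabilizer, and for them q is nonzero; the three
    shears then apply one after the other. *)
Lemma vol_act p q (f : space -> \bar R) : q != 0 -> nsq p - nsq q = 1 ->
  measurable_fun setT f -> (forall v, 0 <= f v)%E ->
  (\int[vol]_v f (act p q v) = \int[vol]_v f v)%E.
Proof.
move=> q0 pq mf f0.
transitivity (\int[vol]_v f (clin 1%R ((p - 1) / q)%R 0%R 1%R
  (clin 1%R 0%R q 1%R (clin 1%R ((conjc p - 1) / q)%R 0%R 1%R v))))%E.
  by apply: eq_integral => v _; rewrite act_shears.
rewrite (@vol_shear1 _ (fun v => f (clin 1 ((p - 1) / q) 0 1 (clin 1 0 q 1 v)))) //; last first.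
  exact: (measurableT_comp (measurableT_comp mf (measurable_clin _ _ _ _)) (measurable_clin _ _ _ _)).
rewrite (@vol_shear2 _ (fun v => f (clin 1 ((p - 1) / q) 0 1 v))) //; last first.
  exact: (measurableT_comp mf (measurable_clin _ _ _ _)).
exact: vol_shear1.
Qed.

Lemma vol_biradial (h : plane -> \bar R) : measurable_fun setT h -> (forall p, 0 <= h p)%E ->
  (forall x y, x < 0 -> h (x, y) = 0%E) -> (forall x y, y < 0 -> h (x, y) = 0%E) ->
  (\int[vol]_v h (nsq2 v.2, nsq2 v.1) = (ca ^+ 2)%:E * \int[mu]_y \int[mu]_x h (x, y))%E.
Proof.
move=> mh h0 hx hy; have mn := @measurable_nsq2 R.
pose g (v : space) := h (nsq2 v.2, nsq2 v.1).
have mg : measurable_fun setT g.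
  apply: measurableT_comp => //; apply: measurable_plane.
    by apply: (measurableT_comp mn); exact: measurable_snd.
  by apply: (measurableT_comp mn); exact: measurable_fst.
have g0 v : (0 <= g v)%E by exact: h0.
transitivity (\int[area]_z \int[area]_w h (nsq2 w, nsq2 z))%E.
  exact: (fubini_tonelli1 _ mg g0).
have [c0 _ area_radial] := areaP; have d0 := ltW c0.
have mhy (y : RR) : measurable_fun setT (fun x : RR => h (x, y)) by exact: measurableT_comp.
transitivity (\int[area]_z (ca%:E * \int[mu]_x h (x, nsq2 z)))%E.
  apply: eq_integral => z _; apply: (area_radial _ (mhy (nsq2 z))) => // x.
  exact: hx.
have mG : measurable_fun setT (fun y : RR => \int[mu]_x h (x, y))%E.
  exact: (measurable_fun_fubini_tonelli_G _ mh h0).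
have G0 y : (0 <= \int[mu]_x h (x, y))%E by exact: integral_ge0.
rewrite ge0_integralZl_EFin //; last exact: (measurableT_comp mG).
rewrite (area_radial _ mG) // ?muleA -?EFinM // => y y0.
by apply: integral0_eq => x _; exact: hy.
Qed.

End Volume.

(** * The beta median *)

Section Beta.
Variable R : realType.
Notation mu := (@lebesgue_measure R).
Notation RR := (measurableTypeR R).

Lemma measurable_rsqrt : measurable_fun [set: RR] (fun x : RR => (Num.sqrt (x : R))^-1 : R).
Proof.
have -> : (fun x : RR => (Num.sqrt (x : R))^-1 : R) =
    (fun x => if 0 < (x : R) then (x : R) `^ (- 2^-1) else 0).
  apply/funext => x; case: ifPn => [x0|]; first by rewrite powRN powR12_sqrt // ltW.
  by rewrite -leNgt => x0; rewrite ler0_sqrtr // invr0.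
apply: measurable_fun_ifT.
- by apply: measurable_fun_ltr; [exact: measurable_cst|exact: measurable_id].
- exact: measurable_powR.
- exact: measurable_cst.
Qed.

Lemma integral_rsqrt_itv (e : R) : 0 < e < 1 ->
  (\int[mu]_(x in `[e, 1%R]) ((Num.sqrt x)^-1)%:E <= 2%:E)%E.
Proof.
move=> /andP[e0 e1].
have d (x : R) : 0 < x -> is_derive x 1 (fun y : R => 2 * Num.sqrt y) ((Num.sqrt x)^-1).
  move=> x0; have h := is_derive1_sqrt x0.
  have k : is_derive x 1 (2 \*: (@Num.sqrt R)) (2 *: (2 * Num.sqrt x)^-1) by exact: is_deriveZ.
  by apply: (is_derive_eq k); rewrite /GRing.scale /=; field; rewrite gt_eqF // sqrtr_gt0.
have cs (x : R) : {for x, continuous (fun y : R => 2 * Num.sqrt y)}.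
  by apply: cvgM; [exact: cvg_cst|exact: sqrt_continuous].
rewrite (@continuous_FTC2 R (fun x => (Num.sqrt x)^-1) (fun y => 2 * Num.sqrt y)) //.
- by rewrite -EFinB lee_fin sqrtr1 mulr1 gerBl mulr_ge0 ?sqrtr_ge0.
- apply: continuous_in_subspaceT => x /set_mem /=; rewrite in_itv /= => /andP[ex _].
  apply: cvgV; last exact: sqrt_continuous.
  by rewrite gt_eqF // sqrtr_gt0 (lt_le_trans e0).
- split.
  + move=> x; rewrite in_itv /= => /andP[ex _].
    by have [] := d x (lt_trans e0 ex).
  + by apply: cvg_at_right_filter; exact: cs.
  + by apply: cvg_at_left_filter; exact: cs.
- move=> x; rewrite in_itv /= => /andP[ex _]; rewrite derive1E.
  by have [_ ->] := d x (lt_trans e0 ex).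
Qed.

Lemma integral_rsqrt : (\int[mu]_(x in `]0%R, 1%R]) ((Num.sqrt x)^-1)%:E <= 2%:E)%E.
Proof.
(* An exhaustion starting at [1/2, 1], since [integral_rsqrt_itv] requires a left end strictly below
   1. *)
pose F (n : nat) : set RR := `[(n.+2%:R : R)^-1, 1]%classic.
have FU : `]0, 1]%classic = \bigcup_n F n :> set RR.
  apply/seteqP; split=> x.
    rewrite /= in_itv /= => /andP[x0 x1].
    have [n hn] : exists n : nat, x^-1 <= n.+2%:R.
      exists (Num.truncn x^-1); apply: ltW; apply: (lt_trans (truncnS_gt _)).
      by rewrite ltr_nat.
    exists n => //; rewrite /F /= in_itv /= x1 andbT.
    by rewrite -[x]invrK lef_pV2 ?posrE ?invr_gt0 ?ltr0n.
  move=> [n _]; rewrite /F /= !in_itv /= => /andP[h ->]; rewrite andbT.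
  by apply: lt_le_trans h; rewrite invr_gt0 ltr0n.
have mm : measurable_fun [set: RR] (fun x : RR => ((Num.sqrt (x : R))^-1)%:E).
  by apply/measurable_EFinP; exact: measurable_rsqrt.
have nF : nondecreasing_seq F.
  move=> n k nk; apply/subsetPset => x; rewrite /F /= !in_itv /= => /andP[h ->]; rewrite andbT.
  by apply: le_trans h; rewrite lef_pV2 ?posrE ?ltr0n // ler_nat !ltnS.
have mF n : measurable (F n) by exact: measurable_itv.
have r0 (x : RR) : (0 <= ((Num.sqrt (x : R))^-1)%:E)%E by rewrite lee_fin invr_ge0 sqrtr_ge0.
have c := @ge0_nondecreasing_set_cvg_integral _ RR R F (fun x => ((Num.sqrt (x : R))^-1)%:E) mu nF mF
  (fun i => measurable_funTS mm) (fun i x _ => r0 x).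
rewrite FU -(cvg_lim _ c) //.
apply: lime_le; first by apply/cvg_ex; eexists; exact: c.
apply: nearW => n; apply: integral_rsqrt_itv.
by rewrite invr_gt0 ltr0n invf_lt1 ?ltr0n // ltr1n.
Qed.

Lemma integral_reflect (f : RR -> \bar R) : measurable_fun setT f -> (forall x, 0 <= f x)%E ->
  (\int[mu]_x f (1 - x)%R = \int[mu]_x f x)%E.
Proof.
move=> mf f0; rewrite (@integral_transport R _ _ mu (fun x : RR => 1 - x : RR) 1) ?mul1e //.
  have H : measurable_fun setT (fun x : RR => 1 - x : R).
    by apply: measurable_funB => //; exact: measurable_cst.
  exact: H.
move=> x y xy; have -> : (fun z : RR => 1 - z) @^-1` `]x, y]%classic = `[(1 - y), (1 - x)[%classic.
  by apply/seteqP; split=> z /=; rewrite !in_itv /= => /andP[h1 h2]; apply/andP; split; lra.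
apply: etrans (lebesgue_measure_itv _) _.
rewrite /= lte_fin ifT; last by lra.
by rewrite -EFinB; congr (_%:E); ring.
Qed.

Section Weight.
Variables (a b : R).
Hypotheses (a1 : 1 <= a) (b1 : 2^-1 <= b).
Notation w := (beta_weight a b).

Let w_ge0 u : 0 <= w u.
Proof. by rewrite mulr_ge0 // powR_ge0. Qed.

Let b2 : - 2^-1 <= b - 1.
Proof. by rewrite lerBrDr (le_trans _ b1) //; lra. Qed.

Lemma measurable_beta_weight : measurable_fun [set: RR] (fun u : RR => (w u)%:E).
Proof.
apply/measurable_EFinP; apply: measurable_funM; first exact: measurable_powR.
have mp : measurable_fun [set: R] (fun x : R => x `^ (b - 1)) by exact: measurable_powR.
apply: (measurableT_comp mp).
by apply: measurable_funB; [exact: measurable_cst|exact: measurable_id].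
Qed.

(** For a >= 1 and b >= 1/2 the weight can be singular only at 1, where it is no worse than an
    inverse square root. *)
Lemma beta_weight_le u : 0 < u < 1 -> w u <= (Num.sqrt (1 - u))^-1.
Proof.
move=> /andP[u0 u1]; have v0 : 0 < 1 - u by rewrite subr_gt0.
rewrite -(powR12_sqrt (ltW v0)) -powRN -[leRHS]mul1r /beta_weight ler_pM ?powR_ge0 //.
  rewrite -[leRHS](powRr0 u); apply: ger_powR; first by rewrite u0 (ltW u1).
  by rewrite subr_ge0.
by apply: ger_powR; [rewrite v0 /= gerBl (ltW u0)|exact: b2].
Qed.

Let W (A : set RR) : \bar R := (\int[mu]_(u in A) (w u)%:E)%E.

Lemma beta_mass_fin : (W `]0%R, 1%R[%classic < +oo)%E.
Proof.
apply: (@le_lt_trans _ _ 2%:E); last exact: ltry.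
pose I01 : set RR := `]0, 1]%classic.
pose r (x : RR) : \bar R := (\1_I01 x * (Num.sqrt (x : R))^-1)%:E.
have mI : measurable I01 by exact: measurable_itv.
have mr : measurable_fun setT r.
  apply/measurable_EFinP; apply: measurable_funM; last exact: measurable_rsqrt.
  exact: measurable_indic.
have r0 x : (0 <= r x)%E by rewrite lee_fin mulr_ge0 // ?invr_ge0 ?sqrtr_ge0.
apply: le_trans integral_rsqrt.
have -> : (\int[mu]_(x in `]0%R, 1%R]) ((Num.sqrt x)^-1)%:E = \int[mu]_x r x)%E.
  rewrite integral_mkcond; apply: eq_integral => x _; rewrite patchE /r indicE.
  by case: ifPn => h; rewrite ?mul1r ?mul0r.
rewrite -(integral_reflect mr r0) /W integral_mkcond.
apply: ge0_le_integral => //.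
- by move=> x _; rewrite patchE; case: ifPn => // _; rewrite lee_fin.
- have mJ : measurable (`]0, 1[%classic : set RR) by exact: measurable_itv.
  by apply: (measurable_restrictT _ mJ).1; apply: measurable_funTS; exact: measurable_beta_weight.
- apply: (measurableT_comp mr); have H : measurable_fun setT (fun x : RR => 1 - x : R).
    by apply: measurable_funB => //; exact: measurable_cst.
  exact: H.
- move=> x _; rewrite patchE; case: ifPn => [|_]; last exact: r0.
  rewrite inE /= in_itv /= => x01; rewrite lee_fin indicE mem_set ?mul1r.
    exact: beta_weight_le.
  by case/andP: x01 => x0 x1; rewrite /I01 /= in_itv /= subr_gt0 x1 gerBl ltW.
Qed.

Lemma beta_mass_gt0 x y : 0 <= x -> x < y -> y <= 1 -> (0 < W `]x, y[%classic)%E.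
Proof.
move=> x0 xy y1.
pose x' := (2 * x + y) / 3; pose y' := (x + 2 * y) / 3.
have x'0 : 0 < x' by rewrite /x'; lra.
have y'1 : y' < 1 by rewrite /y'; lra.
(* A lower bound for the weight on the middle third. As b - 1 may be negative, the exponent is
   raised to b - 1/2 >= 0: this lowers the power of 1 - u and makes it monotone. *)
pose c := x' `^ (a - 1) * (1 - y') `^ (b - 2^-1).
have c0 : 0 < c by rewrite mulr_gt0 // powR_gt0 // subr_gt0.
have mI : measurable (`]x', y']%classic : set RR) by exact: measurable_itv.
have mJ : measurable (`]x, y[%classic : set RR) by exact: measurable_itv.
apply: (@lt_le_trans _ _ (\int[mu]_(u in `]x', y']) (cst c%:E) u)%E).
  rewrite integral_cst //.
  have x'y' : x' <= y' by rewrite /x' /y'; lra.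
  rewrite [X in (_ * X)%E](lebesgue_itv x'y') -EFinM lte_fin mulr_gt0 // /x' /y'; lra.
apply: (@le_trans _ _ (W `]x', y']%classic)).
  apply: ge0_le_integral => //.
  - by move=> u _; rewrite lee_fin ltW.
  - by apply: measurable_funTS; exact: measurable_beta_weight.
  move=> u; rewrite /= in_itv /= => /andP[xu uy]; rewrite lee_fin.
  apply: ler_pM; rewrite ?powR_ge0 //.
    by apply: ge0_ler_powR; rewrite ?nnegrE ?subr_ge0 // ltW // (lt_trans x'0).
  have v0 : 0 < 1 - u by rewrite subr_gt0 (le_lt_trans uy).
  apply: (@le_trans _ _ ((1 - u) `^ (b - 2^-1))).
    have y'0 : 0 <= 1 - y' by rewrite subr_ge0 ltW.
    apply: ge0_ler_powR; rewrite ?nnegrE ?(ltW v0) //; first by rewrite subr_ge0.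
    by rewrite lerD2l lerN2.
  by apply: ger_powR; [rewrite v0 gerBl ltW // (lt_trans x'0)|rewrite lerD2l lerN2 invf_le1 ?ler1n].
apply: ge0_subset_integral => //.
- by apply: measurable_funTS; exact: measurable_beta_weight.
- by move=> u _; rewrite lee_fin.
- by move=> u; rewrite /= !in_itv /= /x' /y' => /andP[h1 h2]; apply/andP; split; lra.
Qed.

Lemma beta_mass_split x y z : x < y -> y < z ->
  W `]x, z[%classic = (W `]x, y[%classic + W `]y, z[%classic)%E.
Proof.
move=> xy yz.
have -> : `]x, z[%classic = `]x, y]%classic `|` `]y, z[%classic :> set RR.
  apply/seteqP; split=> u /=; rewrite !in_itv /=.
    by move=> /andP[-> ->]; case: leP => _; [left|right].
  by move=> [/andP[-> h]|/andP[h ->]]; rewrite ?(le_lt_trans h) ?(lt_trans _ h) // (lt_trans xy).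
rewrite /W ge0_integral_setU //; do ?exact: measurable_itv.
- by rewrite integral_itv_bndoo //; apply: measurable_funTS; exact: measurable_beta_weight.
- by apply: measurable_funTS; exact: measurable_beta_weight.
- by move=> u _; rewrite lee_fin.
- apply/disj_setPS => u [] /=; rewrite !in_itv /= => /andP[_ h1] /andP[h2 _].
  by move: (le_lt_trans h1 h2); rewrite ltxx.
Qed.

Lemma beta_mass_sub x y : 0 <= x -> y <= 1 -> (W `]x, y[%classic < +oo)%E.
Proof.
move=> x0 y1; apply: le_lt_trans beta_mass_fin.
apply: ge0_subset_integral; do ?exact: measurable_itv.
- by apply: measurable_funTS; exact: measurable_beta_weight.
- by move=> u _; rewrite lee_fin.
by move=> u; rewrite /= !in_itv /= => /andP[h1 h2]; rewrite (le_lt_trans x0) // (lt_le_trans h2).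
Qed.

(** The primitive [G] of the weight is continuous and takes half of its total value somewhere; hence
    a median exists and [xget] does not return its default. *)
Lemma beta_medianP : let M := beta_median a b in
  0 < M < 1 /\ W `]0%R, M[%classic = W `]M, 1%R[%classic.
Proof.
rewrite /beta_median; case: xgetP => [M _ []//|nex] /=; exfalso.
have intw : mu.-integrable (`[0, 1]%classic : set RR) (EFin \o w).
  apply/integrableP; split; first by apply: measurable_funTS; exact: measurable_beta_weight.
  under eq_integral do rewrite /= ger0_norm //.
  rewrite integral_itv_bndoo; first exact: beta_mass_fin.
  by apply: measurable_funTS; exact: measurable_beta_weight.
have cG := parameterized_integral_continuous ler01 intw.
pose G x := parameterized_integral mu 0 x w.
have GE x : G x = fine (W `]0, x[%classic).
  rewrite /G /parameterized_integral /Rintegral integral_itv_bndoo //.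
  by apply: measurable_funTS; exact: measurable_beta_weight.
have G0 : G 0 = 0 by rewrite GE set_itvoo0 /W integral_set0.
have fin x y : 0 <= x -> y <= 1 -> W `]x, y[%classic \is a fin_num.
  move=> x0 y1; rewrite ge0_fin_numE ?beta_mass_sub //.
  by apply: integral_ge0 => u _; rewrite lee_fin.
have T0 : 0 < G 1 by rewrite GE fine_gt0 // beta_mass_gt0 // beta_mass_fin.
have [|c] := @IVT R G 0 1 (G 1 / 2) ler01 cG.
  by rewrite G0 ge_min le_max; apply/andP; split; apply/orP; lra.
rewrite in_itv /= => /andP[c0 c1] Gc.
have {}c0 : 0 < c.
  by rewrite lt_neqAle c0 andbT; apply/eqP => e; move: Gc; rewrite -e G0; lra.
have {}c1 : c < 1.
  by rewrite lt_neqAle c1 andbT; apply/eqP => e; move: Gc; rewrite e; lra.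
apply: (nex c); split; first by rewrite c0 c1.
change (W `]0%R, c[%classic = W `]c, 1%R[%classic).
have := beta_mass_split c0 c1.
have f1 := fin 0 c (lexx _) (ltW c1); have f2 := fin c 1 (ltW c0) (lexx _).
have halves (A B T : \bar R) : A \is a fin_num -> B \is a fin_num -> T = (A + B)%E ->
    fine A = fine T / 2 -> A = B.
  by case: A B => [r||] [s||] // _ _ -> /= e; congr (_%:E); lra.
by move=> e; apply: (halves _ _ _ f1 f2 e); rewrite -!GE.
Qed.

Lemma beta_above_median M' : beta_median a b < M' -> M' < 1 ->
  (W `]M', 1%R[%classic < W `]0%R, M'[%classic)%E.
Proof.
move=> MM' M'1; have [/andP[M0 M1] eqM] := beta_medianP.
have f1 : W `]beta_median a b, M'[%classic \is a fin_num.
  rewrite ge0_fin_numE ?(beta_mass_sub (ltW M0) (ltW M'1)) //.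
  by apply: integral_ge0 => u _; rewrite lee_fin.
have f2 : W `]M', 1[%classic \is a fin_num.
  rewrite ge0_fin_numE ?(beta_mass_sub (ltW (lt_trans M0 MM')) (lexx _)) //.
  by apply: integral_ge0 => u _; rewrite lee_fin.
rewrite (beta_mass_split M0 MM') eqM (beta_mass_split MM' M'1).
rewrite -(fineK f1) -(fineK f2) -!EFinD lte_fin.
have : 0 < fine (W `]beta_median a b, M'[%classic).
  by rewrite fine_gt0 // (beta_mass_gt0 (ltW M0) MM' (ltW M'1)) (beta_mass_sub (ltW M0) (ltW M'1)).
lra.
Qed.

End Weight.

End Beta.

(** * The mass of a cone *)

Lemma indic_in (R : realType) (B : set R) (x : R) : B x -> \1_B x = 1 :> R.
Proof. by move=> Bx; rewrite indicE mem_set. Qed.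

Lemma indic_out (R : realType) (B : set R) (x : R) : ~ B x -> \1_B x = 0 :> R.
Proof. by move=> Bx; rewrite indicE memNset. Qed.

Section Cone.
Variable R : realType.
Notation mu := (@lebesgue_measure R).
Notation RR := (measurableTypeR R).
Notation plane := (RR * RR)%type.
Variables (k m : nat) (M : R) (A : set RR).
Hypotheses (m_gt2 : (3 <= m)%N) (mA : measurable A).
Hypothesis coneA : forall c x : R, 0 < c -> A (c * x) <-> A x.

Definition unit_shell : set RR := `[1, 2]%classic.

(** The pair p stands for (|w|^2, |z|^2). The last factor is the modulus of F; the ray [A], tested
    on |w|^2 - M |z|^2, selects one side of the cone |w|^2 = M |z|^2. *)
Definition cone_density (p : plane) : R :=
  \1_unit_shell (p.2 - p.1) * \1_A (p.1 - M * p.2) * \1_(`[0, +oo[%classic : set RR) p.1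
  * (Num.sqrt p.1 ^+ k * (Num.sqrt p.2)^-1 ^+ (m + k)).

Definition radial_weight (y : R) : R := y * \1_unit_shell y * (Num.sqrt y)^-1 ^+ m.

Definition shell_mass : \bar R := (\int[mu]_y (radial_weight y)%:E)%E.

Definition angular_weight (x : R) : R :=
  \1_A (x - M) * \1_(`[0, 1[%classic : set RR) x * beta_weight (k%:R / 2 + 1) (m%:R / 2 - 1) x.

Let mshell : measurable unit_shell. Proof. exact: measurable_itv. Qed.

Lemma measurable_sqrt d (T : measurableType d) (f : T -> R) : measurable_fun setT f ->
  measurable_fun setT (fun x => Num.sqrt (f x)).
Proof.
move=> mf; have h : measurable_fun [set: R] (@Num.sqrt R).
  by apply: continuous_measurable_fun; exact: sqrt_continuous.
exact: (measurableT_comp h mf).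
Qed.

Lemma measurable_sqrtV d (T : measurableType d) (f : T -> R) : measurable_fun setT f ->
  measurable_fun setT (fun x => (Num.sqrt (f x))^-1).
Proof. by move=> mf; exact: (measurableT_comp (@measurable_rsqrt R) mf). Qed.

Lemma measurable_indicT d (T : measurableType d) (B : set RR) (f : T -> R) : measurable B ->
  measurable_fun setT f -> measurable_fun setT (fun x => \1_B (f x) : R).
Proof.
move=> mB mf; have h : measurable_fun [set: RR] (\1_B : RR -> R) by exact: measurable_indic.
exact: (measurableT_comp h mf).
Qed.

Lemma measurable_radial_weight : measurable_fun [set: RR] radial_weight.
Proof.
apply: measurable_funM; first apply: measurable_funM.
- exact: measurable_id.
- exact: measurable_indic.
- by apply: measurable_funX; exact: measurable_rsqrt.
Qed.

Lemma measurable_cone_density : measurable_fun setT cone_density.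
Proof.
have m1 := @measurable_fst2 R; have m2 := @measurable_snd2 R.
apply: measurable_funM; last first.
  apply: measurable_funM; apply: measurable_funX; first exact: measurable_sqrt.
  exact: measurable_sqrtV.
apply: measurable_funM; last first.
  by apply: measurable_indicT => //; exact: measurable_itv.
apply: measurable_funM; apply: measurable_indicT => //.
  exact: measurable_funB.
by apply: measurable_funB => //; apply: measurable_funM => //; exact: measurable_cst.
Qed.

Lemma cone_density_ge0 p : 0 <= cone_density p.
Proof.
by rewrite /cone_density; rewrite !mulr_ge0 // ?exprn_ge0 ?invr_ge0 ?sqrtr_ge0.
Qed.

Lemma cone_density_neg1 x y : x < 0 -> cone_density (x, y) = 0.
Proof.
move=> x0; rewrite /cone_density /= [\1_(`[0, +oo[%classic) x]indic_out ?mulr0 ?mul0r //=.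
by rewrite in_itv /= andbT => /(lt_le_trans x0); rewrite ltxx.
Qed.

(** For y <= 0 the conventions sqrt y = 0 and 0^-1 = 0 make the last factor a positive power of
    0. *)
Lemma cone_density_neg2 x y : y <= 0 -> cone_density (x, y) = 0.
Proof.
move=> y0; rewrite /cone_density /= [Num.sqrt y]ler0_sqrtr // invr0 expr0n.
by rewrite addn_eq0 (gtn_eqF (leq_trans _ m_gt2)) // !mulr0.
Qed.

(** The density in the coordinates x = |w|^2 / |z|^2 and y = |z|^2, with the Jacobian y included.
    Being stable under positive scaling, [A] then constrains x alone. *)
Definition polar_density (p : plane) : R :=
  \1_A (p.1 - M) * \1_(`[0, 1[%classic : set RR) p.1 * Num.sqrt p.1 ^+ k
  * (p.2 * \1_unit_shell ((1 - p.1) * p.2) * (Num.sqrt p.2)^-1 ^+ m).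

Lemma polar_density_ge0 p : 0 <= polar_density p.
Proof.
rewrite /polar_density; case: (leP p.2 0) => y0.
  by rewrite [Num.sqrt p.2]ler0_sqrtr // invr0 expr0n (gtn_eqF (leq_trans _ m_gt2)) // !mulr0.
by rewrite !mulr_ge0 // ?exprn_ge0 ?invr_ge0 ?sqrtr_ge0 // ltW.
Qed.

Lemma measurable_polar_density : measurable_fun setT polar_density.
Proof.
have m1 := @measurable_fst2 R; have m2 := @measurable_snd2 R.
have mc c : measurable_fun [set: plane] (fun _ => c : R) by exact: measurable_cst.
apply: measurable_funM; [apply: measurable_funM; [apply: measurable_funM|]|
  apply: measurable_funM; [apply: measurable_funM|]].
- by apply: measurable_indicT => //; exact: measurable_funB.
- by apply: measurable_indicT => //; exact: measurable_itv.
- by apply: measurable_funX; exact: measurable_sqrt.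
- by [].
- by apply: measurable_indicT => //; apply: measurable_funM => //; exact: measurable_funB.
- by apply: measurable_funX; exact: measurable_sqrtV.
Qed.

Lemma polar_cone_density (x y : R) : 0 < y ->
  y * cone_density (y * x, y) = polar_density (x, y).
Proof.
move=> y0; rewrite /cone_density /polar_density /=.
have e1 : y - y * x = (1 - x) * y by ring.
have e2 : \1_A (y * x - M * y) = \1_A (x - M) :> R.
  rewrite !indicE; congr (_%:R); congr nat_of_bool.
  have -> : y * x - M * y = y * (x - M) by ring.
  by apply/idP/idP; rewrite !inE => /(coneA _ y0).
have [x0|x0] := ltP x 0.
  rewrite [\1_(`[0, +oo[%classic) (y * x)]indic_out; last first.
    by rewrite /= in_itv /= andbT pmulr_rge0 // leNgt x0.
  rewrite [\1_(`[0, 1[%classic) x]indic_out ?mulr0 ?mul0r ?mulr0 ?mul0r //.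
  by rewrite /= in_itv /= leNgt x0.
have [x1|x1] := ltP x 1; last first.
  rewrite e1 [\1_unit_shell _]indic_out ?mulr0 ?mul0r ?mulr0 ?mul0r ?mulr0 //.
  rewrite /unit_shell /= in_itv /= => /andP[h _]; have : 0 <= (x - 1) * y by rewrite mulr_ge0 ?subr_ge0 ?(ltW y0).
  by move: h; lra.
rewrite [\1_(`[0, +oo[%classic) (y * x)]indic_in; last by rewrite /= in_itv /= andbT mulr_ge0 // ltW.
rewrite [\1_(`[0, 1[%classic) x]indic_in; last by rewrite /= in_itv /= x0.
rewrite e1 e2 sqrtrM ?(ltW y0) // exprMn exprD.
have s0 : Num.sqrt y != 0 by rewrite gt_eqF // sqrtr_gt0.
have -> : (Num.sqrt y)^-1 ^+ k = (Num.sqrt y ^+ k)^-1 by rewrite exprVn.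
by field; rewrite expf_neq0.
Qed.

Lemma integral_cone_density_x (y : R) :
  (\int[mu]_x (cone_density (x, y))%:E = \int[mu]_x (polar_density (x, y))%:E)%E.
Proof.
have [y0|y0] := leP y 0.
  apply: eq_integral => x _; rewrite cone_density_neg2 // /polar_density /=.
  by rewrite [Num.sqrt y]ler0_sqrtr // invr0 expr0n (gtn_eqF (leq_trans _ m_gt2)) // !mulr0.
have mc : measurable_fun [set: RR] (fun x => cone_density (x, y)).
  apply: (measurableT_comp measurable_cone_density).
  by apply: measurable_plane; [exact: measurable_id|exact: measurable_cst].
have c0 x : (0 <= (cone_density (x, y))%:E)%E by rewrite lee_fin cone_density_ge0.
rewrite -(@integral_scale _ (fun x => (cone_density (x, y))%:E) y) //; last exact/measurable_EFinP.
transitivity (\int[mu]_x (y%:E * (cone_density ((y * x)%R, y))%:E))%E; last first.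
  by apply: eq_integral => x _; rewrite -EFinM polar_cone_density.
rewrite ge0_integralZl_EFin ?(ltW y0) //.
have h : measurable_fun [set: RR] (fun x : RR => y * x : R).
  by apply: measurable_funM; [exact: measurable_cst|exact: measurable_id].
by apply/measurable_EFinP; exact: (measurableT_comp mc h).
Qed.

Lemma sqrt_powR (x : R) n : 0 <= x -> Num.sqrt x ^+ n = x `^ (n%:R / 2).
Proof.
by move=> x0; rewrite -powR12_sqrt // -powR_mulrn ?powR_ge0 // -powRrM mulrC.
Qed.

Lemma radial_weight_ge0 y : 0 <= radial_weight y.
Proof.
rewrite /radial_weight; case: (leP y 0) => y0.
  by rewrite [Num.sqrt y]ler0_sqrtr // invr0 expr0n (gtn_eqF (leq_trans _ m_gt2)) // !mulr0.
by rewrite !mulr_ge0 // ?exprn_ge0 ?invr_ge0 ?sqrtr_ge0 // ltW.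
Qed.

(** The substitution of (1 - x) y for y separates the variables. The differential and the factor y
    each contribute (1 - x)^(-1), and y^(-m/2) contributes (1 - x)^(m/2): together the beta weight
    in 1 - x. *)
Lemma integral_polar_density_y (x : R) :
  (\int[mu]_y (polar_density (x, y))%:E = (angular_weight x)%:E * shell_mass)%E.
Proof.
have r0 y : (0 <= (radial_weight y)%:E)%E by rewrite lee_fin radial_weight_ge0.
have [x01|/negP x01] := boolP (x \in `[0, 1[); last first.
  rewrite /angular_weight [\1_(`[0, 1[%classic) x]indic_out // mulr0 mul0r mul0e.
  apply: integral0_eq => y _; rewrite /polar_density /= [\1_(`[0, 1[%classic) x]indic_out //.
  by rewrite mulr0 !mul0r.
move: (x01); rewrite in_itv /= => /andP[x0 x1].
have c0 : 0 < 1 - x by rewrite subr_gt0.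
pose C := \1_A (x - M) * Num.sqrt x ^+ k * ((1 - x)^-1 * Num.sqrt (1 - x) ^+ m) : R.
have C0 : 0 <= C.
  by rewrite /C !mulr_ge0 // ?exprn_ge0 ?invr_ge0 ?sqrtr_ge0 // ltW.
have mr := measurable_radial_weight.
have h : measurable_fun [set: RR] (fun y : RR => (1 - x) * y : R).
  by apply: measurable_funM; [exact: measurable_cst|exact: measurable_id].
have mrc : measurable_fun [set: RR] (fun y => (radial_weight ((1 - x) * y))%:E).
  by apply/measurable_EFinP; exact: (measurableT_comp mr h).
transitivity (\int[mu]_y (C%:E * (radial_weight ((1 - x) * y))%:E))%E.
  apply: eq_integral => y _; rewrite -EFinM /C /polar_density /radial_weight /=; congr (_%:E).
  rewrite [\1_(`[0, 1[%classic) x]indic_in // sqrtrM ?(ltW c0) // invfM exprMn.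
  have s0 : Num.sqrt (1 - x) ^+ m != 0 by rewrite expf_neq0 // gt_eqF // sqrtr_gt0.
  have -> : (Num.sqrt (1 - x))^-1 ^+ m = (Num.sqrt (1 - x) ^+ m)^-1 by rewrite exprVn.
  by field; rewrite s0 gt_eqF.
rewrite ge0_integralZl_EFin //.
have e := @integral_scale _ (fun y => (radial_weight y)%:E) _ c0 _ r0.
have {}e : (\int[mu]_y (radial_weight ((1 - x) * y)%R)%:E = ((1 - x)^-1)%:E * shell_mass)%E.
  by rewrite /shell_mass -e ?muleA -?EFinM ?mulVf ?mul1e ?gt_eqF //; exact/measurable_EFinP.
rewrite e muleA -EFinM; congr (_%:E * _)%E.
rewrite /angular_weight /C [\1_(`[0, 1[%classic) x]indic_in // mulr1 /beta_weight addrK -mulrA.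
have P : (1 - x) `^ (m%:R / 2) = (1 - x) `^ (m%:R / 2 - 1 - 1) * (1 - x) ^+ 2.
  rewrite -[X in _ = _ * X]powR_mulrn ?(ltW c0) // -powRD; last by rewrite (gt_eqF c0) implybT.
  by congr (_ `^ _); ring.
by rewrite !sqrt_powR ?(ltW c0) // P; field; rewrite gt_eqF.
Qed.

Lemma beta_weight_ge0 (a b x : R) : 0 <= beta_weight a b x.
Proof. by rewrite mulr_ge0 // powR_ge0. Qed.

Lemma angular_weight_ge0 x : 0 <= angular_weight x.
Proof. by rewrite /angular_weight mulr_ge0 ?beta_weight_ge0 // mulr_ge0. Qed.

Lemma measurable_angular_weight : measurable_fun [set: RR] angular_weight.
Proof.
apply: measurable_funM; last by apply/measurable_EFinP; exact: measurable_beta_weight.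
apply: measurable_funM; apply: measurable_indicT => //.
- by apply: measurable_funB; [exact: measurable_id|exact: measurable_cst].
Qed.

Lemma shell_mass_ge0 : (0 <= shell_mass)%E.
Proof. by apply: integral_ge0 => y _; rewrite lee_fin radial_weight_ge0. Qed.

(** Crude bounds from 1 <= sqrt y <= 2. They make the shell mass positive and finite, so that it can
    be cancelled when the two sides of the cone are compared. *)
Lemma radial_weight_bounds y : unit_shell y -> 2 ^- m <= radial_weight y <= 2.
Proof.
rewrite /unit_shell /= in_itv /= => y12; rewrite /radial_weight indic_in; last by rewrite /unit_shell /= in_itv.
have /andP[y1 y2] := y12; rewrite mulr1.
have s1 : 1 <= Num.sqrt y by rewrite -sqrtr1 ler_sqrt // (le_trans _ y1).
have s2 : Num.sqrt y <= 2.
  by rewrite -(ger0_norm (ler0n R 2)) -sqrtr_sqr ler_sqrt ?exprn_ge0 // expr2; lra.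
have s0 : 0 < Num.sqrt y by apply: lt_le_trans s1.
apply/andP; split.
  rewrite -[leLHS]mul1r ler_pM ?invr_ge0 ?exprn_ge0 // exprVn.
  by rewrite lef_pV2 ?posrE ?exprn_gt0 // lerXn2r // nnegrE ltW.
rewrite -[leRHS]mulr1 ler_pM ?exprn_ge0 ?invr_ge0 ?(le_trans _ y1) ?(ltW s0) //.
by rewrite exprn_ile1 ?invr_ge0 ?(ltW s0) // invf_le1.
Qed.

Let mu_shell : mu unit_shell = 1%E.
Proof.
apply: etrans (lebesgue_measure_itv _) _; rewrite /= lte_fin ltr1n -EFinB; congr (_%:E); lra.
Qed.

Let shell_massE : shell_mass = (\int[mu]_(y in unit_shell) (radial_weight y)%:E)%E.
Proof.
rewrite [RHS]integral_mkcond; apply: eq_integral => y _; rewrite patchE.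
by case: ifPn => //; rewrite notin_setE /radial_weight => h; rewrite indic_out // mulr0 mul0r.
Qed.

Lemma shell_mass_gt0 : (0 < shell_mass)%E.
Proof.
have e : (\int[mu]_(y in unit_shell) (cst (2 ^- m)%:E y) = (2 ^- m)%:E * 1)%E.
  by rewrite integral_cst //; congr (_ * _)%E; exact: mu_shell.
rewrite shell_massE; apply: (@lt_le_trans _ _ ((2 ^- m)%:E * 1)%E).
  by rewrite mule1 lte_fin invr_gt0 exprn_gt0.
rewrite -e; apply: ge0_le_integral => //.
- by move=> x _; rewrite lee_fin invr_ge0 exprn_ge0.
- by apply/measurable_EFinP; apply: measurable_funTS; exact: measurable_radial_weight.
- by move=> x /radial_weight_bounds/andP[h _]; rewrite lee_fin.
Qed.

Lemma shell_mass_fin : (shell_mass < +oo)%E.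
Proof.
have e : (\int[mu]_(y in unit_shell) (cst 2%:E y) = 2%:E * 1)%E.
  by rewrite integral_cst //; congr (_ * _)%E; exact: mu_shell.
rewrite shell_massE; apply: (@le_lt_trans _ _ (2%:E * 1)%E); last by rewrite mule1 ltry.
rewrite -e; apply: ge0_le_integral => //.
- by move=> x _; rewrite lee_fin radial_weight_ge0.
- by apply/measurable_EFinP; apply: measurable_funTS; exact: measurable_radial_weight.
- by move=> x /radial_weight_bounds/andP[_ h]; rewrite lee_fin.
Qed.

Lemma integral_cone_density :
  (\int[mu]_y \int[mu]_x (cone_density (x, y))%:E =
   shell_mass * \int[mu]_x (angular_weight x)%:E)%E.
Proof.
under eq_integral => y _ do rewrite integral_cone_density_x.
have mp : measurable_fun setT (fun p => (polar_density p)%:E).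
  by apply/measurable_EFinP; exact: measurable_polar_density.
have p0 p : (0 <= (polar_density p)%:E)%E by rewrite lee_fin polar_density_ge0.
transitivity (\int[mu]_x \int[mu]_y (polar_density (x, y))%:E)%E.
  by apply/esym; exact: (@fubini_tonelli _ _ RR RR R mu mu _ mp p0).
under eq_integral => x _ do rewrite integral_polar_density_y muleC.
rewrite ge0_integralZl //.
- by apply/measurable_EFinP; exact: measurable_angular_weight.
- by move=> x _; rewrite lee_fin angular_weight_ge0.
- exact: shell_mass_ge0.
Qed.


End Cone.

(** * Comparison of the two sides of the cone *)

Section AngularMass.
Variable R : realType.
Notation mu := (@lebesgue_measure R).
Notation RR := (measurableTypeR R).
Variables (k m : nat) (M : R).
Hypotheses (m_gt2 : (3 <= m)%N).
Notation a := (k%:R / 2 + 1 : R).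
Notation b := (m%:R / 2 - 1 : R).

Definition inner_ray : set RR := `]-oo, 0[%classic.
Definition outer_ray : set RR := `[0, +oo[%classic.

Lemma inner_ray_cone (c x : R) : 0 < c -> inner_ray (c * x) <-> inner_ray x.
Proof. by move=> c0; rewrite /inner_ray /= !in_itv /= pmulr_rlt0. Qed.

Lemma outer_ray_cone (c x : R) : 0 < c -> outer_ray (c * x) <-> outer_ray x.
Proof. by move=> c0; rewrite /outer_ray /= !in_itv /= !andbT pmulr_rge0. Qed.

Lemma measurable_inner_ray : measurable inner_ray. Proof. exact: measurable_itv. Qed.
Lemma measurable_outer_ray : measurable outer_ray. Proof. exact: measurable_itv. Qed.

Lemma beta_shape : 1 <= a /\ 2^-1 <= b.
Proof.
split; first by rewrite lerDr divr_ge0.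
have h : (3 : R) <= m%:R by rewrite ler_nat.
by move: h; lra.
Qed.

Lemma integral_angular (A : set RR) (l u : R) : measurable A ->
  (forall x, A (x - M) /\ 0 <= x < 1 <-> l <= x < u) ->
  (\int[mu]_x (angular_weight k m M A x)%:E = \int[mu]_(x in `]l, u[) (beta_weight a b x)%:E)%E.
Proof.
move=> mA h; have mw := measurable_beta_weight a b.
have mC : measurable (`[l, u[%classic : set RR) by exact: measurable_itv.
transitivity (\int[mu]_(x in `[l, u[) (beta_weight a b x)%:E)%E; last first.
  by rewrite integral_itv_obnd_cbnd //; apply: measurable_funTS.
rewrite [RHS]integral_mkcond; apply: eq_integral => x _; rewrite patchE /angular_weight.
case: ifPn; rewrite ?inE ?notin_setE /= in_itv /= => hx.
  have [Ax x01] := (h x).2 hx.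
  by rewrite indic_in // indic_in ?mul1r // in_itv.
have [Ax|Ax] := pselect (A (x - M)); last by rewrite [\1_A _]indic_out // !mul0r.
rewrite [\1_(`[0, 1[%classic) _]indic_out ?mulr0 ?mul0r //= in_itv /= => x01.
by apply: hx; apply/h.
Qed.

Lemma angular_mass_lt : beta_median a b < M -> M < 1 ->
  (\int[mu]_x (angular_weight k m M outer_ray x)%:E < \int[mu]_x (angular_weight k m M inner_ray x)%:E)%E.
Proof.
move=> M0 M1; have [a1 b1] := beta_shape; have [/andP[m0 _] _] := beta_medianP a1 b1.
have {}m0 := lt_trans m0 M0.
rewrite (@integral_angular outer_ray M 1 measurable_outer_ray); last first.
  move=> x; rewrite /outer_ray /= in_itv /= andbT subr_ge0.
  split=> [[-> /andP[]]//|/andP[h ->]]; split=> //.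
  by rewrite (le_trans (ltW m0)).
rewrite (@integral_angular inner_ray 0 M measurable_inner_ray); last first.
  move=> x; rewrite /inner_ray /= in_itv /= subr_lt0.
  split=> [[-> /andP[->]]//|/andP[-> h]]; split=> //.
  exact: lt_trans M1.
exact: beta_above_median.
Qed.

End AngularMass.

(** * The stabilizer *)

Lemma invmx2 (g : 'M[int]_2) : SL2Z g ->
  invmx g = mx2 (g ord_max ord_max) (- g ord0 ord_max) (- g ord_max ord0) (g ord0 ord0).
Proof.
move=> gZ; have gu : g \in unitmx by rewrite unitmxE gZ unitr1.
rewrite -[RHS](mulmxK gu) -[LHS]mul1mx; congr (_ *m _).
move: gZ; rewrite /SL2Z /= det2 => gZ.
by apply: mx2P; rewrite mulmx2 !mx2E !mxE /= -?gZ; ring.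
Qed.

Section Stabilizer.
Variables (R : realType) (Gamma : set 'M[int]_2).
Hypotheses (Gamma_group : is_subgroup Gamma) (GammaZ : Gamma `<=` SL2Z).
Notation K := (cap_SO2 R Gamma).
Notation zg g := (zc (toR R g)).
Notation wg g := (wc (toR R g)).

Lemma zg1 : zg 1%:M = 1.
Proof. by rewrite /zc !mxE /=; apply/eqP; rewrite eq_complex /=; apply/andP; split; apply/eqP; field. Qed.

Lemma wg1 : wg 1%:M = 0.
Proof. by rewrite /wc !mxE /=; apply/eqP; rewrite eq_complex /=; apply/andP; split; apply/eqP; field. Qed.

Lemma wgV g : SL2Z g -> wg (invmx g) = - wg g.
Proof.
by move=> gZ; rewrite invmx2 // /wc !mxE /= !rmorphN; apply/eqP; rewrite eq_complex /=;
  apply/andP; split; apply/eqP; field.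
Qed.

(** With determinant 1, the sum (a - d)^2 + (b + c)^2 equals a^2 + b^2 + c^2 + d^2 - 2, which
    vanishes when both rows have length 1. Conversely a = d and c = -b is the shape of a
    rotation. *)
Lemma SO2_wc (g : 'M[R]_2) : SL2 g -> SO2 g <-> wc g = 0.
Proof.
rewrite /SL2 /SO2 /= => dg; have := dg; rewrite det2 => d1.
split=> [[/matrixP e _]|/eqP].
  have e0 := e ord0 ord0; have e1 := e ord_max ord_max.
  move: e0 e1; rewrite !mulmx2 !mxE /= => e0 e1.
  have h : (g ord0 ord0 - g ord_max ord_max) ^+ 2 + (g ord_max ord0 + g ord0 ord_max) ^+ 2 = 0.
    by move: e0 e1 d1; rewrite !mulr1n; nra.
  move/eqP: h; rewrite paddr_eq0 ?sqr_ge0 // !sqrf_eq0 => /andP[/eqP h1 /eqP h2].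
  by rewrite /wc h1 h2 !mul0r oppr0.
rewrite eq_complex /= => /andP[/eqP h1 /eqP h2]; split=> //.
have {h1} h1 : g ord0 ord0 = g ord_max ord_max by move: h1; lra.
have {h2} h2 : g ord_max ord0 = - g ord0 ord_max by move: h2; lra.
move: d1; rewrite h1 h2 => d1.
by apply: mx2P; rewrite mulmx2 !mxE /= ?h1 ?h2 ?mulr1n ?mulr0n -?d1; ring.
Qed.

Lemma stabilizerE g : K g <-> Gamma g /\ wg g = 0.
Proof.
split=> [[Gg Kg]|[Gg Kg]]; split=> //.
  by apply/SO2_wc => //; apply: SL2_toR; exact: GammaZ.
by apply/SO2_wc => //; apply: SL2_toR; exact: GammaZ.
Qed.

Lemma stabilizerM g h : K g -> K h -> K (g *m h).
Proof.
have [_ GM _] := Gamma_group.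
move=> /stabilizerE[Gg wg0] /stabilizerE[Gh wh0]; apply/stabilizerE; split; first exact: GM.
by rewrite toRM wcM wg0 wh0 mul0r mulr0 addr0.
Qed.

Lemma stabilizerV g : K g -> K (invmx g).
Proof.
have [_ _ GV] := Gamma_group.
move=> /stabilizerE[Gg wg0]; apply/stabilizerE; split; first exact: GV.
by rewrite wgV ?wg0 ?oppr0 //; exact: GammaZ.
Qed.

Lemma stabilizer1 : K 1%:M.
Proof. by have [G1 _ _] := Gamma_group; apply/stabilizerE; rewrite wg1. Qed.

Lemma unitmx_SL2Z (g : 'M[int]_2) : SL2Z g -> g \in unitmx.
Proof. by move=> gZ; rewrite unitmxE gZ unitr1. Qed.

Lemma stabilizer_bij g : K g -> set_bij K K (mulmx g).
Proof.
move=> Kg; have gu : g \in unitmx by apply: unitmx_SL2Z; apply: GammaZ; case: Kg.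
split=> [x Kx|x y _ _ e|x Kx].
- exact: stabilizerM.
- by rewrite -(mulKmx gu x) e mulKmx.
- by exists (invmx g *m x); rewrite ?mulKVmx //; apply: stabilizerM => //; exact: stabilizerV.
Qed.

Lemma finite_stabilizer : finite_set K.
Proof.
apply: (@sub_finite_set _ _ ([set mx2 1 0 0 1; mx2 (-1) 0 0 (-1)] `|` [set mx2 0 1 (-1) 0; mx2 0 (-1) 1 0])).
  move=> g /stabilizerE[/GammaZ gZ] /eqP; rewrite eq_complex /= !mxE => /andP[/eqP h1 /eqP h2].
  have {h1} h1 : g ord0 ord0 = g ord_max ord_max.
    by apply: (@intr_inj R); move: h1; lra.
  have {h2} h2 : g ord_max ord0 = - g ord0 ord_max.
    by apply: (@intr_inj R); rewrite rmorphN /=; move: h2; lra.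
  move: gZ; rewrite /SL2Z /= det2 h1 h2 => d1.
  set d := g ord_max ord_max in h1 d1 *; set b := g ord0 ord_max in h2 d1 *.
  have : (d = 1 /\ b = 0) \/ (d = -1 /\ b = 0) \/ (d = 0 /\ b = 1) \/ (d = 0 /\ b = -1) by nia.
  move=> [[hd hb]|[[hd hb]|[[hd hb]|[hd hb]]]]; [left; left|left; right|right; left|right; right];
    by apply: mx2P; rewrite !mx2E ?h1 ?h2 -/d -/b ?hd ?hb // oppr0.
by rewrite !finite_setU; do ?split; exact: finite_set1.
Qed.

(** [zg] is multiplicative on K and left multiplication by g permutes K, so the nonzero product of
    all [zg x] is unchanged when each factor is multiplied by [zg g]. *)
Lemma zg_unit_root g : K g -> zg g ^+ #|` fset_set K| = 1.
Proof.
move=> Kg; have fK := finite_stabilizer.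
pose P := \big[*%R/1]_(x \in K) zg x.
have Pn0 : P != 0.
  rewrite /P fsbig_finite //= prodf_seq_neq0; apply/allP => x; rewrite in_fset_set // inE => Kx /=.
  apply: zc_neq0; rewrite det_toR; have -> : \det x = 1 by apply: GammaZ; case: Kx.
  exact: ltr01.
suff e : P = zg g ^+ #|` fset_set K| * P.
  by apply: (mulIf Pn0); rewrite mul1r -e.
rewrite {1}/P (reindex_fsbig _ _ _ _ (stabilizer_bij Kg)) /=.
transitivity (\big[*%R/1]_(x \in K) (zg g * zg x)).
  apply: eq_fsbigr => x _; rewrite toRM zcM.
  by move/stabilizerE: Kg => [_ ->]; rewrite conj0 mul0r addr0.
rewrite fsbig_split //=; congr (_ * _).
by rewrite fsbig_finite //= big_const_seq count_predT iter_mulr_1.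
Qed.

(** Such a g multiplies [zc x] by a root of unity and [wc x] by its inverse, hence F by the power
    -(m + 2k) of that root, which is 1 by the divisibility. *)
Lemma F_stabilizer k m g (x : 'M[R]_2) : (#|` fset_set K| %| m + 2 * k)%N -> K g -> SL2 x ->
  F k m (toR R g *m x) = F k m x.
Proof.
move=> hc Kg Sx; have /stabilizerE[Gg w0] := Kg.
have Sg : SL2 (toR R g) by apply: SL2_toR; exact: GammaZ.
rewrite (FE k m Sx) (FE k m (SL2M Sg Sx)).
rewrite zcM wcM w0 conj0 !mul0r addr0 add0r /Fzw.
set z := zg g; have z1 : z ^+ (m + 2 * k) = 1.
  by case/dvdnP: hc => q ->; rewrite mulnC exprM zg_unit_root // expr1n.
have zn0 : z != 0 by apply: zc_neq0; rewrite Sg ltr01.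
have -> : conjc z = z^-1.
  by apply: (mulfI zn0); rewrite mulcJ SL2_nsq // w0 /nsq /= expr0n addr0 addr0 divff.
have xn0 : zc x != 0 by apply: zc_neq0; rewrite Sx ltr01.
rewrite !exprMn exprVn.
have e : z ^+ k * z ^+ (m + k) = 1 by rewrite -exprD -z1; congr (_ ^+ _); lia.
rewrite invfM mulrACA -invfM mulrC [_ ^+ k * z ^+ _]e invr1 mulr1.
by [].
Qed.

End Stabilizer.

(** * Displacement of a cone by a congruence subgroup *)

Section CountableSum.
Variable R : realType.

(** Indexing by codes turns an unordered countable sum into a series over the natural numbers, for
    which measurability and termwise integration are available. *)
Lemma esum_nat (I : countType) (D : set I) (a : I -> \bar R) : (forall i, 0 <= a i)%E ->
  (\esum_(i in D) a i =
   \sum_(n <oo) if choice.pickle_inv n is Some i then (if i \in D then a i else 0) else 0)%E.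
Proof.
move=> a0; rewrite nneseries_esumT; last by move=> n; case: (choice.pickle_inv n) => // i; case: ifP.
rewrite esum_mkcond.
pose Q : set nat := range (@choice.pickle I).
rewrite [RHS](_ : _ = \esum_(n in Q)
    if choice.pickle_inv n is Some i then (if i \in D then a i else 0) else 0)%E.
  rewrite (@reindex_esum _ _ _ setT Q (@choice.pickle I)).
    by apply: eq_esum => i _; rewrite choice.pickleK_inv.
  split=> [i _|i j _ _ e|n [i _ <-]]; [by exists i| |by exists i].
  exact: (pcan_inj (@choice.pickleK I)).
rewrite [RHS]esum_mkcond; apply: eq_esum => n _; case: ifPn => //; rewrite notin_setE => nQ.
by have := @choice.pickle_invK I n; case: (choice.pickle_inv n) => //= i e; case: nQ; exists i.
Qed.

Variables (d : measure_display) (T : measurableType d) (mu : {measure set T -> \bar R}).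
Variables (I : countType) (D : set I) (f : I -> T -> \bar R).
Hypotheses (mf : forall i, measurable_fun setT (f i)) (f0 : forall i x, (0 <= f i x)%E).

Let g n x : \bar R := if choice.pickle_inv n is Some i then (if i \in D then f i x else 0%E) else 0%E.
Let g0 n x : (0 <= g n x)%E.
Proof. by rewrite /g; case: (choice.pickle_inv n) => // i; case: ifP. Qed.
Let mg n : measurable_fun setT (g n).
Proof.
rewrite /g; case: (choice.pickle_inv n) => [i|]; last exact: measurable_cst.
by case: (i \in D) => //; exact: measurable_cst.
Qed.

Lemma measurable_esum : measurable_fun setT (fun x => \esum_(i in D) f i x)%E.
Proof.
rewrite [X in measurable_fun _ X](_ : _ = (fun x => \sum_(n <oo) g n x)%E); last first.
  by apply/funext => x; rewrite esum_nat.
by apply: ge0_emeasurable_sum => // n x _ _.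
Qed.

Lemma integral_esum : (\int[mu]_x (\esum_(i in D) f i x) = \esum_(i in D) \int[mu]_x f i x)%E.
Proof.
rewrite [RHS]esum_nat; last by move=> i; exact: integral_ge0.
transitivity (\int[mu]_x (\sum_(n <oo) g n x))%E.
  by apply: eq_integral => x _; rewrite esum_nat.
rewrite integral_nneseries //; apply: eq_eseriesr => n _; rewrite /g.
case: (choice.pickle_inv n) => [i|]; last by rewrite integral0.
by case: ifP => // _; rewrite integral0.
Qed.

End CountableSum.

Lemma esum_cst_finite (R : realType) (I : choiceType) (D : set I) (c : R) : finite_set D -> 0 <= c ->
  (\esum_(i in D) c%:E = (#|` fset_set D|%:R * c)%:E)%E.
Proof.
move=> fD c0; rewrite esum_fset //.
by rewrite fsbig_finite //= sumEFin big_const_seq count_predT iter_addr_0 mulr_natl.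
Qed.

(** * The action of SL_2(Z) on pairs of complex numbers *)

Section Action.
Variable R : realType.
Notation RR := (measurableTypeR R).
Notation plane := (RR * RR)%type.
Notation space := (plane * plane)%type.
Notation zg g := (zc (toR R g)).
Notation wg g := (wc (toR R g)).

Definition mact (g : 'M[int]_2) : space -> space := act (zg g) (wg g).

Lemma conjcD (x y : R[i]) : conjc (x + y) = conjc x + conjc y.
Proof. exact: rmorphD. Qed.

Lemma conjcM (x y : R[i]) : conjc (x * y) = conjc x * conjc y.
Proof. exact: rmorphM. Qed.

Lemma mact_fst g v : toC (mact g v).1 = zg g * toC v.1 + conjc (wg g) * toC v.2.
Proof. exact: ofCK. Qed.

Lemma mact_snd g v : toC (mact g v).2 = wg g * toC v.1 + conjc (zg g) * toC v.2.
Proof. exact: ofCK. Qed.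

Lemma space_eq (v v' : space) : toC v.1 = toC v'.1 -> toC v.2 = toC v'.2 -> v = v'.
Proof.
by case: v v' => [a b] [a' b'] /(can_inj (@toCK R)) /= -> /(can_inj (@toCK R)) /= ->.
Qed.

Lemma mactM g h v : mact (g *m h) v = mact g (mact h v).
Proof.
by apply: space_eq; rewrite !(mact_fst, mact_snd) toRM zcM wcM !conjcD !conjcM ?conjcK; ring.
Qed.

Lemma mact1 v : mact 1%:M v = v.
Proof.
by apply: space_eq; rewrite !(mact_fst, mact_snd) zg1 wg1 ?conj0 ?rmorph1; ring.
Qed.

Lemma mactK g v : SL2Z g -> mact g (mact (invmx g) v) = v.
Proof. by move=> gZ; rewrite -mactM mulmxV ?mact1 // unitmx_SL2Z. Qed.

Lemma mactVK g v : SL2Z g -> mact (invmx g) (mact g v) = v.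
Proof. by move=> gZ; rewrite -mactM mulVmx ?mact1 // unitmx_SL2Z. Qed.

Lemma measurable_mact g : measurable_fun setT (mact g).
Proof. exact: measurable_clin. Qed.

Definition disc_form (v : space) : R := nsq2 v.1 - nsq2 v.2.

Lemma disc_form_mact g v : SL2Z g -> disc_form (mact g v) = disc_form v.
Proof.
move=> gZ; have e := SL2_nsq (SL2_toR R gZ).
rewrite /disc_form -!nsq_toC mact_fst mact_snd.
move: e; set z := toC v.1; set w := toC v.2; set p := zg g; set q := wg g => e.
suff : nsq (p * z + conjc q * w) - nsq (q * z + conjc p * w) = (nsq p - nsq q) * (nsq z - nsq w).
  by move=> ->; rewrite e addrK mul1r.
case: p q z w {e} => [p1 p2] [q1 q2] [z1 z2] [w1 w2]; rewrite /nsq /=; ring.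
Qed.

(** In this combination the contributions of [zg g] cancel; it recovers [wg g] from a point and its
    image. *)
Lemma mact_cross g v : SL2Z g ->
  toC (mact g v).2 * conjc (toC v.1) - conjc (toC (mact g v).1) * toC v.2 = wg g * (disc_form v)%:C.
Proof.
move=> gZ; rewrite mact_fst mact_snd.
have <- : toC v.1 * conjc (toC v.1) - toC v.2 * conjc (toC v.2) = (disc_form v)%:C.
  by rewrite !mulcJ -rmorphB !nsq_toC.
by rewrite !conjcD !conjcM conjcK; ring.
Qed.

End Action.

Section Displacement.
Variables (R : realType) (N : nat).
Hypothesis N_gt0 : (0 < N)%N.
Notation zg g := (zc (toR R g)).
Notation wg g := (wc (toR R g)).

Lemma congruence_small (g : 'M[int]_2) : principal_congruence N g -> 2 * normc (wg g) < N%:R -> wg g = 0.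
Proof.
move=> [dg cong] small.
pose x : int := g ord0 ord0 - g ord_max ord_max; pose y : int := g ord_max ord0 + g ord0 ord_max.
have dx : (N %| x)%Z.
  rewrite -eqz_mod_dvd; apply/eqP; rewrite !cong !mxE //=.
have dy : (N %| y)%Z.
  have := cong ord_max ord0; have := cong ord0 ord_max; rewrite !mxE /= !mod0z.
  by move=> h1 h2; rewrite /y rpredD //; apply/dvdz_mod0P.
have h : (x ^+ 2 + y ^+ 2 < N%:Z ^+ 2)%R.
  rewrite -(ltr_int R) rmorphD !rmorphXn /= -pmulrn.
  have -> : x%:~R ^+ 2 + y%:~R ^+ 2 = (2 * normc (wg g)) ^+ 2 :> R.
    by rewrite exprMn normcE2 /nsq /= !mxE /x /y rmorphB rmorphD /=; field.
  by rewrite ltr_pXn2r ?nnegrE // mulr_ge0 // normc_ge0.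
have [[i xi] [j yj]] : (exists i, x = i * N%:Z) /\ (exists j, y = j * N%:Z).
  by split; apply/dvdzP.
have [x0 y0] : x = 0 /\ y = 0.
  have hN : 0 < N%:Z by lia.
  have hij : i ^+ 2 + j ^+ 2 < 1.
    by rewrite -(ltr_pM2r (exprn_gt0 2 hN)) mul1r mulrDl -!exprMn -xi -yj.
  have i0 : i = 0 by move: hij; clear; nia.
  have j0 : j = 0 by move: hij; clear; nia.
  by rewrite xi yj i0 j0 !mul0r.
rewrite /wc !mxE -rmorphB -rmorphD /= -/x -/y x0 y0 !mul0r; apply/eqP.
by rewrite eq_complex /= oppr0 !eqxx.
Qed.

Variable M : R.
Hypotheses (M0 : 0 < M) (M1 : M < 1) (NM : 4 * Num.sqrt M / (1 - M) < N%:R).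

(** Write (z', w') for the image of (z, w), d for their common value of [disc_form], and s = sqrt M.
    By [mact_cross], |wg g| d <= |w'| |z| + |z'| |w| < 2 s |z| |z'|. Both (1 - M) |z|^2 and (1 - M)
    |z'|^2 are at most d, hence so is (1 - M) |z| |z'|. Thus |wg g| < 2 s / (1 - M), which is the
    origin of the bound on N. *)
Lemma cone_displacement (g : 'M[int]_2) v : SL2Z g -> 0 < disc_form v ->
  nsq2 v.2 < M * nsq2 v.1 -> nsq2 (mact g v).2 < M * nsq2 (mact g v).1 ->
  2 * normc (wg g) < N%:R.
Proof.
move=> gZ; rewrite -(disc_form_mact _ gZ) => d0' C C'; have d0 := d0'; rewrite disc_form_mact // in d0.
apply: lt_trans NM; rewrite ltr_pdivlMr ?subr_gt0 //.
have := mact_cross v gZ; move: d0 d0' C C'; rewrite -!nsq_toC.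
have := disc_form_mact v gZ; move: (mact g v) => v'; rewrite /disc_form -!nsq_toC.
move: (toC v.1) (toC v.2) (toC v'.1) (toC v'.2) (wg g) => z w z' w' q.
rewrite -!normcE2 => e d0 d0' C C' cross.
set s := Num.sqrt M; have s0 : 0 < s by rewrite sqrtr_gt0.
have sM : s ^+ 2 = M by rewrite sqr_sqrtr // ltW.
have nz := normc_ge0 z; have nw := normc_ge0 w; have nz' := normc_ge0 z'; have nw' := normc_ge0 w'.
have [a0 b0] : 0 < normc z /\ 0 < normc z' by split; nra.
have hw : normc w < s * normc z.
  by rewrite -(@ltr_pXn2r _ 2) ?nnegrE ?mulr_ge0 ?(ltW s0) // exprMn sM.
have hw' : normc w' < s * normc z'.
  by rewrite -(@ltr_pXn2r _ 2) ?nnegrE ?mulr_ge0 ?(ltW s0) // exprMn sM.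
have tri : normc q * (normc z ^+ 2 - normc w ^+ 2) <= normc w' * normc z + normc z' * normc w.
  rewrite -[X in _ * X <= _](normcR (ltW d0)) -normcM -cross.
  by apply: le_trans (le_normcD _ _) _; rewrite normcN !normcM !normc_conj.
set d := normc z ^+ 2 - normc w ^+ 2 in d0 e tri *.
have dge : (1 - M) * (normc z * normc z') <= d.
  have := mulr_ge0 (_ : 0 <= 1 - M) (sqr_ge0 (normc z - normc z')); rewrite subr_ge0 => /(_ (ltW M1)).
  have h1 : (1 - M) * normc z ^+ 2 <= d by rewrite /d; nra.
  have h2 : (1 - M) * normc z' ^+ 2 <= d by rewrite -e; nra.
  by rewrite sqrrB; nra.
have h : normc q * d < 2 * s * (normc z * normc z') by nra.
have ab : 0 < normc z * normc z' by rewrite mulr_gt0.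
suff : normc q * (1 - M) < 2 * s by lra.
by rewrite -(ltr_pM2r ab); apply: le_lt_trans h; rewrite -mulrA ler_wpM2l // normc_ge0.
Qed.

End Displacement.

(** * Nonvanishing *)

(* Rotating [c0] to the positive axis, the positive part of the vanishing sum
   is at least the contribution of [K], and the negative part comes from the
   complement of [K]. *)
Lemma csum_eq0_le (R : realType) (I : choiceType) (D K : set I) (c : I -> R[i]) (c0 : R[i]) :
  csummable D c -> csum D c = 0 -> K `<=` D -> (forall i, K i -> c i = c0) ->
  (\esum_(i in K) (normc c0)%:E <= \esum_(i in D `&` ~` K) (normc (c i))%:E)%E.
Proof.
move=> [sRe sIm] c_sum KD cK.
have [c00|cn0] := eqVneq c0 0.
  by rewrite c00 normc0 esum1 //; apply: esum_ge0 => i _; rewrite lee_fin normc_ge0.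
have n0 : 0 < normc c0 by rewrite normc_gt0.
pose u : R[i] := conjc c0 * ((normc c0)^-1)%:C.
have nu : normc u = 1.
  by rewrite normcM normc_conj normcR ?invr_ge0 ?(ltW n0) // divff // gt_eqF.
pose r i := complex.Re (u * c i).
have rE i : r i = complex.Re u * complex.Re (c i) - complex.Im u * complex.Im (c i).
    by rewrite /r; case: (u) (c i) => [u1 u2] [c1 c2].
have sr : rsummable D r.
  rewrite /rsummable; under eq_fun do rewrite rE -mulNr.
  by apply: rsummableD; exact: rsummableZ.
have r_sum : rsum D r = 0.
  rewrite (@eq_rsum _ _ _ _ (fun i => complex.Re u * complex.Re (c i) - complex.Im u * complex.Im (c i))) //.
  rewrite rsumB; [|exact: rsummableZ..].
  rewrite !rsumZ //; move/eqP: c_sum; rewrite eq_complex /= => /andP[/eqP -> /eqP ->].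
  by rewrite !mulr0 subr0.
have rK i : K i -> r i = normc c0.
  move=> Ki; rewrite /r cK // /u mulrAC [conjc c0 * c0]mulrC mulcJ -rmorphM /= -normcE2 expr2 mulfK //.
  by rewrite gt_eqF.
have rle i : `|r i| <= normc (c i).
  by apply: le_trans (Re_le_normc _) _; rewrite normcM nu mul1r.
have fin (e : R -> R) : (forall x, 0 <= Num.max (e x) 0 <= `|x|) ->
    \esum_(i in D) (Num.max (e (r i)) 0)%:E \is a fin_num.
  move=> he; rewrite ge0_fin_numE; last first.
    by apply: esum_ge0 => i _; rewrite lee_fin; have /andP[] := he (r i).
  apply: le_lt_trans sr; apply: le_esum => i _; rewrite lee_fin.
  by have /andP[] := he (r i).
have fp := fin id; have fn := fin -%R.
have {}fp : \esum_(i in D) (Num.max (r i) 0)%:E \is a fin_num.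
  by apply: fp => x; rewrite le_max lexx orbT ge_max ler_norm normr_ge0.
have {}fn : \esum_(i in D) (Num.max (- r i) 0)%:E \is a fin_num.
  by apply: fn => x; rewrite le_max lexx orbT ge_max normr_ge0 andbT -normrN ler_norm.
have e : (\esum_(i in D) (Num.max (r i) 0)%:E = \esum_(i in D) (Num.max (- r i) 0)%:E)%E.
  by rewrite -(fineK fp) -(fineK fn); congr (_%:E); apply/eqP; rewrite -subr_eq0; apply/eqP.
apply: (@le_trans _ _ (\esum_(i in D) (Num.max (r i) 0)%:E)%E).
  apply: le_trans (le_esum_subset _ KD) => [|i]; last by rewrite lee_fin le_max lexx orbT.
  by apply: le_esum => i Ki; rewrite rK // lee_fin le_max lexx.
rewrite e esum_mkcondr; apply: le_esum => i Di; case: ifPn => Ki; rewrite lee_fin.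
  by rewrite ge_max normc_ge0 andbT (le_trans _ (rle i)) // -normrN ler_norm.
move: Ki; rewrite notin_setE => Ki; have {}Ki : K i by apply: contrapT.
by rewrite rK // ge_max lexx andbT oppr_le0 ltW.
Qed.

Section Nonvanishing.
Variables (R : realType) (k m N : nat) (Gamma : set 'M[int]_2) (M : R).
Hypotheses (m_gt2 : (3 <= m)%N) (N_gt0 : (0 < N)%N).
Hypotheses (Gamma_group : is_subgroup Gamma) (GammaN : Gamma `<=` principal_congruence N).
Hypothesis card_dvd : (#|` fset_set (cap_SO2 R Gamma)| %| m + 2 * k)%N.
Hypotheses (M_median : beta_median (k%:R / 2 + 1 : R) (m%:R / 2 - 1) < M) (M1 : M < 1)
  (NM : 4 * Num.sqrt M / (1 - M) < N%:R).
Notation mu := (@lebesgue_measure R).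
Notation RR := (measurableTypeR R).
Notation plane := (RR * RR)%type.
Notation space := (plane * plane)%type.
Notation K := (cap_SO2 R Gamma).
Notation zg g := (zc (toR R g)).
Notation wg g := (wc (toR R g)).

Let GammaZ : Gamma `<=` SL2Z. Proof. by move=> g /GammaN[]. Qed.

Let M0 : 0 < M.
Proof.
have [a1 b1] := @beta_shape R k m m_gt2; have [/andP[m0 _] _] := beta_medianP a1 b1.
exact: lt_trans M_median.
Qed.

Definition on_shell (v : space) : R := \1_(@unit_shell R) (disc_form v).
Definition on_cone (A : set RR) (v : space) : R := \1_A (nsq2 v.2 - M * nsq2 v.1).
Definition size_F (v : space) : R := Num.sqrt (nsq2 v.2) ^+ k * (Num.sqrt (nsq2 v.1))^-1 ^+ (m + k).

Lemma size_FE (v : space) : size_F v = normc (Fzw k m (toC v.1) (toC v.2)).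
Proof. by rewrite /size_F /Fzw normcM normcV !normcX !normcS !nsq_toC exprVn. Qed.

Lemma size_F_ge0 v : 0 <= size_F v.
Proof. by rewrite size_FE normc_ge0. Qed.

Lemma nsq2_ge0 (p : plane) : 0 <= nsq2 p.
Proof. by rewrite addr_ge0 ?sqr_ge0. Qed.

Lemma cone_densityE A v :
  cone_density k m M A (nsq2 v.2, nsq2 v.1) = on_shell v * on_cone A v * size_F v.
Proof.
rewrite /cone_density /= [\1_(`[0, +oo[%classic) _]indic_in ?mulr1 //=.
by rewrite in_itv /= nsq2_ge0.
Qed.

Lemma measurable_nsq2_fst : measurable_fun setT (fun v : space => nsq2 v.1).
Proof. by apply: (measurableT_comp (@measurable_nsq2 R)); exact: measurable_fst. Qed.

Lemma measurable_nsq2_snd : measurable_fun setT (fun v : space => nsq2 v.2).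
Proof. by apply: (measurableT_comp (@measurable_nsq2 R)); exact: measurable_snd. Qed.

Lemma measurable_on_shell : measurable_fun setT on_shell.
Proof.
apply: measurable_indicT; first exact: measurable_itv.
by apply: measurable_funB; [exact: measurable_nsq2_fst|exact: measurable_nsq2_snd].
Qed.

Lemma measurable_on_cone A : measurable A -> measurable_fun setT (on_cone A).
Proof.
move=> mA; apply: measurable_indicT => //.
apply: measurable_funB; first exact: measurable_nsq2_snd.
by apply: measurable_funM; [exact: measurable_cst|exact: measurable_nsq2_fst].
Qed.

Lemma measurable_size_F : measurable_fun setT size_F.
Proof.
apply: measurable_funM; apply: measurable_funX.
  by apply: measurable_sqrt; exact: measurable_nsq2_snd.
by apply: measurable_sqrtV; exact: measurable_nsq2_fst.
Qed.

Lemma on_shell_gt0 v : @unit_shell R (disc_form v) -> 0 < disc_form v.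
Proof. by rewrite /unit_shell /= in_itv /= => /andP[h _]; apply: lt_le_trans h. Qed.

Lemma on_shell_mact g v : SL2Z g -> on_shell (mact g v) = on_shell v.
Proof. by move=> gZ; rewrite /on_shell disc_form_mact. Qed.

Lemma inner_rayE (a b : R) : @inner_ray R (a - b) <-> a < b.
Proof. by rewrite /inner_ray /= in_itv /= subr_lt0. Qed.

Lemma outer_rayE (a b : R) : @outer_ray R (a - b) <-> ~ @inner_ray R (a - b).
Proof.
by rewrite inner_rayE /outer_ray /= in_itv /= andbT subr_ge0 leNgt; split=> /negP.
Qed.

Lemma inner_stabilizer g v : Gamma g -> 0 < disc_form v ->
  @inner_ray R (nsq2 v.2 - M * nsq2 v.1) ->
  @inner_ray R (nsq2 (mact g v).2 - M * nsq2 (mact g v).1) -> K g.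
Proof.
move=> Gg d0 /inner_rayE C /inner_rayE C'.
apply/(stabilizerE R GammaZ); split=> //; apply: (congruence_small N_gt0 (GammaN Gg)).
exact: (cone_displacement M0 M1 NM (GammaZ Gg) d0 C C').
Qed.

Notation kappa := (#|` fset_set K|).

Section Vanishing.
Hypothesis vanishing : forall g, SL2 g -> Poincare Gamma (@F R k m) g = 0.

(** The hypothesis concerns SL_2(R) only, so v is divided by s, the square root of its [disc_form].
    By homogeneity every term acquires the same factor s^m, which cancels. *)
Lemma vanishing_le v : 0 < disc_form v ->
  ((kappa%:R * size_F v)%:E <= \esum_(g in Gamma `&` ~` K) (size_F (mact g v))%:E)%E.
Proof.
move=> d0; set s := Num.sqrt (disc_form v); have s0 : 0 < s by rewrite sqrtr_gt0.
have s2 : s ^+ 2 = disc_form v by rewrite sqr_sqrtr // ltW.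
have sC : s%:C != 0 by apply/eqP => /(congr1 (@complex.Re R)) /= /eqP; rewrite gt_eqF.
pose x := of_zw (s^-1%:C * toC v.1) (s^-1%:C * toC v.2).
have nsC (z : R[i]) : nsq (s^-1%:C * z) = s^-1 ^+ 2 * nsq z.
  by rewrite nsqM /nsq /= expr0n addr0.
have Sx : SL2 x.
  rewrite /SL2 /= nsq_det zc_of_zw wc_of_zw !nsC -mulrBr !nsq_toC -/(disc_form v) -s2.
  by rewrite exprVn mulVf // expf_neq0 // gt_eqF.
have term g : Gamma g -> PoincareTerm (@F R k m) x g =
    (s ^+ m)%:C * Fzw k m (toC (mact g v).1) (toC (mact g v).2).
  move=> Gg; rewrite /PoincareTerm FE; last by apply: SL2M => //; apply/SL2_toR/GammaZ.
  rewrite zcM wcM zc_of_zw wc_of_zw mact_fst mact_snd /Fzw.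
  set z' := zg g * toC v.1 + conjc (wg g) * toC v.2; set w' := wg g * toC v.1 + conjc (zg g) * toC v.2.
  have -> : zg g * (s^-1%:C * toC v.1) + conjc (wg g) * (s^-1%:C * toC v.2) = s^-1%:C * z'.
    by rewrite /z'; ring.
  have -> : wg g * (s^-1%:C * toC v.1) + conjc (zg g) * (s^-1%:C * toC v.2) = s^-1%:C * w'.
    by rewrite /w'; ring.
  rewrite !exprMn invfM mulrACA; congr (_ * _).
  rewrite fmorphV /= exprVn exprVn invrK exprD mulrC rmorphXn /= -mulrA divff ?mulr1 //.
  by rewrite expf_neq0.
have G1 : Gamma 1%:M by case: Gamma_group.
have := @csum_eq0_le R _ Gamma K (PoincareTerm (@F R k m) x) (PoincareTerm (@F R k m) x 1%:M).
have toR1 : toR R 1%:M *m x = x by rewrite /toR map_mx1 mul1mx.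
move=> /(_ (csummable_F _ GammaZ Sx m_gt2) (vanishing Sx) (@subIsetl _ _ _)) h.
have {h} := h _; rewrite term // mact1 normcM normcR ?exprn_ge0 ?(ltW s0) // -size_FE.
have fK := finite_stabilizer R GammaZ.
rewrite esum_cst_finite ?mulr_ge0 ?exprn_ge0 ?(ltW s0) ?size_F_ge0 // => h.
have sm : (0 < (s ^+ m)%:E)%E by rewrite lte_fin exprn_gt0.
rewrite -(@lee_pmul2l _ (s ^+ m)%:E) // -EFinM.
rewrite mulrCA; apply: le_trans (h _) _ => [g Kg|].
  rewrite -(mact1 v) -(term _ G1) /PoincareTerm toR1.
  exact: (F_stabilizer Gamma_group GammaZ card_dvd Kg Sx).
apply: le_trans (esum_scale_le _ _ _); [|by rewrite exprn_ge0 // ltW|by move=> g; rewrite lee_fin size_F_ge0].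
apply: le_esum => g [Gg _]; rewrite term // normcM normcR ?exprn_ge0 ?(ltW s0) // -size_FE.
by rewrite EFinM.
Qed.

End Vanishing.

(** If g and g0 both count, then g0^-1 g moves the inner point g^-1 v to the inner point g0^-1 v and
    so lies in K: all counted elements are in the single coset g0 K. If there is any, v itself is
    not inner, for otherwise g0^-1 would lie in K. *)
Lemma overlap_le v :
  (\esum_(g in Gamma `&` ~` K) (on_shell v * on_cone (@inner_ray R) (mact (invmx g) v) * size_F v)%:E
   <= kappa%:R%:E * (on_shell v * on_cone (@outer_ray R) v * size_F v)%:E)%E.
Proof.
have [sh|sh] := pselect (@unit_shell R (disc_form v)); last first.
  by rewrite /on_shell indic_out // !mul0r mule0 esum1 // => g _; rewrite !mul0r.
have d0 := on_shell_gt0 sh; have sz := size_F_ge0 v; have [_ GM GV] := Gamma_group.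
pose S : set 'M[int]_2 :=
  [set g | @inner_ray R (nsq2 (mact (invmx g) v).2 - M * nsq2 (mact (invmx g) v).1)].
have shE : on_shell v = 1 by rewrite /on_shell indic_in.
have -> : (\esum_(g in Gamma `&` ~` K)
    (on_shell v * on_cone (@inner_ray R) (mact (invmx g) v) * size_F v)%:E =
    \esum_(g in (Gamma `&` ~` K) `&` S) (size_F v)%:E)%E.
  rewrite [RHS]esum_mkcondr; apply: eq_esum => g _; rewrite shE mul1r /on_cone.
  by case: ifPn; rewrite ?inE ?notin_setE => h; [rewrite indic_in // mul1r|rewrite indic_out // mul0r].
have [[g0 [[Gg0 Kg0] Sg0]]|noT] := pselect (exists g0, ((Gamma `&` ~` K) `&` S) g0); last first.
  rewrite esum1 => [|g Tg]; last by case: noT; exists g.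
  by rewrite -EFinM lee_fin shE mul1r mulr_ge0 // mulr_ge0 // ler0n.
have outer : on_cone (@outer_ray R) v = 1.
  rewrite /on_cone indic_in //; apply/outer_rayE => inner; apply: Kg0.
  have KV := inner_stabilizer (GV _ Gg0) d0 inner Sg0.
  by rewrite -(invmxK g0); exact: stabilizerV.
rewrite shE outer !mul1r -EFinM -(esum_cst_finite (finite_stabilizer R GammaZ) sz).
have g0u := unitmx_SL2Z (GammaZ Gg0).
apply: (@le_trans _ _ (\esum_(g in mulmx g0 @` K) (size_F v)%:E)%E).
  apply: le_esum_subset => [g|g [[Gg Kg] Sg]]; first by rewrite lee_fin.
  exists (invmx g0 *m g); last by rewrite mulKVmx.
  apply: (@inner_stabilizer _ (mact (invmx g) v)) => //.
  - by apply: GM => //; exact: GV.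
  - by rewrite disc_form_mact //; apply/GammaZ/GV.
  - by rewrite mactM mactK //; exact: GammaZ.
rewrite (@reindex_esum _ _ _ K _ (mulmx g0)) //.
split=> [g Kg|g h _ _ e|g [h Kh <-]]; [by exists g| |by exists h].
by rewrite -(mulKmx g0u g) e mulKmx.
Qed.

(** * Integration over the shell and unfolding *)

Section Integration.
Variables (area : {sigma_finite_measure set plane -> \bar R}) (ca : R).
Hypothesis areaP : invariant_area area ca.
Notation vol := (area \x area)%E.
Let mass A := (\int[vol]_v (on_shell v * on_cone A v * size_F v)%:E)%E.

Lemma mass_cone A : measurable A -> (forall c x : R, 0 < c -> A (c * x) <-> A x) ->
  mass A = ((ca ^+ 2)%:E * (shell_mass R m * \int[mu]_x (angular_weight k m M A x)%:E))%E.
Proof.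
move=> mA coneA.
transitivity (\int[vol]_v (cone_density k m M A (nsq2 v.2, nsq2 v.1))%:E)%E.
  by apply: eq_integral => v _; rewrite cone_densityE.
rewrite -(integral_cone_density k M m_gt2 mA coneA).
apply: (vol_biradial areaP (h := fun p => (cone_density k m M A p)%:E)).
- by apply/measurable_EFinP; exact: measurable_cone_density.
- by move=> p; rewrite lee_fin cone_density_ge0.
- by move=> x y x0; rewrite cone_density_neg1.
- by move=> x y y0; rewrite cone_density_neg2 // ltW.
Qed.

Hypothesis vanishing : forall g, SL2 g -> Poincare Gamma (@F R k m) g = 0.

Let m_inner := @measurable_inner_ray R.
Let m_outer := @measurable_outer_ray R.

Lemma inner_le_outer : (kappa%:R%:E * mass (@inner_ray R) <= kappa%:R%:E * mass (@outer_ray R))%E.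
Proof.
have ge0 A v : (0 <= (on_shell v * on_cone A v * size_F v)%:E)%E.
  by rewrite lee_fin !mulr_ge0 // size_F_ge0.
have meas A : measurable A -> measurable_fun setT (fun v => (on_shell v * on_cone A v * size_F v)%:E).
  move=> mA; apply/measurable_EFinP; apply: measurable_funM; last exact: measurable_size_F.
  by apply: measurable_funM; [exact: measurable_on_shell|exact: measurable_on_cone].
rewrite /mass -!ge0_integralZl_EFin //; do ?[exact: meas|exact: ler0n].
pose h g v := (on_shell v * on_cone (@inner_ray R) v * size_F (mact g v))%:E.
pose h' g v := (on_shell v * on_cone (@inner_ray R) (mact (invmx g) v) * size_F v)%:E.
have h0 g v : (0 <= h g v)%E by rewrite lee_fin !mulr_ge0 // size_F_ge0.
have h'0 g v : (0 <= h' g v)%E by rewrite lee_fin !mulr_ge0 // size_F_ge0.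
have mh g : measurable_fun setT (h g).
  apply/measurable_EFinP; apply: measurable_funM.
    by apply: measurable_funM; [exact: measurable_on_shell|exact: measurable_on_cone].
  by apply: (measurableT_comp measurable_size_F); exact: measurable_mact.
have mh' g : measurable_fun setT (h' g).
  apply/measurable_EFinP; apply: measurable_funM; last exact: measurable_size_F.
  apply: measurable_funM; first exact: measurable_on_shell.
  by apply: (measurableT_comp (measurable_on_cone m_inner)); exact: measurable_mact.
(* Pointwise domination: off the shell or off the inner region the left side is 0, and elsewhere
   [vanishing_le] applies. *)
apply: (@le_trans _ _ (\int[vol]_v \esum_(g in Gamma `&` ~` K) h g v)%E).
  apply: ge0_le_integral => //.
  - by move=> v _; rewrite mule_ge0 // lee_fin ler0n.
  - by apply: measurable_funeM; exact: meas.
  - exact: measurable_esum.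
  move=> v _; rewrite /h.
  have [sh|sh] := pselect (@unit_shell R (disc_form v)); last first.
    by rewrite /on_shell indic_out // !mul0r mule0; apply: esum_ge0 => g _; rewrite !mul0r.
  have [inn|inn] := pselect (@inner_ray R (nsq2 v.2 - M * nsq2 v.1)); last first.
    by rewrite /on_cone indic_out // !mulr0 !mul0r mule0; apply: esum_ge0 => g _; rewrite !mul0r.
  rewrite /on_shell /on_cone !indic_in // !mul1r -EFinM.
  apply: le_trans (vanishing_le vanishing (on_shell_gt0 sh)) _.
  by apply: le_esum => g _; rewrite !mul1r.
rewrite integral_esum //.
(* Unfolding: in each term the volume-preserving substitution by g frees F of its translate and
   moves the inner region by g instead. *)
rewrite (_ : (\esum_(g in _) _)%E = (\esum_(g in Gamma `&` ~` K) \int[vol]_v h' g v)%E); last first.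
  apply: eq_esum => g [Gg Kg]; have gZ := GammaZ Gg.
  have wn0 : wg g != 0 by apply/eqP => w0; apply: Kg; apply/stabilizerE.
  have pq : nsq (zg g) - nsq (wg g) = 1 by rewrite SL2_nsq ?addrK //; exact: SL2_toR.
  rewrite -(vol_act areaP wn0 pq (mh' g) (h'0 g)); apply: eq_integral => v _.
  by rewrite -[act _ _ v]/(mact g v) /h /h' mactVK // on_shell_mact.
rewrite -integral_esum //; apply: ge0_le_integral => //.
- by move=> v _; exact: esum_ge0.
- exact: measurable_esum.
- by apply: measurable_funeM; exact: meas.
by move=> v _; exact: overlap_le.
Qed.

Lemma no_vanishing : False.
Proof.
have := inner_le_outer; apply/negP; rewrite -ltNge.
have [ca0 _ _] := areaP.
rewrite !mass_cone //; do ?[exact: inner_ray_cone|exact: outer_ray_cone].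
have kappa0 : (0 < kappa%:R :> R).
  rewrite ltr0n cardfs_gt0; apply/fset0Pn; exists 1%:M.
  by rewrite in_fset_set ?inE; [exact: stabilizer1|exact: finite_stabilizer].
have sf : shell_mass R m \is a fin_num.
  by rewrite ge0_fin_numE ?shell_mass_fin // shell_mass_ge0.
have s0 : (0 < shell_mass R m)%E by exact: shell_mass_gt0.
rewrite !lte_pmul2l ?lte_fin ?exprn_gt0 //.
exact: angular_mass_lt.
Qed.

End Integration.

Lemma nonvanishing : exists g, SL2 g /\ Poincare Gamma (@F R k m) g <> 0.
Proof.
apply: contrapT => h; have [A [ca areaP]] := invariant_area_exists R.
apply: (no_vanishing areaP) => g Sg; apply: contrapT => Pg; apply: h.
by exists g.
Qed.

End Nonvanishing.

(** * Integrability in Iwasawa coordinates *)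

Section HalfLine.
Variable R : realType.
Notation mu := (@lebesgue_measure R).
Notation RR := (measurableTypeR R).

Lemma measurable_oneDsqrV d (T : measurableType d) (f : T -> R) : measurable_fun setT f ->
  measurable_fun setT (fun x => (oneDsqr (f x))^-1).
Proof.
move=> mf; have h : measurable_fun [set: R] (fun x : R => (oneDsqr x)^-1).
  by apply: continuous_measurable_fun; exact: continuous_oneDsqrV.
exact: (measurableT_comp h mf).
Qed.

(* For positive y this is the derivative of 2 atan (y^(1/2)); it vanishes for the other y. *)
Definition half_weight (y : R) : R := (Num.sqrt y)^-1 * (oneDsqr (Num.sqrt y))^-1.

Lemma half_weight_ge0 y : 0 <= half_weight y.
Proof. by rewrite mulr_ge0 ?invr_ge0 ?sqrtr_ge0 // (le_trans ler01 (oneDsqr_ge1 _)). Qed.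

Lemma measurable_half_weight : measurable_fun [set: RR] half_weight.
Proof.
apply: measurable_funM; first exact: measurable_rsqrt.
by apply: measurable_oneDsqrV; apply: measurable_sqrt; exact: measurable_id.
Qed.

Lemma integral_half_weight_itv (a b : R) : 0 < a -> a < b ->
  (\int[mu]_(x in `[a, b]) (half_weight x)%:E <= pi%:E)%E.
Proof.
move=> a0 ab.
have d (x : R) : 0 < x -> is_derive x 1 (fun y : R => 2 * atan (Num.sqrt y)) (half_weight x).
  move=> x0; have h := is_derive1_sqrt x0.
  have c := @is_derive1_comp R (@atan R) (@Num.sqrt R) x _ _ (is_derive1_atan (Num.sqrt x)) h.
  have k : is_derive x 1 (2 \*: ((@atan R) \o (@Num.sqrt R))) _ := is_deriveZ _ c.
  apply: (is_derive_eq k); rewrite /half_weight /oneDsqr /GRing.scale /=.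
  have s0 : Num.sqrt x != 0 by rewrite gt_eqF // sqrtr_gt0.
  have s1 : 1 + Num.sqrt x ^+ 2 != 0 by rewrite gt_eqF // ltr_pwDl ?sqr_ge0.
  by field; rewrite s0 s1.
have cs (x : R) : {for x, continuous (fun y : R => 2 * atan (Num.sqrt y))}.
  apply: cvgM; first exact: cvg_cst.
  by apply: continuous_comp; [exact: sqrt_continuous|exact: continuous_atan].
rewrite (@continuous_FTC2 R half_weight (fun y => 2 * atan (Num.sqrt y))) //.
- rewrite -EFinB lee_fin.
  have := atan_ltpi2 (Num.sqrt b); have : 0 <= atan (Num.sqrt a).
    by rewrite -atan0 (ltW_homo (@lt_atan R)) // sqrtr_ge0.
  lra.
- apply: continuous_in_subspaceT => x /set_mem /=; rewrite in_itv /= => /andP[ax _].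
  apply: cvgM.
    by apply: cvgV; [rewrite gt_eqF // sqrtr_gt0 (lt_le_trans a0)|exact: sqrt_continuous].
  have c : {for x, continuous ((fun z : R => (oneDsqr z)^-1) \o @Num.sqrt R)}.
    by apply: continuous_comp; [exact: sqrt_continuous|exact: continuous_oneDsqrV].
  exact: c.
- split.
  + move=> x; rewrite in_itv /= => /andP[ax _].
    by have [] := d x (lt_trans a0 ax).
  + by apply: cvg_at_right_filter; exact: cs.
  + by apply: cvg_at_left_filter; exact: cs.
- move=> x; rewrite in_itv /= => /andP[ax _]; rewrite derive1E.
  by have [_ ->] := d x (lt_trans a0 ax).
Qed.

Lemma integral_half_weight : (\int[mu]_x (half_weight x)%:E <= pi%:E)%E.
Proof.
(* With n + 2 the left end stays strictly below the right end already for n = 0. *)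
pose F (n : nat) : set RR := `[(n.+2%:R : R)^-1, n.+2%:R]%classic.
pose P : set RR := `]0, +oo[%classic.
have FU : P = \bigcup_n F n.
  apply/seteqP; split=> x; rewrite /P /= in_itv /= andbT.
    move=> x0; have [n hn] : exists n : nat, Num.max x x^-1 <= n.+2%:R.
      exists (Num.truncn (Num.max x x^-1)); apply: ltW; apply: (lt_trans (truncnS_gt _)).
      by rewrite ltr_nat.
    move: hn; rewrite ge_max => /andP[h1 h2].
    exists n => //; rewrite /F /= in_itv /= h1 andbT.
    by rewrite -[x]invrK lef_pV2 ?posrE ?invr_gt0 ?ltr0n.
  move=> [n _]; rewrite /F /= !in_itv /= => /andP[h _].
  by apply: lt_le_trans h; rewrite invr_gt0 ltr0n.
have mm : measurable_fun [set: RR] (fun x : RR => (half_weight x)%:E).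
  by apply/measurable_EFinP; exact: measurable_half_weight.
have nF : nondecreasing_seq F.
  move=> n k nk; apply/subsetPset => x; rewrite /F /= !in_itv /= => /andP[h1 h2].
  have le : (n.+2%:R : R) <= k.+2%:R by rewrite ler_nat !ltnS.
  by rewrite (le_trans h2 le) andbT; apply: le_trans h1; rewrite lef_pV2 ?posrE ?ltr0n.
have mF n : measurable (F n) by exact: measurable_itv.
have r0 (x : RR) : (0 <= (half_weight x)%:E)%E by rewrite lee_fin half_weight_ge0.
have c := @ge0_nondecreasing_set_cvg_integral _ RR R F (fun x => (half_weight x)%:E) mu nF mF
  (fun i => measurable_funTS mm) (fun i x _ => r0 x).
have -> : (\int[mu]_x (half_weight x)%:E = \int[mu]_(x in P) (half_weight x)%:E)%E.
  rewrite [RHS]integral_mkcond; apply: eq_integral => x _; rewrite patchE.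
  case: ifPn => //; rewrite notin_setE /P /= in_itv /= andbT => /negP; rewrite -leNgt => x0.
  by rewrite /half_weight ler0_sqrtr // invr0 mul0r.
rewrite FU -(cvg_lim _ c) //.
apply: lime_le; first by apply/cvg_ex; eexists; exact: c.
apply: nearW => n; apply: integral_half_weight_itv; first by rewrite invr_gt0 ltr0n.
by apply: (@lt_trans _ _ 1); rewrite ?invf_lt1 ?ltr0n ?ltr1n.
Qed.

Lemma integral_oneDsqrV : (\int[mu]_x ((oneDsqr x)^-1)%:E = pi%:E)%E.
Proof.
rewrite (@ge0_symfun_integralT R (fun x => (oneDsqr x)^-1)).
- by rewrite -set_itvcy integral0y_oneDsqr -EFinM; congr (_%:E); field.
- by move=> x; rewrite invr_ge0 (le_trans ler01 (oneDsqr_ge1 _)).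
- exact: continuous_oneDsqrV.
- by move=> x; rewrite /= /oneDsqr sqrrN.
Qed.

End HalfLine.

Section ComplexMeasurable.
Variables (R : realType) (d : measure_display) (T : measurableType d).
Implicit Types f g : T -> R[i].

Definition cmeasurable f := measurable_fun setT (fun x => complex.Re (f x)) /\
  measurable_fun setT (fun x => complex.Im (f x)).

Lemma cmeasurableM f g : cmeasurable f -> cmeasurable g -> cmeasurable (fun x => f x * g x).
Proof.
move=> [f1 f2] [g1 g2]; split.
  rewrite (_ : (fun x => _) =
    (fun x => complex.Re (f x) * complex.Re (g x) - complex.Im (f x) * complex.Im (g x))).
    by apply: measurable_funB; exact: measurable_funM.
  by apply/funext => x; case: (f x) (g x) => [? ?] [? ?].
rewrite (_ : (fun x => _) =
    (fun x => complex.Re (f x) * complex.Im (g x) + complex.Im (f x) * complex.Re (g x))).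
  by apply: measurable_funD; exact: measurable_funM.
by apply/funext => x; case: (f x) (g x) => [? ?] [? ?].
Qed.

Lemma cmeasurableX f n : cmeasurable f -> cmeasurable (fun x => f x ^+ n).
Proof.
move=> mf; elim: n => [|n IH]; first by split; exact: measurable_cst.
by under eq_fun do rewrite exprS; exact: cmeasurableM.
Qed.

Lemma cmeasurableV f : cmeasurable f -> cmeasurable (fun x => (f x)^-1).
Proof.
move=> [f1 f2]; have mn : measurable_fun setT (fun x => (nsq (f x))^-1).
  rewrite (_ : (fun x => _) = (fun x => (Num.sqrt (nsq (f x)))^-1 ^+ 2)).
    apply: measurable_funX; apply: measurable_sqrtV.
    by apply: measurable_funD; exact: measurable_funX.
  by apply/funext => x; rewrite exprVn sqr_sqrtr // nsq_ge0.
split.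
  rewrite (_ : (fun x => _) = (fun x => complex.Re (f x) * (nsq (f x))^-1)); first exact: measurable_funM.
  by apply/funext => x; exact: ReV.
rewrite (_ : (fun x => _) = (fun x => - complex.Im (f x) * (nsq (f x))^-1)).
  by apply: measurable_funM => //; exact: measurableT_comp.
by apply/funext => x; exact: ImV.
Qed.

Lemma cmeasurable_Fzw k m f g : cmeasurable f -> cmeasurable g ->
  cmeasurable (fun x => Fzw k m (f x) (g x)).
Proof.
by move=> mf mg; apply: cmeasurableM; [|apply: cmeasurableV]; exact: cmeasurableX.
Qed.

End ComplexMeasurable.

(** * A product majorant for F *)

Section Iwasawa.
Variables (R : realType) (k m : nat).
Hypothesis m_gt2 : (3 <= m)%N.
Notation mu := (@lebesgue_measure R).
Notation RR := (measurableTypeR R).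
Notation group := ((RR * RR) * RR)%type.

Definition iwasawa_z (p : group) : R[i] :=
  (((Num.sqrt p.1.2 + (Num.sqrt p.1.2)^-1) / 2) +i* (- (p.1.1 * (Num.sqrt p.1.2)^-1 / 2))) * expi p.2.
Definition iwasawa_w (p : group) : R[i] :=
  (((Num.sqrt p.1.2 - (Num.sqrt p.1.2)^-1) / 2) +i* (- (p.1.1 * (Num.sqrt p.1.2)^-1 / 2))) * expi p.2.

Lemma iwasawaE (x y t : R) : let g := n_ x *m a_ y *m r_ t in
  zc g = iwasawa_z (x, y, t) /\ wc g = iwasawa_w (x, y, t).
Proof.
split; [rewrite zcM|rewrite wcM]; rewrite wc_r zc_r mulr0 addr0; congr (_ * _);
  rewrite /= /a_ /zc /wc !mulmx2 !mx2E;
  move: (Num.sqrt y)^-1 => v; move: (Num.sqrt y) => s;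
  by apply/eqP; rewrite eq_complex /=; apply/andP; split; apply/eqP; field.
Qed.

Lemma SL2_iwasawa (x y t : R) : 0 < y -> SL2 (n_ x *m a_ y *m r_ t).
Proof.
move=> y0; have s0 : Num.sqrt y != 0 by rewrite gt_eqF // sqrtr_gt0.
apply: SL2M; first apply: SL2M; rewrite /SL2 /= det2 !mx2E.
- by ring.
- by rewrite divff // mulr0 subr0.
- by rewrite -(cos2Dsin2 t) !expr2; ring.
Qed.

(** To separate x from y, one splits |z|^3 into |z|^2 >= (1 + x^2) / (4 y) and |z| >= (1 + y) / (2
    sqrt y), whence the constant 8. The factor y^(-2) of the Haar measure is written as a fourth
    power of 1 / sqrt y. *)
Lemma iwasawa_bound (x y t : R) : 0 < y ->
  normc (F k m (n_ x *m a_ y *m r_ t)) * (Num.sqrt y)^-1 ^+ 4 <= 8 * ((oneDsqr x)^-1 * half_weight y).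
Proof.
move=> y0; set g := _ *m r_ t; have Sg : SL2 g by exact: SL2_iwasawa.
have [ez _] := iwasawaE x y t; rewrite FE //.
set s := Num.sqrt y; have s0 : 0 < s by rewrite sqrtr_gt0.
have n1 := SL2_normc_ge1 Sg.
apply: (@le_trans _ _ ((normc (zc g) ^+ 3)^-1 * s^-1 ^+ 4)).
  rewrite ler_wpM2r ?exprn_ge0 ?invr_ge0 ?(ltW s0) //.
  apply: le_trans (normc_Fzw _ _ (SL2_wz Sg)) _.
  by rewrite lef_pV2 ?posrE ?exprn_gt0 ?(lt_le_trans ltr01) // ler_weXn2l.
pose u : R[i] := ((s + s^-1) / 2) +i* (- (x * s^-1 / 2)).
have nu : normc (zc g) = normc u.
  rewrite ez normcM [normc (expi t)]normcS /nsq /= cos2Dsin2 sqrtr1 mulr1 //.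
have h1 : (1 + s ^+ 2) / (2 * s) <= normc u.
  apply: le_trans (le_trans (ler_norm _) (Re_le_normc u)) => /=.
  by rewrite le_eqVlt; apply/orP; left; apply/eqP; field; rewrite gt_eqF.
have h2 : (1 + x ^+ 2) / (4 * s ^+ 2) <= normc u ^+ 2.
  rewrite normcE2 /nsq /=.
  have -> : ((s + s^-1) / 2) ^+ 2 + (- (x / s / 2)) ^+ 2 =
     ((1 + s ^+ 2) ^+ 2 + x ^+ 2) / (4 * s ^+ 2) by field; rewrite gt_eqF.
  rewrite ler_pM2r ?invr_gt0 ?mulr_gt0 ?exprn_gt0 // lerD2r.
  by rewrite exprn_ege1 // lerDl sqr_ge0.
have x1 : 0 < 1 + x ^+ 2 by rewrite ltr_pwDl ?sqr_ge0.
have s1 : 0 < 1 + s ^+ 2 by rewrite ltr_pwDl ?sqr_ge0.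
have h3 : (1 + x ^+ 2) * (1 + s ^+ 2) / (8 * s ^+ 3) <= normc (zc g) ^+ 3.
  rewrite nu [normc u ^+ 3]exprSr.
  have -> : (1 + x ^+ 2) * (1 + s ^+ 2) / (8 * s ^+ 3) =
     (1 + x ^+ 2) / (4 * s ^+ 2) * ((1 + s ^+ 2) / (2 * s)) by field; rewrite gt_eqF.
  by apply: ler_pM => //; rewrite divr_ge0 ?mulr_ge0 ?exprn_ge0 ?(ltW s0) ?(ltW x1) ?(ltW s1).
apply: (@le_trans _ _ (((1 + x ^+ 2) * (1 + s ^+ 2) / (8 * s ^+ 3))^-1 * s^-1 ^+ 4)).
  rewrite ler_wpM2r ?exprn_ge0 ?invr_ge0 ?(ltW s0) //.
  have l0 : 0 < (1 + x ^+ 2) * (1 + s ^+ 2) / (8 * s ^+ 3) by rewrite divr_gt0 ?mulr_gt0 ?exprn_gt0.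
  by rewrite lef_pV2 ?posrE // (lt_le_trans l0).
rewrite /half_weight /oneDsqr -/s le_eqVlt; apply/orP; left; apply/eqP.
by field; rewrite !gt_eqF.
Qed.

Lemma measurable_iwasawa : cmeasurable iwasawa_z /\ cmeasurable iwasawa_w.
Proof.
have mx : measurable_fun setT (fun p : group => p.1.1 : R).
  by apply: (measurableT_comp (@measurable_fst2 R)); exact: measurable_fst.
have my : measurable_fun setT (fun p : group => p.1.2 : R).
  by apply: (measurableT_comp (@measurable_snd2 R)); exact: measurable_fst.
have mt : measurable_fun setT (fun p : group => p.2 : R) by exact: measurable_snd.
have ms := measurable_sqrt my; have mv := measurable_sqrtV my.
have m2 : measurable_fun setT (fun _ : group => 2^-1 : R) by exact: measurable_cst.
have me : cmeasurable (fun p : group => expi (p.2 : R)).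
  split; [have h : measurable_fun [set: R] (@cos R) by apply: continuous_measurable_fun; exact: continuous_cos
         |have h : measurable_fun [set: R] (@sin R) by apply: continuous_measurable_fun; exact: continuous_sin];
  exact: (measurableT_comp h mt).
have mi : measurable_fun setT (fun p : group => - (p.1.1 * (Num.sqrt p.1.2)^-1 / 2) : R).
  apply: measurableT_comp => //; apply: measurable_funM => //; exact: measurable_funM.
split; apply: cmeasurableM me; split=> //=; apply: measurable_funM => //.
  exact: measurable_funD.
exact: measurable_funB.
Qed.

Definition iwasawa_domain : set group := ([set: R] `*` `]0, +oo[%classic) `*` `[0, 2 * pi[%classic.

Definition iwasawa_majorant (p : group) : R :=
  8 * ((oneDsqr p.1.1)^-1 * half_weight p.1.2) * \1_(`[0, 2 * pi[%classic : set RR) p.2.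

Lemma measurable_iwasawa_domain : measurable iwasawa_domain.
Proof. by apply: measurableX; [apply: measurableX => //|]; exact: measurable_itv. Qed.

Lemma measurable_iwasawa_majorant : measurable_fun setT iwasawa_majorant.
Proof.
have mJ : measurable (`[0, 2 * pi[%classic : set RR) by exact: measurable_itv.
have m1 : measurable_fun setT (fun p : group => p.1.1 : R).
  by apply: (measurableT_comp (@measurable_fst2 R)); exact: measurable_fst.
have m2 : measurable_fun setT (fun p : group => p.1.2 : R).
  by apply: (measurableT_comp (@measurable_snd2 R)); exact: measurable_fst.
apply: measurable_funM; last exact: (measurable_indicT mJ measurable_snd).
apply: measurable_funM; first exact: measurable_cst.
apply: measurable_funM; first exact: measurable_oneDsqrV.
exact: (measurableT_comp (@measurable_half_weight R) m2).
Qed.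

Lemma integral_iwasawa_majorant :
  (\int[((mu \x mu) \x mu)%E]_p (iwasawa_majorant p)%:E < +oo)%E.
Proof.
(* The inner product is replaced by an equal measure carrying the sigma-finite structure, and the
   triple integral is carried over to it before Tonelli is used. *)
have [A hA] := sigma_finite_product mu mu.
have I (f : RR * RR -> \bar R) : (\int[A]_p f p = \int[(mu \x mu)%E]_p f p)%E.
  by apply: eq_measure_integral => S _ _; exact: hA.
have e1 S : ((mu \x mu) \x mu)%E S = (A \x mu)%E S.
  exact: (esym (I (fun x => mu (xsection S x)))).
have e2 f : (\int[((mu \x mu) \x mu)%E]_p f p = \int[(A \x mu)%E]_p f p)%E.
  by apply: eq_measure_integral => S _ _; exact: e1.
have pi0 : 0 <= pi :> R by rewrite pi_ge0.
pose J : set RR := `[0, 2 * pi[%classic.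
have mJ : measurable J by exact: measurable_itv.
have muJ : mu J = (2 * pi)%:E.
  apply: etrans (lebesgue_measure_itv _) _; rewrite /= lte_fin mulr_gt0 ?pi_gt0 //.
  by rewrite -EFinB subr0.
have o0 (x : R) : 0 <= (oneDsqr x)^-1 by rewrite invr_ge0 (le_trans ler01 (oneDsqr_ge1 _)).
have h0 := @half_weight_ge0 R.
have mh := @measurable_half_weight R.
have mo : measurable_fun [set: RR] (fun x : RR => (oneDsqr (x : R))^-1).
  by apply: measurable_oneDsqrV; exact: measurable_id.
pose B (q : RR * RR) : R := 8 * ((oneDsqr q.1)^-1 * half_weight q.2).
have B0 q : 0 <= B q by rewrite mulr_ge0 // mulr_ge0.
have mB : measurable_fun setT B.
  apply: measurable_funM; first exact: measurable_cst.
  apply: measurable_funM; first exact: measurable_oneDsqrV (@measurable_fst2 R).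
  exact: (measurableT_comp mh (@measurable_snd2 R)).
have m0 p : (0 <= (iwasawa_majorant p)%:E)%E.
  by rewrite lee_fin /iwasawa_majorant mulr_ge0 // (B0 p.1).
have mm : measurable_fun setT (fun p => (iwasawa_majorant p)%:E).
  by apply/measurable_EFinP; exact: measurable_iwasawa_majorant.
rewrite e2 (fubini_tonelli1 _ mm m0) /fubini_F.
have -> : (\int[A]_q \int[mu]_t (iwasawa_majorant (q, t))%:E = \int[A]_q ((2 * pi)%:E * (B q)%:E))%E.
  apply: eq_integral => q _; rewrite /iwasawa_majorant -/(B q).
  under eq_integral do rewrite EFinM.
  rewrite ge0_integralZl_EFin //; last by apply/measurable_EFinP; exact: measurable_indic.
  rewrite muleC; congr (_ * _)%E; rewrite integral_indic // setIT; exact: muJ.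
rewrite ge0_integralZl_EFin //; last 3 first.
- by move=> q _; rewrite lee_fin.
- exact/measurable_EFinP.
- by rewrite mulr_ge0.
rewrite lte_mul_pinfty ?lee_fin ?mulr_ge0 // I.
have mBE : measurable_fun setT (fun q => (B q)%:E) by exact/measurable_EFinP.
have B0E q : (0 <= (B q)%:E)%E by rewrite lee_fin.
rewrite (fubini_tonelli1 _ mBE B0E) /fubini_F.
have -> : (\int[mu]_x \int[mu]_y (B (x, y))%:E =
    \int[mu]_x ((8 * (oneDsqr x)^-1)%:E * \int[mu]_y (half_weight y)%:E))%E.
  apply: eq_integral => x _; rewrite -ge0_integralZl_EFin ?mulr_ge0 //; last 2 first.
  - by move=> y _; rewrite lee_fin.
  - exact/measurable_EFinP.
  by apply: eq_integral => y _; rewrite -EFinM /B /= mulrA.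
have H0 : (0 <= \int[mu]_y (half_weight y)%:E)%E by apply: integral_ge0 => y _; rewrite lee_fin.
have Hf : (\int[mu]_y (half_weight y)%:E < +oo)%E by apply: le_lt_trans (integral_half_weight R) (ltry _).
under eq_integral do rewrite EFinM -muleA.
rewrite ge0_integralZl_EFin //; last 2 first.
- by move=> x _; rewrite mule_ge0 // lee_fin.
- apply: emeasurable_funM; [exact/measurable_EFinP|exact: measurable_cst].
rewrite lte_mul_pinfty ?lee_fin // ge0_integralZr //; last exact/measurable_EFinP.
by rewrite integral_oneDsqrV lte_mul_pinfty ?lee_fin.
Qed.

(** [phi] stands for the real or the imaginary part. As F is defined by a choice, measurability is
    read off the explicit expression [T], with which it agrees on the Iwasawa domain. *)
Lemma L1_part (phi : R[i] -> R) : (forall z, `|phi z| <= normc z) ->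
  (forall f : group -> R[i], cmeasurable f -> measurable_fun setT (fun p => phi (f p))) ->
  L1_SL2_real (fun g => phi (F k m g)).
Proof.
move=> hphi mphi; pose T (p : group) := Fzw k m (iwasawa_z p) (iwasawa_w p).
have my : measurable_fun setT (fun p : group => p.1.2 : R).
  by apply: (measurableT_comp (@measurable_snd2 R)); exact: measurable_fst.
have eqD p : iwasawa_domain p ->
    phi (F k m (n_ p.1.1 *m a_ p.1.2 *m r_ p.2)) / p.1.2 ^+ 2 = phi (T p) * (Num.sqrt p.1.2)^-1 ^+ 4.
  case: p => [[x y] t] [[_]]; rewrite /= in_itv /= andbT => y0 _.
  have [ez ew] := iwasawaE x y t.
  rewrite FE; last exact: SL2_iwasawa.
  by rewrite ez ew -/(T _) exprVn -[4%N]/(2 * 2)%N exprM sqr_sqrtr // ltW.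
have mD := measurable_iwasawa_domain.
have [mz mw] := measurable_iwasawa.
have mT : measurable_fun setT (fun p => phi (T p) * (Num.sqrt p.1.2)^-1 ^+ 4).
  apply: measurable_funM; first by apply: mphi; exact: cmeasurable_Fzw.
  by apply: measurable_funX; exact: measurable_sqrtV.
have maj0 p : 0 <= iwasawa_majorant p.
  have o0 : 0 <= (oneDsqr p.1.1)^-1 by rewrite invr_ge0 (le_trans ler01 (oneDsqr_ge1 _)).
  by rewrite /iwasawa_majorant mulr_ge0 // mulr_ge0 // mulr_ge0 // half_weight_ge0.
have mf : measurable_fun iwasawa_domain
    (fun p => (phi (F k m (n_ p.1.1 *m a_ p.1.2 *m r_ p.2)) / p.1.2 ^+ 2)%:E).
  apply: (eq_measurable_fun (fun p => (phi (T p) * (Num.sqrt p.1.2)^-1 ^+ 4)%:E)).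
    by move=> p; rewrite inE => Dp; rewrite eqD.
  by apply: measurable_funTS; exact/measurable_EFinP.
rewrite /L1_SL2_real; apply/integrableP; split.
  exact: mf.
apply: le_lt_trans integral_iwasawa_majorant.
rewrite [leLHS]integral_mkcond; apply: ge0_le_integral => //.
- by move=> p _; rewrite patchE; case: ifPn => // _; exact: abse_ge0.
- by apply: (measurable_restrictT _ mD).1; exact: measurableT_comp.
- apply/measurable_EFinP; exact: measurable_iwasawa_majorant.
move=> p _; rewrite patchE; case: ifPn => [|_]; last by rewrite lee_fin.
rewrite inE => Dp; rewrite eqD // abse_EFin lee_fin normrM.
rewrite [X in _ * X <= _]ger0_norm ?exprn_ge0 ?invr_ge0 ?sqrtr_ge0 //.
have [[_ y0] t0] := Dp; move: y0 t0; rewrite /= in_itv /= andbT => y0 t0.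
rewrite /iwasawa_majorant indic_in // mulr1.
apply: le_trans (iwasawa_bound p.1.1 p.2 y0).
rewrite ler_wpM2r ?exprn_ge0 ?invr_ge0 ?sqrtr_ge0 //.
apply: le_trans (hphi _) _; rewrite FE; last exact: SL2_iwasawa.
have [-> ->] := iwasawaE p.1.1 p.1.2 p.2.
by rewrite /T; case: p {Dp y0 t0} => [[x y] t].
Qed.

Lemma F_L1 : L1_SL2 (@F R k m).
Proof.
split; apply: L1_part => [z|f []//]; [exact: Re_le_normc|exact: Im_le_normc].
Qed.

End Iwasawa.

(** The condition is strict and, with the denominator cleared, continuous in M, so it persists a
    little above the median, where the inner mass is strictly larger than the outer one. *)
Lemma exists_above (R : realType) (M : R) (N : nat) : 0 < M -> M < 1 ->
  4 * Num.sqrt M / (1 - M) < N%:R ->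
  exists M', [/\ M < M', M' < 1 & 4 * Num.sqrt M' / (1 - M') < N%:R].
Proof.
move=> M0 M1 h; pose f x := N%:R * (1 - x) - 4 * Num.sqrt x : R.
have cf : continuous f.
  move=> x; apply: cvgB; apply: cvgM; do ?[exact: cvg_cst|exact: sqrt_continuous].
  by apply: cvgB; [exact: cvg_cst|exact: cvg_id].
have fM : 0 < f M by move: h; rewrite /f ltr_pdivrMr ?subr_gt0.
have /nbhs_ballP[e /= e0 he] : \forall x \near M, 0 < f x by exact: (cvgr_gt (f M) (cf M) _ fM).
pose M' := M + Num.min e (1 - M) / 2.
have d0 : 0 < Num.min e (1 - M) by rewrite lt_min e0 subr_gt0.
have d1 : Num.min e (1 - M) <= e by rewrite ge_min lexx.
have d2 : Num.min e (1 - M) <= 1 - M by rewrite ge_min lexx orbT.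
have MM' : M < M' by rewrite /M'; lra.
have M'1 : M' < 1 by rewrite /M'; lra.
exists M'; split => //.
have : 0 < f M'.
  by apply: he; rewrite /ball /= ler0_norm ?subr_le0 ?(ltW MM') // /M'; lra.
by rewrite /f ltr_pdivrMr ?subr_gt0 // subr_gt0.
Qed.

Theorem proposition6p11 (R : realType) (m k : nat) (hm : (3 <= m)%N)
  (N : nat) (hN : (0 < N)%N)
  (Gamma : set 'M[int]_2) (hGamma : is_subgroup Gamma)
  (hGammaN : Gamma `<=` principal_congruence N)
  (hcard : (#|` fset_set (cap_SO2 R Gamma)| %| m + 2 * k)%N)
  (hmedian :
    let M := beta_median (k%:R / 2 + 1 : R) (m%:R / 2 - 1) in
    N%:R > 4 * Num.sqrt M / (1 - M)) :
  [/\ smooth_SL2 (@F R k m),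
      L1_SL2 (@F R k m),
      forall g, SL2 g -> csummable Gamma (PoincareTerm (@F R k m) g),
      smooth_quotient Gamma (Poincare Gamma (@F R k m))
    & exists g, SL2 g /\ Poincare Gamma (@F R k m) g <> 0].
Proof.
have GammaZ : Gamma `<=` SL2Z by move=> g /hGammaN[].
have [a1 b1] := @beta_shape R k m hm; have [/andP[M0 M1] _] := beta_medianP a1 b1.
have [M [medM M1' NM]] := exists_above M0 M1 hmedian.
split.
- exact: F_smooth.
- exact: F_L1.
- by move=> g Sg; exact: csummable_F.
- split; first exact: Poincare_smooth.
  by move=> gamma g Gg _; exact: Poincare_invariant.
- exact: (nonvanishing hm hN hGamma hGammaN hcard medM M1' NM).
Qed.
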